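(* Let $\mathcal{A}$ and $\mathcal{B}$ satisfy assumptions (B) and (A) stated in the context. Let $u_0\in\mathcal{V}$ with $\mathcal{B}u_0=g(0)$, let $g\in H^2(0,T;\mathcal{Q}^* )$, and let $f\colon[0,T]\times\mathcal{V}\to\mathcal{H}$ satisfy: (1) $v\mapsto f(t,v)$ is continuous for almost all $t\in[0,T]$, and $t\mapsto f(t,v)$ is measurable for all $v\in\mathcal{V}$; (2) there exists $k\in L^2(0,T)$ with $\|f(t,v)\|_{\mathcal{H}}\le k(t)(1+\|v\|_{\mathcal{V}})$ for all $v\in\mathcal{V}$ and almost all $t\in[0,T]$; (3) for every $v\in\mathcal{V}$ there exist $r=r(v)>0$ and $L(v)\ge0$ such that for almost every $t\in[0,T]$, $\|f(t,v_1)-f(t,v_2)\|_{\mathcal{H}}\le L(v)\|v_1-v_2\|_{\mathcal{V}}$ for all $v_1,v_2$ in the open ball $B_r(v)\subseteq\mathcal{V}$. Let $(u,\lambda)$ be the solution, with $u\in C([0,T];\mathcal{V})\cap H^1(0,T;\mathcal{H})$, $\lambda\in L^2(0,T;\mathcal{Q})$, of $$\dot u(t)+\mathcal{A}u(t)+\mathcal{B}^*\lambda(t)=f(t,u(t))\ \text{ in }\mathcal{V}^*,\qquad \mathcal{B}u(t)=g(t)\ \text{ in }\mathcal{Q}^*,\qquad u(0)=u_0,$$ and assume $\frac{\mathrm{d}}{\mathrm{d}t}f(\cdot,u(\cdot))\in L^2(0,T;\mathcal{H})$. Let the step size $\tau$ be sufficiently small such that the approximations $u_n$ produced by the exponential Euler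 scheme (defined in the context) lie within a strip along $u$ in which $f$ is locally Lipschitz continuous with a uniform constant $L>0$. Then $$\|u_n-u(t_n)\|_{\mathcal{V}}^2\ \le\ C\,\tau^2\int_0^{t_n}\Big(\big\|\tfrac{\mathrm{d}}{\mathrm{d}t}f(t,u(t))\big\|_{\mathcal{H}}^2+\|\mathcal{B}^-\ddot g(t)\|_{\mathcal{H}}^2\Big)\,\mathrm{d}t ,$$ where the constant $C$ depends only on $t_n$, $L$, and the operator $\mathcal{A}$.
   Context: $T>0$. $\mathcal{V}$, $\mathcal{Q}$, $\mathcal{H}$ are Hilbert spaces, and $\mathcal{V},\mathcal{H},\mathcal{V}^*$ form a Gelfand triple: $\mathcal{V}$ is continuously and densely embedded in $\mathcal{H}$, and $\mathcal{H}\equiv\mathcal{H}^*\hookrightarrow\mathcal{V}^*$. $\langle\cdot,\cdot\rangle$ denotes duality pairings, $\mathcal{B}^*\colon\mathcal{Q}\to\mathcal{V}^*$ is the dual operator of $\mathcal{B}$, and $L^2(0,T;X)$, $H^m(0,T;X)$ are Sobolev–Bochner spaces. Evolution equations are understood for almost every $t$. Assumption (B): $\mathcal{B}\colon\mathcal{V}\to\mathcal{Q}^*$ is linear, continuous, and there is $\beta>0$ with $\inf_{q\in\mathcal{Q}\setminus\{0\}}\sup_{v\in\mathcal{V}\setminus\{0\}}\frac{\langle\mathcal{B}v,q\rangle}{\|v\|_{\mathcal{V}}\|q\|_{\mathcal{Q}}}\ge\beta$. Assumption (A): $\mathcal{A}\colon\mathcal{V}\to\mathcal{V}^*$ is linear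 and continuous, $\mathcal{A}=\mathcal{A}_1+\mathcal{A}_2$ with $\mathcal{A}_1\in\mathcal{L}(\mathcal{V},\mathcal{V}^* )$ self-adjoint and $\mathcal{A}_2\in\mathcal{L}(\mathcal{V},\mathcal{H})$; moreover $\mathcal{A}$ is elliptic on $\mathcal{V}_{\ker}:=\ker\mathcal{B}$, i.e. there is $\mu_{\mathcal{A}}>0$ with $\langle\mathcal{A}v,v\rangle\ge\mu_{\mathcal{A}}\|v\|_{\mathcal{V}}^2$ for all $v\in\mathcal{V}_{\ker}$. Right-inverse: $\mathcal{V}_{\mathrm{c}}:=\{v\in\mathcal{V}\mid\langle\mathcal{A}v,w\rangle=0\text{ for all }w\in\mathcal{V}_{\ker}\}$, and $\mathcal{B}^-\colon\mathcal{Q}^*\to\mathcal{V}$ is the right-inverse of $\mathcal{B}$ with image $\mathcal{V}_{\mathrm{c}}$. Equivalently, $x=\mathcal{B}^-h$ is the first component of the solution $(x,\nu)\in\mathcal{V}\times\mathcal{Q}$ of $\mathcal{A}x+\mathcal{B}^*\nu=0$ in $\mathcal{V}^*$, $\mathcal{B}x=h$ in $\mathcal{Q}^*$. Strip: that $f$ is locally Lipschitz with uniform constant $L$ in a strip along $u$ which contains the $u_n$ means that there is a radius $r>0$ such that $\|f(t,v_1)-f(t,v_2)\|_{\mathcal{H}}\le L\|v_1-v_2\|_{\mathcal{V}}$ for all $t\in[0,T]$ and all $v_1,v_2\in\mathcal{V}$ with $\|v_i-u(t)\|_{\mathcal{V}}<r$, and $\|u_n-u(t_n)\|_{\mathcal{V}}<r$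 for all $n$. The condition on $\frac{\mathrm{d}}{\mathrm{d}t}f(\cdot,u(\cdot))$ means that $t\mapsto f(t,u(t))$ is absolutely continuous from $[0,T]$ to $\mathcal{H}$ with derivative in $L^2(0,T;\mathcal{H})$. Exponential Euler scheme: let $N\in\mathbb{N}$, $\tau=T/N$, $t_n=n\tau$, $g_n=g(t_n)$, $\dot g_n=\dot g(t_n)$. Starting from $u_0$, for $n=0,\dots,N-1$: (i) let $(w_n,\nu_n)\in\mathcal{V}\times\mathcal{Q}$ be the solution of $\mathcal{A}w_n+\mathcal{B}^*\nu_n=f(t_n,u_n)-\mathcal{B}^-\dot g_n$ in $\mathcal{V}^*$, $\mathcal{B}w_n=0$ in $\mathcal{Q}^*$; (ii) let $z$ (with multiplier $\mu$) be the solution on $[t_n,t_{n+1}]$ of $\dot z(t)+\mathcal{A}z(t)+\mathcal{B}^*\mu(t)=0$ in $\mathcal{V}^*$, $\mathcal{B}z(t)=0$ in $\mathcal{Q}^*$, with $z(t_n)=u_n-\mathcal{B}^-g_n-w_n$; (iii) set $u_{n+1}=\mathcal{B}^-g_{n+1}+z(t_{n+1})+w_n$. *)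

(* Defs.v *)
From HB Require Import structures.
From mathcomp Require Import all_boot all_order all_algebra.
From mathcomp Require Import ring.
From mathcomp Require Import all_classical all_reals all_analysis.

Set Implicit Arguments.
Unset Strict Implicit.
Unset Printing Implicit Defensive.

Import Order.TTheory GRing.Theory Num.Theory.
Import numFieldNormedType.Exports.

Local Open Scope classical_set_scope.
Local Open Scope ring_scope.

HB.mixin Record NormedModule_isHilbert (R : realType) V
    & NormedModule R V := {
  inner : V -> V -> R;
  innerC : forall u v, inner u v = inner v u;
  innerPl : forall (a : R) u v w,
    inner (a *: u + v) w = a * inner u w + inner v w;
  inner_norm : forall v, inner v v = `|v| ^+ 2
}.

#[short(type="hilbertType")]
HB.structure Definition Hilbert (R : realType) :=
  {V of CompleteNormedModule R V & NormedModule_isHilbert R V}.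

Section operators.
Context {R : realType}.

Definition oper_pred (V W : normedModType R) : {pred V -> W} :=
  [pred f : V -> W | `[< linear f /\ continuous f >]].

Record oper (V W : normedModType R) := Oper {
  oper_fun :> V -> W;
  operP : oper_fun \in @oper_pred V W }.

HB.instance Definition _ (V W : normedModType R) := [isSub for @oper_fun V W].
HB.instance Definition _ (V W : normedModType R) := [Choice of oper V W by <:].

Lemma oper_pred_submod (V W : normedModType R) : submod_closed (@oper_pred V W).
Proof.
split=> [|a f g].
  apply/asboolP; split=> [b u v /=|].
    by rewrite [RHS]addr0 [RHS]scaler0.
  by move=> x; exact: cvg_cst.
move=> /asboolP[lf cf] /asboolP[lg cg]; apply/asboolP; split.
  move=> b u v /=; rewrite [LHS]/(a *: f (b *: u + v) + g (b *: u + v)).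
  rewrite [RHS]/(b *: (a *: f u + g u) + (a *: f v + g v)).
  rewrite lf lg !scalerDr !scalerA [b * a]mulrC.
  exact: addrACA.
move=> x; apply: (@cvgD _ _ _ _ _ (fun x => a *: f x) g); last exact: cg.
by apply: cvgZl_tmp; exact: cf.
Qed.

HB.instance Definition _ (V W : normedModType R) :=
  GRing.isSubmodClosed.Build R (V -> W) (@oper_pred V W) (oper_pred_submod V W).
HB.instance Definition _ (V W : normedModType R) :=
  [SubChoice_isSubLmodule of oper V W by <:].

Section operator_norm.
Variables V W : normedModType R.
Implicit Types f : oper V W.

Lemma oper_linear f : linear f.
Proof. by have /asboolP[] := operP f. Qed.

HB.instance Definition _ f :=
  GRing.isLinear.Build R V W *:%R (oper_fun f) (oper_linear f).

Lemma oper_continuous f : continuous f.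
Proof. by have /asboolP[] := operP f. Qed.

Definition opnorm f : R := sup [set `|f v| | v in [set v : V | `|v| <= 1]].

Lemma opnorm_has_sup f : has_sup [set `|f v| | v in [set v : V | `|v| <= 1]].
Proof.
split; first by exists `|f 0|, 0 => //=; rewrite normr0.
have /linear_bounded_continuous/bounded_funP/(_ 1)[M fM] :=
  @oper_continuous f.
by exists M => _ [v /= v1 <-]; exact: fM.
Qed.

Lemma opnorm_ub f v : `|v| <= 1 -> `|f v| <= opnorm f.
Proof.
by move=> v1; apply: sup_upper_bound; [exact: opnorm_has_sup|exists v].
Qed.

Lemma opnorm_le f M : (forall v, `|v| <= 1 -> `|f v| <= M) -> opnorm f <= M.
Proof.
move=> fM; apply: ge_sup; first by have [] := opnorm_has_sup f.
by move=> _ [v /= v1 <-]; exact: fM.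
Qed.

Lemma oper_bound f v : `|f v| <= opnorm f * `|v|.
Proof.
have [->|v0] := eqVneq v 0; first by rewrite linear0 !normr0 mulr0.
have nv : 0 < `|v| by rewrite normr_gt0.
rewrite -ler_pdivrMr// mulrC -[`|v|^-1]ger0_norm ?invr_ge0// -normrZ -linearZ.
by apply: opnorm_ub; rewrite normfZV.
Qed.

Lemma ler_opnormD f g : opnorm (f + g) <= opnorm f + opnorm g.
Proof.
apply: opnorm_le => v v1; rewrite (le_trans (ler_normD _ _))//.
by apply: lerD; exact: opnorm_ub.
Qed.

Lemma opnormZ_le (a : R) f : opnorm (a *: f) <= `|a| * opnorm f.
Proof.
apply: opnorm_le => v v1; rewrite [(a *: f) v]/(a *: f v) normrZ.
by rewrite ler_wpM2l// opnorm_ub.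
Qed.

Lemma opnormZ (a : R) f : opnorm (a *: f) = `|a| * opnorm f.
Proof.
apply/eqP; rewrite eq_le opnormZ_le /=.
have [->|a0] := eqVneq a 0.
  rewrite normr0 mul0r (le_trans (normr_ge0 ((0 *: f) 0)))//.
  by apply: opnorm_ub; rewrite normr0.
rewrite -ler_pdivlMl ?normr_gt0// -normfV.
by rewrite -{1}[f](scalerK a0) opnormZ_le.
Qed.

Lemma opnorm_eq0 f : opnorm f = 0 -> f = 0.
Proof.
move=> f0; apply/val_inj/funext => v; apply/eqP.
by rewrite -normr_le0 (le_trans (oper_bound f v))// f0 mul0r.
Qed.

HB.instance Definition _ := Lmodule_isNormed.Build R (oper V W)
  ler_opnormD opnormZ opnorm_eq0.

End operator_norm.

Definition dual (V : normedModType R) := oper V R^o.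
HB.instance Definition _ (V : normedModType R) := NormedModule.on (dual V).

Lemma oper_subproof (V W : normedModType R) (f : V -> W) (M : R) :
  linear f -> (forall v, `|f v| <= M * `|v|) -> f \in @oper_pred V W.
Proof.
move=> lf fM; apply/asboolP; split => //.
pose f' := GRing.isLinear.Build R V W *:%R f lf.
pose F : {linear V -> W} := HB.pack f f'.
apply: (@bounded_linear_continuous _ _ _ F); apply/bounded_funP => r.
exists (`|M| * r) => x xr; apply: (le_trans (fM x)).
rewrite (@le_trans _ _ (`|M| * `|x|))// ?ler_wpM2r ?ler_norm//.
by rewrite ler_wpM2l.
Qed.

Lemma adjoint_subproof (V Q : normedModType R) (B : oper V (dual Q)) (q : Q) :
  (fun v : V => B v q : R^o) \in @oper_pred V R^o.
Proof.
apply: (@oper_subproof _ _ _ (opnorm B * `|q|)) => [a u v|v].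
  by rewrite linearP.
rewrite (le_trans (oper_bound (B v) q))// mulrAC ler_wpM2r//.
exact: (oper_bound B v).
Qed.

(** The dual operator [B^* : Q -> V^*] of [B : V -> Q^*], Q being reflexive. *)
Definition adjoint (V Q : normedModType R) (B : oper V (dual Q)) (q : Q) :
  dual V := Oper (adjoint_subproof B q).

Lemma inner0l (H : hilbertType R) (h : H) : inner 0 h = 0.
Proof.
by have := innerPl 1 0 0 h; rewrite scaler0 addr0 mul1r -{1}[inner 0 h]addr0
  => /addrI.
Qed.

Lemma innerZl (H : hilbertType R) a (h k : H) : inner (a *: h) k = a * inner h k.
Proof. by have := innerPl a h 0 k; rewrite !addr0 inner0l addr0. Qed.

Lemma innerPr (H : hilbertType R) (a : R) (h u v : H) :
  inner h (a *: u + v) = a * inner h u + inner h v.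
Proof. by rewrite innerC innerPl ![inner _ h]innerC. Qed.

Lemma cauchy_schwarz (H : hilbertType R) (h k : H) :
  `|inner h k| <= `|h| * `|k|.
Proof.
rewrite -(@ler_pXn2r _ 2) ?nnegrE ?mulr_ge0// exprMn -normrX ger0_norm ?sqr_ge0//.
have [->|k0] := eqVneq k 0.
  by rewrite innerC inner0l expr0n/= mulr_ge0.
have nk : 0 < `|k| ^+ 2 by rewrite exprn_gt0// normr_gt0.
pose a := - (inner h k / `|k| ^+ 2).
have : 0 <= inner (a *: k + h) (a *: k + h) by rewrite inner_norm sqr_ge0.
rewrite innerPl !innerPr !inner_norm [inner k h]innerC.
rewrite -(pmulr_lge0 _ nk) (_ : _ * _ = `|h| ^+ 2 * `|k| ^+ 2 - inner h k ^+ 2).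
  by rewrite subr_ge0.
rewrite /a; field; by rewrite normr_eq0.
Qed.

Lemma embed_dual_subproof (V : normedModType R) (H : hilbertType R)
  (i : oper V H) (h : H) : (fun v : V => inner h (i v) : R^o) \in @oper_pred V R^o.
Proof.
apply: (@oper_subproof _ _ _ (`|h| * opnorm i)) => [a u v|v].
  by rewrite linearP innerPr.
by rewrite (le_trans (cauchy_schwarz _ _))// -mulrA ler_wpM2l// oper_bound.
Qed.

(** The embedding of H into [V^*] obtained by identifying H with its dual. *)
Definition embed_dual (V : normedModType R) (H : hilbertType R)
    (i : oper V H) (h : H) : dual V := Oper (embed_dual_subproof i h).

Definition gelfand_triple (V H : hilbertType R) (i : oper V H) :=
  injective i /\ closure (range i) = setT.

Local Notation mu := (@lebesgue_measure R).

Section bochner.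
Variable X : normedModType R.

Definition simple_fun (s : R -> X) :=
  finite_set (range s) /\ forall x, measurable (s @^-1` [set x]).

Definition simple_integral (D : set R) (s : R -> X) : X :=
  \sum_(x \in range s) fine (mu (D `&` s @^-1` [set x])) *: x.

(** Bochner measurability; as the limit holds only a.e., it does not matter
    that [measurable] means Borel measurable here. *)
Definition strongly_measurable (D : set R) (f : R -> X) :=
  exists s : nat -> R -> X, (forall n, simple_fun (s n)) /\
    {ae mu, forall t, D t -> s n t @[n --> \oo] --> f t}.

(** [x] is the Bochner integral of [f] over a set [D] of finite measure. *)
Definition is_bochner_integral (D : set R) (f : R -> X) (x : X) :=
  exists s : nat -> R -> X, [/\ forall n, simple_fun (s n),
    {ae mu, forall t, D t -> s n t @[n --> \oo] --> f t},
    (\int[mu]_(t in D) (`|f t - s n t|%:E))%E @[n --> \oo] --> 0%E &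
    simple_integral D (s n) @[n --> \oo] --> x].

Definition bochner_L2 (a b : R) (f : R -> X) :=
  strongly_measurable `[a, b] f /\
  (\int[mu]_(t in `[a, b]) ((`|f t| ^+ 2)%:E) < +oo)%E.

Definition test_function (a b : R) (phi : R -> R) :=
  (forall n t, derivable (derive1n n phi) t 1) /\
  exists c d, [/\ a < c, d < b & forall t, t \notin `[c, d] -> phi t = 0].

Definition weak_derivative (a b : R) (x dx : R -> X) :=
  forall phi, test_function a b phi ->
  exists2 y, is_bochner_integral `[a, b] (fun t => derive1 phi t *: x t) y &
             is_bochner_integral `[a, b] (fun t => phi t *: dx t) (- y).

(** [x] is in H^1(a, b; X) with derivative [dx]. *)
Definition bochner_H1 (a b : R) (x dx : R -> X) :=
  [/\ bochner_L2 a b x, bochner_L2 a b dx & weak_derivative a b x dx].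

(** [x] is in H^2(a, b; X) with derivatives [dx] and [ddx]; since point values
    of [x] and [dx] are used, these are the continuous representatives. *)
Definition bochner_H2 (a b : R) (x dx ddx : R -> X) :=
  [/\ bochner_H1 a b x dx, bochner_H1 a b dx ddx,
      {within `[a, b], continuous x} & {within `[a, b], continuous dx}].

Definition abs_continuous (a b : R) (x : R -> X) :=
  forall e : R, 0 < e -> exists2 d : R, 0 < d &
  forall n (s t : 'I_n -> R),
    (forall j, [/\ a <= s j, s j <= t j & t j <= b]) ->
    trivIset setT (fun j => `]s j, t j[%classic) ->
    \sum_j (t j - s j) < d -> \sum_j `|x (t j) - x (s j)| < e.

(** [x] is absolutely continuous, with a.e. derivative [dx] in L^2. *)
Definition abs_continuous_L2 (a b : R) (x dx : R -> X) :=
  [/\ abs_continuous a b x,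
      {ae mu, forall t, t \in `[a, b] -> is_derive t (1 : R) x (dx t)} &
      bochner_L2 a b dx].

End bochner.

Definition operator_kernel (V Q : normedModType R) (B : oper V (dual Q)) :=
  [set v | B v = 0].

Definition inf_sup_stable (V Q : normedModType R) (B : oper V (dual Q))
    (beta : R) :=
  (beta%:E <= ereal_inf [set ereal_sup
      [set (B v q / (`|v| * `|q|))%:E | v in [set v : V | v != 0%R]]
    | q in [set q : Q | q != 0%R]])%E.

Definition assumption_B (V Q : normedModType R) (B : oper V (dual Q)) :=
  exists2 beta : R, 0 < beta & inf_sup_stable B beta.

Definition self_adjoint (V : normedModType R) (A : oper V (dual V)) :=
  forall v w, A v w = A w v.

Definition splitting (V H : hilbertType R) (i : oper V H)
    (A A1 : oper V (dual V)) (A2 : oper V H) :=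
  self_adjoint A1 /\ forall v, A v = A1 v + embed_dual i (A2 v).

Definition elliptic_on (V : normedModType R) (A : oper V (dual V))
    (K : set V) (muA : R) :=
  forall v, K v -> muA * `|v| ^+ 2 <= A v v.

Definition Vc (V Q : normedModType R) (A : oper V (dual V))
    (B : oper V (dual Q)) : set V :=
  [set v | forall w, operator_kernel B w -> A v w = 0].

Definition right_inverse_onto_Vc (V Q : normedModType R) (A : oper V (dual V))
    (B : oper V (dual Q)) (Bm : dual Q -> V) :=
  (forall h, B (Bm h) = h) /\ range Bm = Vc A B.

(** [(x, lam)] solves, on [a, b],
    x' + A x + B^* lam = F in [V^*],  B x = G in [Q^*],  x(a) = x0. *)
Definition constrained_solution (V H Q : hilbertType R) (i : oper V H)
    (A : oper V (dual V)) (B : oper V (dual Q)) (a b : R)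
    (F : R -> H) (G : R -> dual Q) (x0 : V) (x : R -> V) (lam : R -> Q) :=
  {within `[a, b], continuous x} /\
  bochner_L2 a b lam /\
  x a = x0 /\
  exists2 dx : R -> H, bochner_H1 a b (i \o x) dx &
  {ae mu, forall t, t \in `[a, b] ->
    embed_dual i (dx t) + A (x t) + adjoint B (lam t) = embed_dual i (F t) /\
    B (x t) = G t}.

Section nonlinearity.
Variables V H : hilbertType R.
Implicit Types f : R -> V -> H.

Definition caratheodory (T : R) f :=
  {ae mu, forall t, t \in `[0, T] -> continuous (f t)} /\
  forall v, strongly_measurable `[0, T] (fun t => f t v).

Definition linear_growth (T : R) f :=
  exists2 k : R -> R, bochner_L2 0 T (k : R -> R^o) &
  {ae mu, forall t, t \in `[0, T] ->
    forall v, `|f t v| <= k t * (1 + `|v|)}.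

Definition locally_lipschitz (T : R) f :=
  forall v : V, exists r L : R, [/\ 0 < r, 0 <= L &
  {ae mu, forall t, t \in `[0, T] ->
    forall v1 v2, ball v r v1 -> ball v r v2 ->
    `|f t v1 - f t v2| <= L * `|v1 - v2|}].

Definition lipschitz_in_strip (T : R) f (u : R -> V) (N : nat)
    (tn : nat -> R) (un : nat -> V) (L : R) :=
  exists r : R, [/\ 0 < r,
    forall t v1 v2, t \in `[0, T] -> `|v1 - u t| < r -> `|v2 - u t| < r ->
      `|f t v1 - f t v2| <= L * `|v1 - v2| &
    forall n, (n <= N)%N -> `|un n - u (tn n)| < r].

End nonlinearity.

Section scheme.
Variables (V H Q : hilbertType R) (i : oper V H) (A : oper V (dual V)).
Variables (B : oper V (dual Q)) (Bm : dual Q -> V) (f : R -> V -> H).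
Variables (g dg : R -> dual Q).

(** From the approximation [un] at time [s] to [un1] at time [t]; the
    constraint [B z = 0] is the zero right-hand side [fun=> 0 : Q^*]. *)
Definition exp_euler_step (s t : R) (un un1 : V) :=
  exists (w : V) (nu : Q) (z : R -> V) (m : R -> Q),
  [/\ A w + adjoint B nu = embed_dual i (f s un - i (Bm (dg s))),
      B w = 0,
      constrained_solution i A B s t (fun=> 0) (fun=> 0)
        (un - Bm (g s) - w) z m &
      un1 = Bm (g t) + z t + w].

Definition grid (T : R) (N n : nat) : R := n%:R * (T / N%:R).

Definition exp_euler (T : R) (N : nat) (u0 : V) (un : nat -> V) :=
  un 0%N = u0 /\ forall n, (n < N)%N ->
  exp_euler_step (grid T N n) (grid T N n.+1) (un n) (un n.+1).

End scheme.

End operators.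

(* Main.v *)
Require Import Defs.
From mathcomp Require Import all_boot all_order all_algebra.
From mathcomp Require Import ring lra.
From mathcomp Require Import all_classical all_reals all_analysis measurable_realfun.
Import Order.TTheory GRing.Theory Num.Theory.
Import numFieldNormedType.Exports.
Local Open Scope classical_set_scope.
Local Open Scope ring_scope.

Set Implicit Arguments.
Unset Strict Implicit.
Unset Printing Implicit Defensive.

(** The error of one exponential Euler step is the value at the end of the step
    of a function [d] with values in the kernel of [B] that solves
    [d' + A d + B^* m = F], where
    [F(t) = f(t_n, u_n) - f(t, u(t)) + B^- (dg(t) - dg(t_n))] is continuous in
    time with values in [H]: inside a step the scheme solves the constrained
    equation exactly, with the right-hand side frozen at [t_n].  On the step
    [|F|] is at most [L |e_n|] plus the increments of [f(., u(.))] and of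
    [B^- dg], and by the Cauchy-Schwarz inequality the squares of these
    increments are at most [tau] times the integrals of [|df|^2] and
    [|B^- ddg|^2] over the step ([abs_continuous_increment_sqr] and
    [weak_derivative_increment_closed]).

    Stability comes from the energy [E(v) = A1(v, v) + k |i v|^2], with [k] so
    large that [E] is coercive on the kernel of [B] ([energy_form_coercive]).
    Testing the equation with [d'] gives
    [E(d)' <= rate * E(d) + 3/2 |F|^2] ([energy_dissipation]), and Gronwall's
    inequality bounds [E] at the end of the step ([energy_estimate]).  Summing
    over the steps ([error_recursion]) yields the theorem with
    [C(t, L) = 9 / muA * exp ((rate + 9 L^2 / muA) t)].

    The test function [d'] takes values in [H] only, whereas [A1] needs [V].
    So the equation is first averaged over [[t, t + h]]: the average
    [m(t) = (P(t + h) - P(t)) / h], where [P] is a primitive of [d] in [V]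
    ([hilbert_primitive]), is differentiable with values in the kernel of [B],
    the averaged equation is tested with [m'] ([average_energy]), and [h] tends
    to [0] at the two ends of the step.  This only uses the equation tested
    with fixed [w] in the kernel of [B].  There the multiplier drops out and the
    weak derivative of [t |-> (i (d t), i w)] is a continuous function, hence a
    classical derivative ([weak_derivative_is_derive], a consequence of
    [du_bois_reymond]).

    The remaining ingredient is that [B^-] is linear and bounded
    ([right_inverse_bounded]).  It follows from the inf-sup condition, which
    makes the form [(B^* q, B^* p)] coercive on [Q], and from the Lax-Milgram
    theorem. *)

(** * Bilinear forms and inner products *)

Lemma ler_sqr_eps (R : realFieldType) (x K : R) :
  (forall e : R, 0 < e -> x ^+ 2 <= K * e) -> x = 0.
Proof.
move=> h; have : x ^+ 2 <= 0.
  apply/ler_addgt0Pr => e e0; rewrite add0r.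
  have K1 : 0 < `|K| + 1 by rewrite ltr_wpDl.
  apply: (le_trans (h (e / (`|K| + 1)) _)); first by rewrite divr_gt0.
  rewrite mulrCA ger_pMr// ler_pdivrMr// mul1r.
  by rewrite (le_trans (ler_norm K))// lerDl.
by move=> x2; apply/eqP; rewrite -sqrf_eq0 eq_le x2 sqr_ge0.
Qed.

Section bilinear.
Context {R : realType} (V : lmodType R) (a : V -> V -> R).
Hypothesis aC : forall u v, a u v = a v u.
Hypothesis aP : forall c u v w, a (c *: u + v) w = c * a u w + a v w.

Lemma form_Dl u v w : a (u + v) w = a u w + a v w.
Proof. by have := aP 1 u v w; rewrite scale1r mul1r. Qed.
Lemma form_0l w : a 0 w = 0.
Proof. by apply: (addrI (a 0 w)); rewrite -form_Dl !addr0. Qed.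
Lemma form_Zl c u w : a (c *: u) w = c * a u w.
Proof. by have := aP c u 0 w; rewrite !addr0 form_0l addr0. Qed.
Lemma form_Nl u w : a (- u) w = - a u w.
Proof. by rewrite -scaleN1r form_Zl mulN1r. Qed.
Lemma form_Dr u v w : a w (u + v) = a w u + a w v.
Proof. by rewrite aC form_Dl !(aC w). Qed.
Lemma form_Zr c u w : a w (c *: u) = c * a w u.
Proof. by rewrite aC form_Zl !(aC w). Qed.
Lemma form_Nr u w : a w (- u) = - a w u.
Proof. by rewrite aC form_Nl !(aC w). Qed.
Definition formE := (form_Dl, form_Dr, form_Nl, form_Nr, form_Zl, form_Zr).
End bilinear.

Section inner_lemmas.
Context {R : realType} (H : hilbertType R).
Implicit Types u v w : H.
Lemma innerDl u v w : inner (u + v) w = inner u w + inner v w.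
Proof. exact: (form_Dl (@innerPl _ H)). Qed.
Lemma innerNl u w : inner (- u) w = - inner u w.
Proof. exact: (form_Nl (@innerPl _ H)). Qed.
Lemma innerZr c u w : inner w (c *: u) = c * inner w u.
Proof. exact: (form_Zr (@innerC _ H) (@innerPl _ H)). Qed.

Lemma inner_inj u v : (forall w, inner u w = inner v w) -> u = v.
Proof.
move=> uv; apply/eqP; rewrite -subr_eq0 -normr_eq0 -sqrf_eq0 -inner_norm.
by rewrite innerDl innerNl uv subrr.
Qed.

Lemma inner_le u v : inner u v <= `|u| * `|v|.
Proof. exact: le_trans (ler_norm _) (cauchy_schwarz _ _). Qed.
End inner_lemmas.

Section dual_operator.
Context {R : realType} (V W : normedModType R) (A : oper V (dual W)).

Lemma operPl c u v w : A (c *: u + v) w = c * A u w + A v w.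
Proof. by rewrite oper_linear. Qed.
Lemma operDl u v w : A (u + v) w = A u w + A v w.
Proof. by rewrite linearD. Qed.
Lemma operNl u w : A (- u) w = - A u w.
Proof. by rewrite linearN. Qed.
Lemma operZl c u w : A (c *: u) w = c * A u w.
Proof. by rewrite linearZ. Qed.
Lemma operBl u v w : A (u - v) w = A u w - A v w.
Proof. by rewrite operDl operNl. Qed.

Lemma oper_bound2 u w : `|A u w| <= opnorm A * `|u| * `|w|.
Proof.
rewrite (le_trans (oper_bound (A u) w))// ler_wpM2r//.
exact: (oper_bound A u).
Qed.
End dual_operator.

Lemma opnorm_ge0 {R : realType} (V W : normedModType R) (f : oper V W) :
  0 <= opnorm f.
Proof. by rewrite (le_trans _ (opnorm_ub f (v := 0) _)) ?normr0. Qed.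

(** * The Lax-Milgram theorem for symmetric forms and the Riesz theorem *)

Section lax_milgram.
Context {R : realType} (Q : hilbertType R) (a : Q -> Q -> R) (l : Q -> R).
Variables (al M m : R).
Hypothesis aC : forall u v, a u v = a v u.
Hypothesis aP : forall c u v w, a (c *: u + v) w = c * a u w + a v w.
Hypothesis lP : forall c u v, l (c *: u + v) = c * l u + l v.
Hypothesis al0 : 0 < al.
Hypothesis a_coercive : forall q, al * `|q| ^+ 2 <= a q q.
Hypothesis a_bounded : forall p q, `|a p q| <= M * `|p| * `|q|.
Hypothesis l_bounded : forall q, `|l q| <= m * `|q|.

Let aE := formE aC aP.
Let lD u v : l (u + v) = l u + l v.
Proof. by have := lP 1 u v; rewrite scale1r mul1r. Qed.
Let lZ c u : l (c *: u) = c * l u.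
Proof.
have l0 : l 0 = 0 by apply: (addrI (l 0)); rewrite -lD !addr0.
by have := lP c u 0; rewrite !addr0 l0 addr0.
Qed.

Let J q := a q q - 2 * l q.

Let J_lb q : - (m ^+ 2 / al) <= J q.
Proof.
have h1 := a_coercive q; have h2 := ler_norm (l q); have h3 := l_bounded q.
have h4 : - (m ^+ 2 / al) <= al * `|q| ^+ 2 - 2 * (m * `|q|).
  rewrite -subr_ge0 (_ : _ - _ = (al * `|q| - m) ^+ 2 / al).
    by rewrite divr_ge0 ?sqr_ge0// ltW.
  by field; rewrite gt_eqF.
by rewrite (le_trans h4)// /J; lra.
Qed.

(** The minimiser of the quadratic energy [a q q - 2 * l q]: the parallelogram
    law turns almost-minimality into a Cauchy estimate, and the first variation
    at an almost-minimiser is almost zero. *)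
Lemma symmetric_lax_milgram : exists q, forall p, a q p = l p.
Proof.
pose S := range J; pose j := inf S.
have hS : has_inf S.
  by split; [exists (J 0); exists 0|exists (- (m ^+ 2 / al)) => _ [q _ <-]].
have Jj q : j <= J q by apply: ge_inf; [case: hS|exists q].
have ex (e : R) : exists q, 0 < e -> J q < j + e.
  have [e0|_] := ltP 0 e; last by exists 0.
  by have [_ [q _ <-] qe] := inf_adherent e0 hS; exists q.
pose q_ n := sval (cid (ex n.+1%:R^-1)).
have Jq n : J (q_ n) < j + n.+1%:R^-1.
  by apply: (svalP (cid (ex n.+1%:R^-1))); rewrite invr_gt0.
have dq n k : al * `|q_ n - q_ k| ^+ 2 <= 2 * (n.+1%:R^-1 + k.+1%:R^-1).
  apply: (le_trans (a_coercive _)).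
  have := Jq n; have := Jq k; have := Jj (2^-1 *: (q_ n + q_ k)).
  rewrite /J !aE lZ lD [a (q_ k) (q_ n)]aC.
  move: (n.+1%:R^-1) (k.+1%:R^-1) => x y; lra.
have cq : cvgn q_.
  apply: cauchy_cvg; apply: cauchy_exP => e e0.
  have d0 : 0 < al * e ^+ 2 / 4 by rewrite divr_gt0// mulr_gt0// exprn_gt0.
  have [n _ nE] : \forall n \near \oo, n.+1%:R^-1 < al * e ^+ 2 / 4 :> R.
    exact: (near_infty_natSinv_lt (PosNum d0)).
  exists (q_ n); exists n => // k /= nk; rewrite -ball_normE/=.
  rewrite -(@ltr_pXn2r _ 2)// ?nnegrE ?(ltW e0)// -(ltr_pM2l al0).
  rewrite (le_lt_trans (dq _ _))//; have := nE _ nk; have := nE n (leqnn n).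
  move: (n.+1%:R^-1) (k.+1%:R^-1) => x y /= ? ?; lra.
have {cq} /cvg_ex[q qq] := cq.
exists q => p; apply/eqP; rewrite -subr_eq0; apply/eqP.
have ap0 : 0 <= a p p by rewrite (le_trans _ (a_coercive p))// mulr_ge0 ?sqr_ge0// ltW.
have K0 : 0 < a p p + 1 by lra.
have cn n : (a (q_ n) p - l p) ^+ 2 <= (a p p + 1) * n.+1%:R^-1.
  (* The step [s] almost minimises [J (q_ n + s *: p)] over [s]; the added [1]
     keeps the denominator positive. *)
  set c := _ - _; pose s := - c / (a p p + 1).
  have : - n.+1%:R^-1 <= J (q_ n + s *: p) - J (q_ n).
    move: (Jq n) (Jj (q_ n + s *: p)).
    move: (n.+1%:R^-1) => y ? ?; lra.
  rewrite /J !aE lD lZ [a p _]aC.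
  rewrite (_ : _ - _ = 2 * s * c + s ^+ 2 * a p p); last by rewrite /c; ring.
  move=> h; have : 2 * s * c + s ^+ 2 * a p p <= - (c ^+ 2 / (a p p + 1)).
    rewrite -subr_ge0 (_ : _ - _ = c ^+ 2 / (a p p + 1) ^+ 2).
      by rewrite divr_ge0 ?sqr_ge0.
    by rewrite /s; field; rewrite gt_eqF.
  move=> h'; have : c ^+ 2 / (a p p + 1) <= n.+1%:R^-1 by rewrite -lerN2 (le_trans h h').
  by rewrite ler_pdivrMr// mulrC.
apply: (@ler_sqr_eps _ _ (2 * (a p p + 1) + 2 * (M * `|p|) ^+ 2)) => e e0.
have [n [h1 h2]] : exists n, n.+1%:R^-1 < e /\ `|q - q_ n| ^+ 2 <= e.
  have e1 : 0 < Num.min e 1 by rewrite lt_min e0/=.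
  have near1 : \forall n \near \oo, n.+1%:R^-1 < e :> R.
    exact: (near_infty_natSinv_lt (PosNum e0)).
  have near2 : \forall n \near \oo, `|q - q_ n| < Num.min e 1.
    exact: cvgr_dist_lt qq _ e1.
  have [n _ nE] := filterI near1 near2; exists n.
  have [/= ? /ltW] := nE n (leqnn n); rewrite le_min => /andP[b1 b2].
  split=> //.
  by rewrite expr2 (le_trans _ b1)// ler_piMr.
have -> : a q p - l p = a (q - q_ n) p + (a (q_ n) p - l p) by rewrite !aE; ring.
have h3 : a (q - q_ n) p ^+ 2 <= (M * `|p|) ^+ 2 * e.
  rewrite -real_normK ?num_real// (@le_trans _ _ ((M * `|p|) ^+ 2 * `|q - q_ n| ^+ 2))//.
    have := a_bounded (q - q_ n) p; rewrite mulrAC => h.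
    by rewrite -exprMn lerXn2r ?nnegrE// (le_trans _ h).
  by rewrite ler_wpM2l ?sqr_ge0.
have h4 : (a p p + 1) * n.+1%:R^-1 <= (a p p + 1) * e by apply: ler_wpM2l; apply: ltW.
have := cn n; set X := a (q_ n) p - _; set Y := a _ p in h3 *.
move=> h5; have : (Y + X) ^+ 2 <= 2 * Y ^+ 2 + 2 * X ^+ 2.
  by rewrite -subr_ge0 (_ : _ - _ = (Y - X) ^+ 2) ?sqr_ge0//; ring.
move: h3 h4 h5; clear; move: (n.+1%:R^-1) => y; rewrite !mulrDl -!mulrA => *; lra.
Qed.

End lax_milgram.

Lemma riesz {R : realType} (H : hilbertType R) (l : H -> R) (m : R) :
  (forall c u v, l (c *: u + v) = c * l u + l v) ->
  (forall q, `|l q| <= m * `|q|) -> exists q, forall p, inner q p = l p.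
Proof.
move=> lP lb; apply: (symmetric_lax_milgram (al := 1) (M := 1) (m := m)) => //.
- exact: innerC.
- exact: innerPl.
- by move=> q; rewrite mul1r inner_norm.
- by move=> p q; rewrite mul1r cauchy_schwarz.
Qed.

(** * The right inverse of the constraint operator *)

Section right_inverse.
Context {R : realType} (V Q : hilbertType R) (A : oper V (dual V))
  (B : oper V (dual Q)) (Bm : dual Q -> V) (muA : R).
Hypothesis mu0 : 0 < muA.
Hypothesis Aell : elliptic_on A (operator_kernel B) muA.
Hypothesis Bm_inv : right_inverse_onto_Vc A B Bm.

Lemma right_inverseK h : B (Bm h) = h.
Proof. by case: Bm_inv. Qed.

Lemma right_inverse_orth h w : B w = 0 -> A (Bm h) w = 0.
Proof.
move=> Bw; have [_ /seteqP[VB _]] := Bm_inv.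
by apply: (VB (Bm h)) => //; exists h.
Qed.

(** Ellipticity makes [Vc] and the kernel of [B] meet only at [0]; this is why
    [Bm], a right inverse of [B] with values in [Vc], is linear. *)
Lemma ker_orth_eq0 v : B v = 0 -> A v v = 0 -> v = 0.
Proof.
move=> Bv Av; have := Aell Bv; rewrite Av pmulr_rle0// => h.
by apply/eqP; rewrite -normr_eq0 -sqrf_eq0 eq_le h sqr_ge0.
Qed.

Lemma right_inverseP c h k : Bm (c *: h + k) = c *: Bm h + Bm k.
Proof.
apply/eqP; rewrite -subr_eq0; apply/eqP; set v := _ - _.
have Bv : B v = 0.
  by rewrite /v linearB linearP /= !right_inverseK subrr.
apply: ker_orth_eq0 => //; rewrite [A v]/(A (_ - _)) operBl operPl.
by rewrite !right_inverse_orth// mulr0 addr0 subr0.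
Qed.

(** By the inf-sup condition [q |-> |B^* q|^2] is coercive on [Q]; the
    Riesz representative [v] of [B^* q], where [q] solves the associated
    variational problem, is a preimage of [h] of norm at most [|h| / beta]. *)
Lemma inf_sup_preimage (beta : R) h : 0 < beta -> inf_sup_stable B beta ->
  exists2 v, B v = h & beta * `|v| <= `|h|.
Proof.
move=> b0 Bis.
have S_ex q : exists s : V, forall v, inner s v = B v q.
  apply: (@riesz _ _ _ (opnorm (adjoint B q))) => [c u v|v].
    by rewrite linearP.
  exact: (oper_bound (adjoint B q) v).
pose S q := sval (cid (S_ex q)).
have SE q v : inner (S q) v = B v q := svalP (cid (S_ex q)) v.
have SP c p q : S (c *: p + q) = c *: S p + S q.
  by apply: inner_inj => v; rewrite innerPl !SE linearP.
have Sb q : `|S q| <= opnorm B * `|q|.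
  have : `|S q| ^+ 2 <= `|S q| * (opnorm B * `|q|).
    rewrite -inner_norm SE (le_trans (ler_norm _))//.
    rewrite (le_trans (oper_bound (B (S q)) q))// mulrA ler_wpM2r//.
    by rewrite mulrC; exact: (oper_bound B).
  have [->|S0] := eqVneq (S q) 0.
    by rewrite normr0 mulr_ge0// opnorm_ge0.
  by rewrite expr2 ler_pM2l// normr_gt0.
have Sl q : beta * `|q| <= `|S q|.
  have [->|q0] := eqVneq q 0; first by rewrite normr0 mulr0.
  rewrite -ler_pdivlMr ?normr_gt0// -lee_fin (le_trans Bis)//.
  apply: (le_trans (ereal_inf_lbound _)); first by exists q.
  apply: ge_ereal_sup => _ [v /= v0 <-]; rewrite lee_fin -SE.
  rewrite ler_pdivrMr ?mulr_gt0 ?normr_gt0// mulrA mulrAC divfK ?normr_eq0//.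
  - exact: inner_le.
have [q qE] : exists q, forall p, inner (S q) (S p) = h p.
  apply: (@symmetric_lax_milgram _ _ (fun p q => inner (S p) (S q)) _
      (beta ^+ 2) (opnorm B ^+ 2) (opnorm h)).
  - by move=> u v; exact: innerC.
  - by move=> c u v w; rewrite SP innerPl.
  - by move=> c u v; rewrite linearP.
  - by rewrite exprn_gt0.
  - move=> p; rewrite inner_norm -exprMn lerXn2r ?nnegrE// mulr_ge0//.
    exact: ltW.
  - move=> p r; rewrite (le_trans (cauchy_schwarz _ _))//.
    rewrite [X in _ <= X](_ : _ = (opnorm B * `|p|) * (opnorm B * `|r|)).
      by rewrite ler_pM.
    by ring.
  - exact: (oper_bound h).
exists (S q); first by apply/val_inj/funext => p; rewrite -[LHS]SE innerC qE.
have [->|S0] := eqVneq (S q) 0; first by rewrite normr0 mulr0.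
rewrite -(@ler_pM2r _ `|S q|) ?normr_gt0// -mulrA -expr2 -inner_norm qE.
rewrite (le_trans (ler_wpM2l (ltW b0) (ler_norm _)))//.
have hq := oper_bound h q.
rewrite (le_trans (ler_wpM2l (ltW b0) hq))// mulrCA ler_wpM2l//.
by rewrite opnorm_ge0.
Qed.

(** [Bm h] differs from any preimage [v] of [h] by an element [p] of the kernel
    of [B] with [A p p = A v p], so ellipticity bounds [p] by [v]. *)
Lemma right_inverse_bounded : assumption_B B ->
  exists2 c : R, 0 <= c & forall h, `|Bm h| <= c * `|h|.
Proof.
move=> [beta b0 Bis]; exists ((1 + opnorm A / muA) / beta).
  by rewrite divr_ge0 ?(ltW b0)// addr_ge0// divr_ge0 ?(ltW mu0)//
    opnorm_ge0.
move=> h; have [v Bv vh] := inf_sup_preimage h b0 Bis.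
pose p := v - Bm h.
have Bp : B p = 0 by rewrite /p linearB /= Bv right_inverseK subrr.
have pv : muA * `|p| <= opnorm A * `|v|.
  have [->|p0] := eqVneq p 0.
    by rewrite normr0 mulr0 mulr_ge0// opnorm_ge0.
  rewrite -(@ler_pM2r _ `|p|) ?normr_gt0// -mulrA -expr2.
  apply: (le_trans (Aell Bp)).
  have -> : A p p = A v p.
    by rewrite [A p]/(A (_ - _)) operBl right_inverse_orth// subr0.
  by rewrite (le_trans (ler_norm _))// oper_bound2.
have -> : Bm h = v - p by rewrite /p opprB addrC subrK.
have {}pv : `|p| <= opnorm A / muA * `|v| by rewrite mulrAC ler_pdivlMr// mulrC.
have k0 : 0 <= 1 + opnorm A / muA by rewrite addr_ge0// divr_ge0 ?opnorm_ge0 ?ltW.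
apply: (@le_trans _ _ ((1 + opnorm A / muA) * `|v|)).
  by rewrite (le_trans (ler_normB _ _))// mulrDl mul1r lerD2l.
by rewrite -mulrA ler_wpM2l// ler_pdivlMl.
Qed.
End right_inverse.

(** * Derivatives and primitives of vector-valued functions *)

Section calculus.
Context {R : realType}.
Implicit Types (a b s t e d : R).

Lemma nbhs_distP (P : R -> Prop) t :
  (\forall s \near t, P s) <-> exists2 d, 0 < d & forall s, `|s - t| < d -> P s.
Proof.
split=> [/nbhs_ballP[d /= d0 dP]|[d d0 dP]].
  by exists d => // s sd; apply: dP; rewrite -ball_normE/= distrC.
apply/nbhs_ballP; exists d => //= s; rewrite -ball_normE/= distrC; exact: dP.
Qed.

Lemma is_derive_distP (V : normedModType R) (f : R -> V) t v :
  is_derive t (1 : R) f v <->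
  forall e, 0 < e -> exists2 d, 0 < d &
    forall s, `|s - t| < d -> `|f s - f t - (s - t) *: v| <= e * `|s - t|.
Proof.
split=> [[df <-] e e0|H].
  have /cvgrPdist_le/(_ e e0) : h^-1 *: (f (h *: 1 + t) - f t) @[h --> 0^']
      --> 'D_1 f t by exact: df.
  rewrite near_withinE => /nbhs_distP[d d0 dP]; exists d => // s sd.
  have [->|st] := eqVneq s t; first by rewrite !subrr scale0r subr0 !normr0 mulr0.
  have st0 : s - t != 0 by rewrite subr_eq0.
  have := dP (s - t); rewrite subr0 => /(_ sd st0).
  rewrite [(s - t) *: 1]mulr1 subrK distrC => h.
  rewrite -[X in X - _](scalerKV st0) -scalerBr normrZ mulrC ler_pM2r//.
  by rewrite normr_gt0.
have cf : h^-1 *: (f (h *: 1 + t) - f t) @[h --> 0^'] --> v.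
  apply/cvgrPdist_le => e e0; rewrite near_withinE; apply/nbhs_distP.
  have [d d0 dP] := H e e0; exists d => // h; rewrite subr0 => hd h0.
  have := dP (h + t); rewrite addrK => /(_ hd).
  rewrite [h *: 1]mulr1 -[X in `|X - _|](scalerKV h0) -scalerBr normrZ mulrC.
  by rewrite ler_pM2r ?normr_gt0// distrC.
by apply: DeriveDef; [apply/cvg_ex; exists v|apply/cvg_lim].
Qed.

Lemma continuous_distP (V : normedModType R) (f : R -> V) t :
  {for t, continuous f} <-> forall e, 0 < e -> exists2 d, 0 < d &
    forall s, `|s - t| < d -> `|f s - f t| <= e.
Proof.
split=> [/cvgrPdist_le H e e0|H].
  by have /nbhs_distP[d d0 dP] := H _ e0; exists d => // s /dP; rewrite distrC.
apply/cvgrPdist_le => e e0; apply/nbhs_distP; have [d d0 dP] := H e e0.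
by exists d => // s /dP; rewrite distrC.
Qed.

(** A continuous function on a segment is only known there; freezing it outside
    the segment makes it continuous on the whole line. *)
Definition clamp a b t := Num.max a (Num.min b t).

Lemma clamp_id a b t : a <= t <= b -> clamp a b t = t.
Proof. by move=> /andP[at_ tb]; have h1 := min_r tb; rewrite /clamp h1; exact: max_r. Qed.

Lemma clamp_in a b t : a <= b -> a <= clamp a b t <= b.
Proof. by move=> ab; rewrite /clamp le_max lexx/= ge_max ab ge_min lexx. Qed.

Lemma clamp_lip a b s t : a <= b -> `|clamp a b s - clamp a b t| <= `|s - t|.
Proof.
move=> ab; rewrite ler_norml; have h1 := ler_norm (s - t).
have := ler_norm (t - s); rewrite [`|t - s|]distrC => h2.
move: `|s - t| h1 h2 => n h1 h2; apply/andP; rewrite /clamp.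
case: (leP b s) => ?; case: (leP b t) => ?; rewrite ?(max_r ab);
  case: (leP a s) => ?; case: (leP a t) => ?; split; lra.
Qed.

Lemma clamp_continuous (V : normedModType R) (f : R -> V) a b : a <= b ->
  {within `[a, b], continuous f} -> continuous (f \o clamp a b).
Proof.
move=> ab cf t; apply/continuous_distP => e e0.
have ct : clamp a b t \in `[a, b] by rewrite in_itv/= clamp_in.
have /subspace_continuousP/(_ _ ct)/cvgrPdist_le/(_ e e0) := cf.
rewrite near_withinE => /nbhs_distP[d d0 dP]; exists d => // s sd.
rewrite distrC; apply: dP => //=; last by rewrite in_itv/= clamp_in.
exact: le_lt_trans (clamp_lip _ _ _) sd.
Qed.

Lemma is_derive_continuous (V : normedModType R) (f : R -> V) t v :
  is_derive t (1 : R) f v -> {for t, continuous f}.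
Proof.
move=> df; apply/differentiable_continuous/derivable1_diffP.
by case: df.
Qed.

(** The derivative is required at the end points too, which provides the
    continuity there. *)
Lemma mean_value_le (f df : R -> R) (K a b : R) : a <= b ->
  (forall t, a <= t <= b -> is_derive t (1 : R) f (df t)) ->
  (forall t, a <= t <= b -> `|df t| <= K) -> `|f b - f a| <= K * (b - a).
Proof.
move=> ab fdf dfK.
have [| |t tab ->] := @MVT_segment R f df a b ab.
- move=> x /[!in_itv]/= /andP[ax xb]; apply: fdf; lra.
- apply: derivable_within_continuous => x /[!in_itv]/= xab.
  by case: (fdf x xab).
by rewrite normrM [X in _ * X]ger0_norm ?subr_ge0// ler_wpM2r ?subr_ge0// dfK.
Qed.

Lemma Rintegrable_continuous (f : R -> R) a b : continuous f ->
  (@lebesgue_measure R).-integrable `[a, b] (EFin \o f).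
Proof.
move=> cf; apply: continuous_compact_integrable; first exact: segment_compact.
exact: continuous_subspaceT.
Qed.

Lemma is_derive_derive1 (f : R -> R) t v : derivable f t 1 -> derive1 f t = v ->
  is_derive t (1 : R) f v.
Proof. by move=> df <-; apply: DeriveDef => //; rewrite derive1E. Qed.

Lemma continuous_primitive (f : R -> R) a t : continuous f -> a < t ->
  is_derive t (1 : R)
    (fun x => \int[@lebesgue_measure R]_(s in `[a, x]) f s)%R (f t).
Proof.
move=> cf at_.
have [] := @continuous_FTC1 R f (BLeft a) t (t + 1).
- by rewrite ltrDl.
- exact: Rintegrable_continuous.
- by [].
- exact: cf.
exact: is_derive_derive1.
Qed.

Lemma continuous_inner (V : hilbertType R) (d : R -> V) v :
  continuous d -> continuous (fun s => inner (d s) v).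
Proof.
move=> cd t; apply/continuous_distP => e e0.
have e0' : 0 < e / (`|v| + 1) by rewrite divr_gt0// ltr_wpDl.
have [del del0 H] := (continuous_distP d t).1 (cd t) _ e0'.
exists del => // s /H h; rewrite -innerNl -innerDl.
rewrite (le_trans (cauchy_schwarz _ _))//.
apply: (@le_trans _ _ (e / (`|v| + 1) * (`|v| + 1))); last by rewrite divfK// gt_eqF// ltr_wpDl.
by apply: ler_pM => //; rewrite lerDl.
Qed.

(** The weak integral [v |-> \int (d s, v) ds] is a bounded functional, hence
    represented by a vector; the fundamental theorem holds in norm because
    the scalar one holds against every vector with the same modulus. *)
Lemma hilbert_primitive (V : hilbertType R) (d : R -> V) a : continuous d ->
  exists P : R -> V, forall t, a < t -> is_derive t (1 : R) P (d t).
Proof.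
move=> cd.
pose mu := @lebesgue_measure R.
pose I (t : R) v := (\int[mu]_(s in `[a, t]) inner (d s) v)%R.
have int t v : mu.-integrable `[a, t] (EFin \o (fun s => inner (d s) v)).
  by apply: Rintegrable_continuous; exact: continuous_inner.
have ex t : exists P : V, forall v, inner P v = I t v.
  have cnd : continuous (fun s => `|d s|).
    by move=> s; apply: (@cvg_norm _ _ _ _ _ d); exact: cd.
  apply: (@riesz _ _ _ (\int[mu]_(s in `[a, t]) `|d s|)%R) => [c u v|v].
    rewrite /I -RintegralZl//.
    rewrite -RintegralD//.
    - by apply: eq_Rintegral => s _; rewrite innerPr.
    - rewrite (_ : _ \o _ = EFin \o (fun s => inner (d s) (c *: u))).
        exact: int.
      by apply/funext => s /=; rewrite innerZr.
  rewrite (le_trans (le_normr_Rintegral _ _))//.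
  rewrite mulrC -RintegralZl//; last exact: Rintegrable_continuous.
  apply: le_Rintegral => //.
  - apply: Rintegrable_continuous => s; apply: (@cvg_norm _ _ _ _ _ (fun s => inner (d s) v)).
    exact: continuous_inner.
  - apply: Rintegrable_continuous => s; apply: cvgM; first exact: cvg_cst.
    exact: cnd.
  - by move=> s _; rewrite mulrC cauchy_schwarz.
pose P t := sval (cid (ex t)).
have PE t v : inner (P t) v = I t v := svalP (cid (ex t)) v.
have Pd t v : a < t -> is_derive t (1 : R) (fun t => inner (P t) v) (inner (d t) v).
  move=> at_; rewrite (_ : (fun _ => _) = fun x => (\int[mu]_(s in `[a, x]) inner (d s) v)%R).
    by apply: (@continuous_primitive (fun s => inner (d s) v)) => //; exact: continuous_inner.
  by apply/funext => x; rewrite PE.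
exists P => t at_; apply/is_derive_distP => e e0.
have [del del0 H] := (continuous_distP d t).1 (cd t) _ e0.
exists (Num.min del (t - a)); first by rewrite lt_min del0 subr_gt0.
move=> s; rewrite lt_min => /andP[sdel sta].
set X := _ - _ - _.
pose r x := inner (P x) X - x * inner (d t) X.
have key : `|X| ^+ 2 <= e * `|X| * `|s - t|.
  have -> : `|X| ^+ 2 = r s - r t.
    by rewrite -inner_norm {1}/X /r !(innerDl, innerNl, innerZl); ring.
  rewrite (le_trans (ler_norm _))//.
  have rd x : a < x -> is_derive x (1 : R) r (inner (d x - d t) X).
    move=> ax; have := Pd x X ax => h; rewrite innerDl innerNl.
    apply: is_deriveB.
    rewrite (_ : (fun _ => _) = (fun x => x) * cst (inner (d t) X)) //.
    apply: is_derive_eq; rewrite /= scaler0 add0r.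
    by rewrite [LHS]mulr1.
  have rb x : `|x - t| < del -> `|inner (d x - d t) X| <= e * `|X|.
    move=> /H h; rewrite (le_trans (cauchy_schwarz _ _))// ler_wpM2r//.
  (* The mean value theorem is applied between the smaller and the larger
     of [s] and [t]. *)
  have [st|ts] := leP s t.
    rewrite distrC [`|s - t|]distrC [`|t - s|]ger0_norm ?subr_ge0//.
    apply: (@mean_value_le _ (fun x => inner (d x - d t) X)) => // x xst.
      apply: rd; move: sta; rewrite ltr_norml; lra.
    apply: rb; move: sdel; rewrite !ltr_norml; lra.
  rewrite [`|s - t|]ger0_norm ?subr_ge0 ?(ltW ts)//.
  apply: (@mean_value_le _ (fun x => inner (d x - d t) X)) => [|x xst|x xst].
  - exact: ltW.
  - by apply: rd; lra.
  - by apply: rb; move: sdel; rewrite !ltr_norml; lra.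
have [->|X0] := eqVneq X 0; first by rewrite normr0 mulr_ge0// ltW.
by rewrite -(@ler_pM2r _ `|X|) ?normr_gt0// -expr2 (le_trans key)// mulrAC.
Qed.

End calculus.

(** * A smooth step function *)

Section smooth_step.
Context {R : realType}.
Implicit Types (f g : R -> R) (x y s : R).

(** The derivatives are quantified existentially so that closure under the
    algebraic operations is a plain induction on the order. *)
Fixpoint diffn n f : Prop := if n is n'.+1 then
  exists2 df, (forall x, is_derive x (1 : R) f (df x)) & diffn n' df else True.

Lemma diffnW n f : diffn n.+1 f -> diffn n f.
Proof.
elim: n f => // n ih f [df fdf /ih dfn]; by exists df.
Qed.

Lemma diffn_derive1n f : (forall n, diffn n f) ->
  forall n t, derivable (derive1n n f) t 1.
Proof.
move=> fn n; have := fn n.+1; elim: n f {fn} => [|n ih] f [df fdf dfn] t.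
  by case: (fdf t).
rewrite /derive1n iterSr -/(derive1n n _) (_ : derive1 f = df); first exact: ih.
by apply/funext => x; rewrite derive1E; case: (fdf x).
Qed.

Lemma diffnD n f g : diffn n f -> diffn n g -> diffn n (fun x => f x + g x).
Proof.
elim: n f g => // n ih f g [df fdf dfn] [dg gdg dgn].
exists (fun x => df x + dg x); last exact: ih.
by move=> x; apply: is_deriveD.
Qed.

Lemma diffnM n f g : diffn n f -> diffn n g -> diffn n (fun x => f x * g x).
Proof.
elim: n f g => // n ih f g df0 dg0.
have [fn gn] := (diffnW df0, diffnW dg0).
have [df fdf dfn] := df0; have [dg gdg dgn] := dg0.
exists (fun x => df x * g x + f x * dg x); last by apply: diffnD; exact: ih.
move=> x; have := fdf x; have := gdg x => ? ?.
by apply: is_derive_eq; rewrite [LHS]addrC; congr (_ + _); rewrite [LHS]mulrC.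
Qed.

Lemma diffn_cst n (c : R) : diffn n (fun=> c).
Proof.
elim: n c => // n ih c; exists (fun=> 0); last exact: ih.
by move=> x; exact: is_derive_cst.
Qed.

Lemma diffnV n f : (forall x, f x != 0) -> diffn n f ->
  diffn n (fun x => (f x)^-1).
Proof.
move=> f0; elim: n => // n ih dfn; have fn := ih (diffnW dfn).
have [df fdf dfn'] := dfn.
exists (fun x => (- 1) * (df x * ((f x)^-1 * (f x)^-1))).
  move=> x; have := fdf x => ?; apply: is_derive_eq.
  by rewrite -exprVn expr2 [LHS]mulrC mulrN mulN1r.
by apply: diffnM; [exact: diffn_cst|do 2?apply: diffnM].
Qed.

Lemma is_derive_affine f (v a b x : R) : is_derive (a * x + b) (1 : R) f v ->
  is_derive x (1 : R) (fun x => f (a * x + b)) (a * v).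
Proof.
move=> fv; apply/is_derive_distP => e e0.
have a0 : 0 < `|a| + 1 by rewrite ltr_wpDl.
have [d d0 H] := (is_derive_distP _ _ _).1 fv _ (divr_gt0 e0 a0).
exists (d / (`|a| + 1)); first by rewrite divr_gt0.
move=> s sx; have E : a * s + b - (a * x + b) = a * (s - x) by ring.
have := H (a * s + b); rewrite E normrM => h.
apply: (@le_trans _ _ (e / (`|a| + 1) * (`|a| * `|s - x|))).
  rewrite (_ : (s - x) *: (a * v) = (a * (s - x)) *: v).
    apply: h; rewrite mulrC (@le_lt_trans _ _ (`|s - x| * (`|a| + 1)))//.
      by rewrite ler_wpM2l// lerDl.
    by rewrite -ltr_pdivlMr.
  by rewrite [LHS]mulrCA mulrA.
rewrite mulrA ler_wpM2r// mulrAC ler_pdivrMr// ler_wpM2l ?(ltW e0)//.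
by rewrite lerDl.
Qed.

Lemma diffn_affine n f (a b : R) : diffn n f -> diffn n (fun x => f (a * x + b)).
Proof.
elim: n f => // n ih f [df fdf dfn].
exists (fun x => a * df (a * x + b)).
  by move=> x; exact: is_derive_affine.
by apply: diffnM; [exact: diffn_cst|exact: ih].
Qed.

(** The functions [p(1/x) exp(-1/x)], extended by [0] to [x <= 0], form a class
    stable under derivation. *)
Definition flat (p : {poly R}) x : R :=
  if 0 < x then p.[x^-1] * expR (- x^-1) else 0.

Lemma poly_bound (p : {poly R}) :
  exists C n, 0 <= C /\ forall y, 1 <= y -> `|p.[y]| <= C * y ^+ n.
Proof.
elim/poly_ind: p => [|p c [C [n [C0 H]]]].
  by exists 0, 0%N; split => // y _; rewrite horner0 normr0 mul0r.
exists (C + `|c|), n.+1; split; first by rewrite addr_ge0.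
move=> y y1; rewrite !hornerE (le_trans (ler_normD _ _))// mulrDl.
have y0 : 0 <= y by rewrite (le_trans _ y1).
apply: lerD; last by rewrite ler_peMr// exprn_ege1.
by rewrite normrM (ger0_norm y0) exprSr mulrA ler_wpM2r// H.
Qed.

(** With [y = 1/x], [exp(y) >= (1 + y/m)^m >= (y/m)^m] for [m = n + 2], so that
    [exp(-y)] beats a polynomial of degree [n] with a factor [y^-2] to spare. *)
Lemma flat_sqr (p : {poly R}) : exists2 C, 0 <= C &
  forall x, x <= 1 -> `|flat p x| <= C * x ^+ 2.
Proof.
have [C [n [C0 H]]] := poly_bound p; exists (C * n.+2%:R ^+ n.+2).
  by rewrite mulr_ge0// exprn_ge0.
move=> x x1; rewrite /flat; case: ifPn => [x0|_]; last first.
  by rewrite normr0 mulr_ge0 ?sqr_ge0// mulr_ge0// exprn_ge0.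
set y := x^-1; have y0 : 0 < y by rewrite invr_gt0.
have y1 : 1 <= y by rewrite invf_ge1.
have ey : expR (- y) <= n.+2%:R ^+ n.+2 * y ^- n.+2.
  have yn : y = n.+2%:R * (y / n.+2%:R) by rewrite mulrC divfK// pnatr_eq0.
  have k : (y / n.+2%:R) ^+ n.+2 <= expR y.
    rewrite [X in expR X]yn expRM_natl lerXn2r ?nnegrE ?expR_ge0 ?divr_ge0 ?(ltW y0)//.
    by rewrite (le_trans _ (expR_ge1Dx _))// lerDr.
  rewrite expRN (_ : _ * _ = ((y / n.+2%:R) ^+ n.+2)^-1).
    by rewrite lef_pV2 ?posrE ?expR_gt0 ?exprn_gt0 ?divr_gt0.
  by rewrite expr_div_n invf_div.
rewrite normrM [`|expR _|]ger0_norm ?expR_ge0//.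
apply: (le_trans (ler_pM (normr_ge0 _) (expR_ge0 _) (H y y1) ey)).
have -> : x ^+ 2 = y ^+ n * y ^- n.+2.
  have -> : y ^+ n.+2 = y ^+ n * y ^+ 2 by rewrite -exprD addn2.
  rewrite invfM mulrA mulfV ?mul1r; last first.
    by rewrite expf_neq0// gt_eqF.
  by rewrite /y exprVn invrK.
by rewrite mulrACA.
Qed.

Lemma is_derive_flat (p : {poly R}) x :
  is_derive x (1 : R) (flat p) (flat ('X^2 * (p - p^`())) x).
Proof.
have [x0|x0|x0] := ltgtP 0 x.
- have h : is_derive x (1 : R) (fun x => p.[x^-1] * expR (- x^-1))
      (flat ('X^2 * (p - p^`())) x).
    have x0' : x != 0 by rewrite gt_eqF.
    have dp := is_derive_poly p x^-1.
    have di : is_derive x (1 : R) (fun x => x^-1) (- x ^- 2).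
      have h := @is_deriveV _ id x 1 _ x0' (is_derive_id x 1).
      by apply: is_derive_eq h _; rewrite [LHS]mulr1.
    have d1 := is_derive1_comp dp di.
    have d2 := @is_derive1_comp _ expR (fun x => - x^-1) x _ _
      (is_derive_expR _) (is_deriveN di).
    apply: is_derive_eq (is_deriveM d1 d2) _; rewrite /flat x0 !hornerE /=.
    rewrite -[_ *: _]/(_ * _) -[X in _ + X]/(_ * _) -exprVn; ring.
  apply: near_eq_is_derive h; near=> y.
  by rewrite /flat ifT//; near: y; exact: lt_nbhsr.
- apply/is_derive_distP => e e0; exists (- x); first lra.
  move=> s; rewrite ltr_norml => /andP[_ sx]; have s0 : s < 0 by lra.
  by rewrite /flat (lt_gtF s0) (lt_gtF x0) scaler0 !subr0 normr0 mulr_ge0 ?(ltW e0).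
- rewrite -x0 {2}/flat ltxx; apply/is_derive_distP => e e0.
  have [C C0 H] := flat_sqr p.
  exists (Num.min 1 (e / (C + 1))).
    by rewrite lt_min ltr01 divr_gt0// ltr_wpDl.
  move=> s; rewrite !subr0 lt_min => /andP[s1 se].
  rewrite scaler0 subr0 {2}/flat ltxx subr0 (le_trans (H _ _))//.
    by rewrite (le_trans (ler_norm _))// ltW.
  rewrite -[s ^+ 2]real_normK ?num_real// expr2 mulrA ler_wpM2r//.
  rewrite (le_trans (ler_wpM2l C0 (ltW se)))// mulrCA ler_piMr ?(ltW e0)//.
  by rewrite ler_pdivrMr ?ltr_wpDl// mul1r lerDl.
Unshelve. all: by end_near. Qed.

Lemma diffn_flat n p : diffn n (flat p).
Proof.
elim: n p => // n ih p; exists (flat ('X^2 * (p - p^`()))); last exact: ih.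
exact: is_derive_flat.
Qed.

Lemma diffn_derive_continuous f df : (forall n, diffn n f) ->
  (forall x, is_derive x (1 : R) f (df x)) -> continuous df.
Proof.
move=> /(_ 2%N)[df' fdf' [ddf dfddf _]] fdf x.
rewrite (_ : df = df'); first exact: is_derive_continuous (dfddf x).
apply/funext => t; have [_ <-] := fdf t; by have [_ <-] := fdf' t.
Qed.

(** With [E(x) = exp(-1/x)] the step is [E(x) / (E(x) + E(1 - x))]. *)
Lemma smooth_step_exists : exists th dth : R -> R,
  [/\ forall n, diffn n th, forall x, is_derive x (1 : R) th (dth x),
      forall x, 0 <= dth x,
      forall x, 0 <= th x <= 1 &
      (forall x, x <= 0 -> th x = 0) /\ (forall x, 1 <= x -> th x = 1)].
Proof.
pose E := flat 1; pose dE := flat ('X^2).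
have Ed x : is_derive x (1 : R) E (dE x).
  by have := is_derive_flat 1 x; rewrite -polyC1 derivC subr0 polyC1 mulr1.
have flat_ge0 p x : (forall y, 0 <= p.[y]) -> 0 <= flat p x.
  by move=> p0; rewrite /flat; case: ifP => // _; rewrite mulr_ge0// expR_ge0.
have E0 x : 0 <= E x by apply: flat_ge0 => y; rewrite hornerE.
have dE0 x : 0 <= dE x by apply: flat_ge0 => y; rewrite hornerXn sqr_ge0.
have Epos x : 0 < x -> 0 < E x.
  by move=> x0; rewrite /E /flat x0 hornerE mul1r expR_gt0.
have Eneg x : x <= 0 -> E x = 0 by move=> x0; rewrite /E /flat ltNge x0.
pose E' x := E (- 1 * x + 1).
have E'd x : is_derive x (1 : R) E' (- 1 * dE (- 1 * x + 1)).
  exact: is_derive_affine.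
pose D x := E x + E' x.
have D0 x : 0 < D x.
  have [x0|x0] := ltP 0 x; first by rewrite ltr_pwDl ?Epos// E0.
  by rewrite ltr_wpDl ?E0// Epos//; lra.
have D0' x : D x != 0 by rewrite gt_eqF.
exists (fun x => E x * (D x)^-1).
exists (fun x => (dE x * E' x + E x * dE (- 1 * x + 1)) / D x ^+ 2); split.
- move=> n; apply: diffnM; first exact: diffn_flat.
  apply: diffnV => //; apply: diffnD; first exact: diffn_flat.
  exact/diffn_affine/diffn_flat.
- move=> x; have := Ed x; have := E'd x => h1 h2; have := D0' x => h3.
  have h4 : is_derive x (1 : R) D (dE x + - 1 * dE (- 1 * x + 1)).
    exact: is_deriveD.
  have h5 := @is_deriveV _ D x _ 1 h3 h4.
  apply: is_derive_eq (is_deriveM h2 h5) _.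
  rewrite -![_ *: _]/(_ * _) /D; move: h3; rewrite /D => h3; field.
  exact: h3.
- move=> x; rewrite divr_ge0 ?sqr_ge0// addr_ge0// mulr_ge0// ?E0 //.
- by move=> x; rewrite divr_ge0 ?E0 ?(ltW (D0 x))// ler_pdivrMr// mul1r lerDl E0.
split=> [x x0|x x1]; first by rewrite Eneg// mul0r.
have e0 : E' x = 0 by apply: Eneg; lra.
by rewrite /D e0 addr0 divff// gt_eqF// Epos//; lra.
Qed.
End smooth_step.

(** * Bochner measurability and Bochner integrals *)

Section bochner_facts.
Context {R : realType}.
Local Notation mu := (@lebesgue_measure R).
Implicit Types (D : set (measurableTypeR R)) (q : R -> R).

Lemma aeS (P Q : R -> Prop) : (forall t, P t -> Q t) ->
  {ae mu, forall t, P t} -> {ae mu, forall t, Q t}.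
Proof.
move=> PQ; apply: filterS; first exact: (ae_filter_ringOfSetsType mu).
exact: PQ.
Qed.

Lemma aeI (P Q : R -> Prop) : {ae mu, forall t, P t} ->
  {ae mu, forall t, Q t} -> {ae mu, forall t, P t /\ Q t}.
Proof.
move=> aP aQ; apply: filterS2 aP aQ => //.
exact: (ae_filter_ringOfSetsType mu).
Qed.

Lemma aeW (P : R -> Prop) : (forall t, P t) -> {ae mu, forall t, P t}.
Proof.
by move=> aP; apply: filterE => //; exact: (ae_filter_ringOfSetsType mu).
Qed.

(** The majorant need not be measurable: the integral of a nonnegative function
    is a supremum over the simple functions below it, hence monotone. *)
Lemma ae_le_integral D (p q : R -> \bar R) : measurable D ->
  measurable_fun D p -> (forall t, D t -> 0 <= p t)%E ->
  (forall t, D t -> 0 <= q t)%E ->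
  {ae mu, forall t, D t -> (p t <= q t)%E} ->
  (\int[mu]_(t in D) p t <= \int[mu]_(t in D) q t)%E.
Proof.
move=> mD mp p0 q0 [N [mN N0 pqN]].
rewrite (ge0_negligible_integral mN)// ge0_integralE; last by move=> t [/p0].
rewrite ge0_integralE//; apply: ereal_sup_le => _ [h /= hp <-]; exists h => //= t.
apply: (le_trans (hp t)); rewrite /patch; case: ifPn => [|_]; last first.
  by case: ifPn => // /set_mem/q0.
move=> /set_mem[Dt Nt]; rewrite mem_set//.
by apply: contrapT => h'; apply: Nt; apply: pqN => /= H; apply: h'; exact: H.
Qed.

(** The same Borel sets, under the two measurable structures of the line. *)
Lemma measurableRE (D : set R) :
  @measurable _ R D -> @measurable _ (measurableTypeR R) D.
Proof. by []. Qed.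

Section simple.
Variables (X : normedModType R) (s : R -> X).
Hypothesis s_simple : simple_fun s.

Lemma simple_comp_measurable D (psi : X -> R) : measurable D ->
  measurable_fun D (psi \o s).
Proof.
move=> mD; apply: (measurable_funS measurableT) => //.
move=> _ B mB; rewrite setTI; have [fs ms0] := s_simple; have ms x := measurableRE (ms0 x).
rewrite (_ : _ @^-1` _ = \bigcup_(x in range s `&` psi @^-1` B) s @^-1` [set x]).
  apply: fin_bigcup_measurable => //.
  exact: finite_setIl.
apply/seteqP; split => [t Bt|t [x [_ Bx] /= sx]]; last by rewrite /= sx.
by exists (s t).
Qed.

Lemma simple_integral_functional D (l : oper X R^o) : measurable D ->
  (mu D < +oo)%E ->
  mu.-integrable D (EFin \o (fun t => l (s t) : R)) /\
  (\int[mu]_(t in D) (l (s t) : R))%R = l (simple_integral D s).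
Proof.
move=> mD muD; have [fs ms0] := s_simple; have ms x := measurableRE (ms0 x).
pose F := finmap.enum_fset (fset_set (range s)).
have sE t : (l (s t) : R) = \sum_(x <- F) (l x : R) * \1_(s @^-1` [set x]) t.
  rewrite (bigD1_seq (s t)) ?finmap.fset_uniq//=; last first.
    by have := in_fset_set fs (s t); rewrite mem_set//; exists t.
  rewrite big1 ?addr0; last first.
    move=> x xs; rewrite indicE memNset ?mulr0//= => sx.
    by rewrite sx eqxx in xs.
  by rewrite indicE mem_set// mulr1.
have int (x : X) : mu.-integrable D (EFin \o (fun t => ((l x : R) * \1_(s @^-1` [set x]) t)%R)).
  apply: measurable_bounded_integrable => //.
    apply: measurable_funM; first exact: measurable_cst.
    exact: (measurable_indic (ms x)).
  exists `|l x|; split=> // M lM t _ /=; rewrite normrM (le_trans _ (ltW lM))//.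
  by rewrite ler_piMr// indicE normr_nat; case: (_ \in _).
have E : (EFin \o (fun t => l (s t) : R)) =
    (fun t => \sum_(x <- F) ((l x : R) * \1_(s @^-1` [set x]) t)%:E)%E.
  by apply/funext => t /=; rewrite sE sumEFin.
split; first by rewrite E; apply: integrable_sum => // x _; exact: int.
rewrite /Rintegral -[X in fine (integral _ _ X)]/(EFin \o (fun t => l (s t) : R)).
rewrite E integral_sum// /simple_integral fsbig_finite// linear_sum /=.
rewrite -sum_fine//; last by move=> x _; exact: (integrable_fin_num mD (int x)).
apply: eq_bigr => x _.
under eq_integral do rewrite EFinM.
have i1 : mu.-integrable D (EFin \o (\1_(s @^-1` [set x]) : R -> R)).
  apply: measurable_bounded_integrable => //.
  exists 1; split=> // M lM t _ /=; rewrite (le_trans _ (ltW lM))//.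
  by rewrite indicE normr_nat; case: (_ \in _).
rewrite (integralZl mD i1).
rewrite integral_indic// setIC fineM//; last first.
  rewrite ge0_fin_numE//; apply: le_lt_trans muD; apply: le_measure => //.
  - by rewrite inE; apply: measurableI.
  - by rewrite inE.
by rewrite linearZ mulrC.
Qed.
End simple.

Variable X : normedModType R.

(** Strong measurability only gives Lebesgue measurability of [psi \o f]; the
    Borel version is the limes superior along the approximating functions. *)
Lemma strongly_measurable_borel D (f : R -> X) (psi : X -> R) :
  continuous psi -> strongly_measurable D f ->
  exists2 q, measurable_fun [set: measurableTypeR R] q & {ae mu, forall t, D t -> psi (f t) = q t}.
Proof.
move=> cpsi [s [ss sf]].
pose e t := limn_esup (fun n => (psi (s n t))%:E).
have me : measurable_fun [set: measurableTypeR R] e.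
  apply: measurable_fun_limn_esup => n.
  by apply/measurable_EFinP; exact: (@simple_comp_measurable _ _ (ss n) setT psi).
exists (fun t => fine (e t)).
  by apply: measurableT_comp me; exact: fine_measurable.
apply: aeS sf => t sft Dt; rewrite /e is_cvg_limn_esupE.
  have -> : limn (fun n => (psi (s n t))%:E) = (psi (f t))%:E => //.
  apply/cvg_lim => //; apply: cvg_EFin; first exact: nearW.
  exact: (cvg_comp _ _ (sft Dt) (cpsi (f t))).
apply/cvg_ex; exists (psi (f t))%:E; apply: cvg_EFin; first exact: nearW.
exact: (cvg_comp _ _ (sft Dt) (cpsi (f t))).
Qed.

(** Bounded functionals commute with the Bochner integral; [k] stands for a
    Borel function because [l \o f] is only Lebesgue measurable. *)
Lemma bochner_integral_functional D (f : R -> X) x (l : oper X R^o) (k : R -> R) :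
  measurable D -> (mu D < +oo)%E -> is_bochner_integral D f x ->
  mu.-integrable D (EFin \o k) -> {ae mu, forall t, D t -> l (f t) = k t} ->
  (\int[mu]_(t in D) k t)%R = l x.
Proof.
move=> mD muD [s [ss sf s0 sx]] ik lk.
pose M := opnorm l + 1; have M0 : 0 < M by rewrite ltr_wpDl// opnorm_ge0.
have iln n := (simple_integral_functional (ss n) l mD muD).1.
have lnE n := (simple_integral_functional (ss n) l mD muD).2.
have dk n : (`|(\int[mu]_(t in D) k t) - l (simple_integral D (s n))|%:E <=
    M%:E * \int[mu]_(t in D) (`|f t - s n t|%:E))%E.
  rewrite -lnE -RintegralB//.
  have ib : mu.-integrable D (EFin \o (fun t => k t - (l (s n t) : R))).
    by rewrite (_ : _ \o _ = (EFin \o k) \- (EFin \o (fun t => l (s n t))))%E;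
      [exact: integrableB|apply/funext].
  apply: (@le_trans _ _ (\int[mu]_(t in D) `|(k t - l (s n t))%:E|)%E).
    rewrite /Rintegral -abse_EFin fineK; last exact: integrable_fin_num.
    by apply: le_abse_integral => //; have /integrableP[] := ib.
  (* The norm [|f - s n|] need not be Borel, so the constant is moved to the
     measurable side before comparing the integrals. *)
  rewrite -lee_pdivrMl//.
  have ->: (M^-1%:E * \int[mu]_(t in D) `|(k t - l (s n t))%:E| =
      \int[mu]_(t in D) (M^-1%:E * `|(k t - l (s n t))%:E|))%E.
    rewrite ge0_integralZl//; last by rewrite lee_fin invr_ge0 ltW.
    by apply: measurableT_comp => //; have /integrableP[] := ib.
  apply: ae_le_integral => //.
  - apply: measurable_funeM; apply: measurableT_comp => //.
    by have /integrableP[] := ib.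
  - by move=> t _; rewrite mule_ge0// lee_fin invr_ge0 ltW.
  - apply: aeS lk => t lkt Dt; rewrite -lkt//= lee_fin -ler_pdivlMl ?invr_gt0//.
    rewrite invrK; have -> : l (f t) - l (s n t) = l (f t - s n t) by rewrite linearB.
    rewrite (le_trans (oper_bound l _))// ler_wpM2r// /M lerDl//.
have cl : l (simple_integral D (s n)) @[n --> \oo] --> l x.
  exact: (cvg_comp _ _ sx (@oper_continuous _ _ _ l x)).
apply/esym; apply: (@cvg_unique _ (@Rhausdorff R) (l (simple_integral D (s n)) @[n --> \oo])) => //.
apply/cvgrPdist_le => e e0.
have eM : 0 < e / M by rewrite divr_gt0.
have : \forall n \near \oo, (\int[mu]_(t in D) (`|f t - s n t|%:E) < (e / M)%:E)%E.
  exact: (s0 _ (@nbhs_open_ereal_lt R 0 (fun=> e / M) eM)).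
apply: filterS => n h; rewrite -lee_fin (le_trans (dk n))//.
apply: (@le_trans _ _ (M%:E * (e / M)%:E)%E).
  by apply: lee_wpmul2l; rewrite ?lee_fin ltW.
by rewrite -EFinM lee_fin mulrC divfK// gt_eqF.
Qed.
End bochner_facts.

(** * Weak derivatives of continuous functions *)

Section du_bois_reymond.
Context {R : realType}.
Local Notation mu := (@lebesgue_measure R).
Implicit Types (a b s t e del p x : R).

Lemma continuous_within_mulr (f eta : R -> R) a b : continuous f ->
  {within `[a, b], continuous eta} ->
  {within `[a, b], continuous (fun x => f x * eta x)}.
Proof.
move=> cf ce x; apply: (@continuousM _ (subspace `[a, b]) f eta x).
  exact: (@continuous_subspaceT _ _ `[a, b] f).
exact: ce.
Qed.

Lemma dist_chain (y1 y2 z1 z2 x1 x2 e : R) : y1 - y2 = - z2 ->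
  `|z1 - z2| <= e / 3 -> `|y1 - x1| <= e / 3 -> `|y2 - x2| <= e / 3 ->
  `|x2 - x1 - z1| <= e.
Proof.
move=> E; rewrite !ler_norml => /andP[? ?] /andP[? ?] /andP[? ?].
by apply/andP; split; lra.
Qed.

Lemma dist_interval (x p w d : R) : p <= x <= p + w -> w < d -> `|x - p| < d.
Proof. by move=> /andP[px xw] wd; rewrite ger0_norm ?subr_ge0//; lra. Qed.

Section step.
Variables th dth : R -> R.
Hypothesis th_diffn : forall n, diffn n th.
Hypothesis th_der : forall x, is_derive x (1 : R) th (dth x).
Hypothesis dth_ge0 : forall x, 0 <= dth x.
Hypothesis th_01 : forall x, 0 <= th x <= 1.
Hypothesis th_0 : forall x, x <= 0 -> th x = 0.
Hypothesis th_1 : forall x, 1 <= x -> th x = 1.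

Lemma step_derive_eq0 x : x < 0 \/ 1 < x -> dth x = 0.
Proof.
have [_ <-] := th_der x.
move=> [x0|x1].
  have h : is_derive x (1 : R) th 0.
    apply: (near_eq_is_derive _ (is_derive_cst (0 : R) x (1 : R))).
    by near=> y; rewrite /= th_0// ltW//; near: y; exact: lt_nbhsl.
  by case: h.
have h : is_derive x (1 : R) th 0.
  apply: (near_eq_is_derive _ (is_derive_cst (1 : R) x (1 : R))).
  by near=> y; rewrite /= th_1// ltW//; near: y; exact: lt_nbhsr.
by case: h.
Unshelve. all: by end_near. Qed.

Let ramp p del x := th (del^-1 * x + - (p / del)).
Let dramp p del x := del^-1 * dth (del^-1 * x + - (p / del)).

Let rampE p del x : del^-1 * x + - (p / del) = (x - p) / del.
Proof. by rewrite mulrBl mulrC. Qed.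

Let ramp_der p del x : is_derive x (1 : R) (ramp p del) (dramp p del x).
Proof. exact: is_derive_affine. Qed.

Let ramp_diffn n p del : diffn n (ramp p del).
Proof. exact: diffn_affine. Qed.

Let ramp_0 p del x : 0 < del -> x <= p -> ramp p del x = 0.
Proof.
by move=> d0 xp; rewrite /ramp rampE th_0// pmulr_lle0 ?invr_gt0// subr_le0.
Qed.

Let ramp_1 p del x : 0 < del -> p + del <= x -> ramp p del x = 1.
Proof.
by move=> d0 xp; rewrite /ramp rampE th_1// ler_pdivlMr// mul1r lerBrDl.
Qed.

Let dramp_continuous p del : continuous (dramp p del).
Proof.
apply: (@diffn_derive_continuous _ (ramp p del)) => [n|x].
  exact: ramp_diffn.
exact: ramp_der.
Qed.

Let dramp_eq0 p del x : 0 < del -> x < p \/ p + del < x -> dramp p del x = 0.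
Proof.
move=> d0 h; rewrite /dramp rampE step_derive_eq0 ?mulr0//.
case: h => h; [left|right].
  by rewrite pmulr_llt0 ?invr_gt0// subr_lt0.
by rewrite ltr_pdivlMr// mul1r ltrBrDl.
Qed.

Let dramp_int a b p del (eta : R -> R) : {within `[a, b], continuous eta} ->
  mu.-integrable `[a, b] (EFin \o (fun x => dramp p del x * eta x)).
Proof.
move=> ceta; apply: continuous_compact_integrable; first exact: segment_compact.
exact: continuous_within_mulr.
Qed.

(** The derivative of the ramp is a probability density on [[p, p + del]]. *)
Lemma ramp_average a b p del e (eta : R -> R) : a < b ->
  {within `[a, b], continuous eta} -> a <= p -> 0 < del -> p + del <= b ->
  (forall x, p <= x <= p + del -> `|eta x - eta p| <= e) ->
  `|(\int[mu]_(x in `[a, b]) (dramp p del x * eta x))%R - eta p| <= e.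
Proof.
move=> ab ceta ap d0 pb etae.
have int1 : (\int[mu]_(x in `[a, b]) dramp p del x)%R = 1.
  rewrite /Rintegral (@continuous_FTC2 _ (dramp p del) (ramp p del))//.
  - by rewrite -EFinB/= ramp_1// ramp_0// subr0.
  - exact: continuous_subspaceT.
  - split=> [x _| |]; first by case: (ramp_der p del x).
      apply: cvg_at_right_filter; exact: is_derive_continuous (ramp_der p del a).
    apply: cvg_at_left_filter; exact: is_derive_continuous (ramp_der p del b).
  - by move=> x _; rewrite derive1E; case: (ramp_der p del x).
have i1 := @dramp_int a b p del _ ceta.
have i2 c : mu.-integrable `[a, b] (EFin \o (fun x => dramp p del x * c)).
  exact: (@dramp_int a b p del (fun=> c) (@continuous_subspaceT _ _ _ _ (@cst_continuous _ _ _))).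
have i0 : mu.-integrable `[a, b] (EFin \o (fun x => dramp p del x)).
  by have := i2 1; under [X in EFin \o X]funext do rewrite mulr1.
have intc c : (\int[mu]_(x in `[a, b]) (dramp p del x * c))%R = c.
  under eq_Rintegral do rewrite mulrC.
  by rewrite RintegralZl// int1 mulr1.
rewrite -[X in _ - X]intc -RintegralB//.
have i3 : mu.-integrable `[a, b]
    (EFin \o (fun x => dramp p del x * eta x - dramp p del x * eta p)).
  by rewrite (_ : _ \o _ = (EFin \o (fun x => dramp p del x * eta x)%R) \-
    (EFin \o (fun x => dramp p del x * eta p)%R))%E;
      [exact: integrableB|apply/funext].
rewrite (le_trans (le_normr_Rintegral _ i3))// -[X in _ <= X]intc.
apply: le_Rintegral => //.
  rewrite (_ : EFin \o _ = abse \o (EFin \o (fun x => dramp p del x * eta x - dramp p del x * eta p))).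
    exact: integrable_abse.
  by apply/funext.
move=> x _; rewrite -mulrBr normrM ger0_norm; last first.
  by rewrite mulr_ge0 ?invr_ge0 ?(ltW d0).
have [xp|px] := ltP x p; first by rewrite dramp_eq0 ?mul0r//; left.
have [px'|xp'] := ltP (p + del) x; first by rewrite dramp_eq0 ?mul0r//; right.
rewrite ler_wpM2l ?etae ?px//.
by rewrite mulr_ge0 ?invr_ge0 ?(ltW d0).
Qed.

(** As [del] tends to [0], the bump tends to the indicator function of
    [(s, t]]. *)
Let bump s t del x := ramp s del x - ramp t del x.

Let bump_test a b s t del : a < s -> s < t -> t + del < b -> 0 < del ->
  test_function a b (bump s t del).
Proof.
move=> as_ st tb d0; split.
  apply: diffn_derive1n => n; apply: diffnD => //.
  rewrite (_ : (fun _ => _) = (fun x => (- 1) * ramp t del x)).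
    by apply: diffnM => //; exact: diffn_cst.
  by apply/funext => x; rewrite mulN1r.
exists s, (t + del); split => // x.
rewrite in_itv/= negb_and -!ltNge => /orP[xs|tx]; rewrite /bump.
  by rewrite !ramp_0 ?subrr//; lra.
by rewrite !ramp_1 ?subrr//; lra.
Qed.

Let bump_derive s t del x : derive1 (bump s t del) x = dramp s del x - dramp t del x.
Proof.
rewrite derive1E; have h := is_deriveB (ramp_der s del x) (ramp_der t del x).
by case: h.
Qed.

Lemma du_bois_reymond_step a b s t (eta k : R -> R) :
  {within `[a, b], continuous eta} ->
  measurable_fun [set: measurableTypeR R] k ->
  mu.-integrable `[a, b] (EFin \o k) ->
  (forall phi, test_function a b phi ->
    (\int[mu]_(x in `[a, b]) (derive1 phi x * eta x) =
     - \int[mu]_(x in `[a, b]) (phi x * k x))%R) ->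
  a < s -> s < t -> t < b ->
  eta t - eta s = (\int[mu]_(x in `]s, t]) k x)%R.
Proof.
move=> ceta mk ik H as_ st tb.
(* The denominator starts at [2] to keep the support inside [(a, b)]. *)
pose de n := (b - t) / n.+2%:R.
have de0 n : 0 < de n by rewrite divr_gt0// subr_gt0.
have deb n : t + de n < b.
  by rewrite -ltrBrDl /de ltr_pdivrMr// ltr_pMr ?subr_gt0// ltr1n.
pose F n x := bump s t (de n) x * k x.
have mbump n : measurable_fun [set: measurableTypeR R] (bump s t (de n)).
  apply: continuous_measurable_fun => x; apply: continuousB.
    exact: is_derive_continuous (ramp_der _ _ _).
  exact: is_derive_continuous (ramp_der _ _ _).
have bump1 n x : `|bump s t (de n) x| <= 1.
  rewrite /bump; have := th_01 ((de n)^-1 * x + - (s / de n)).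
  have := th_01 ((de n)^-1 * x + - (t / de n)); rewrite /ramp.
  by move=> /andP[? ?] /andP[? ?]; rewrite ler_norml; apply/andP; split; lra.
have small e : 0 < e -> \forall n \near \oo, de n < e.
  move=> e0; have e0' : 0 < e / (b - t) by rewrite divr_gt0// subr_gt0.
  have [N _ HN] := near_infty_natSinv_lt (PosNum e0').
  exists N => // n /= Nn; rewrite /de mulrC -ltr_pdivlMr ?subr_gt0//.
  apply: lt_trans (HN n Nn) => //=.
  by rewrite ltf_pV2 ?posrE// ltr_nat.
have [_ _ cF] : [/\ mu.-integrable `[a, b] (EFin \o (k \_ `]s, t])),
   [sequence \int[mu]_(x in `[a, b]) `|(F n x)%:E - ((k \_ `]s, t]) x)%:E|]_n @ \oo --> 0 &
   [sequence \int[mu]_(x in `[a, b]) (F n x)%:E]_n @ \oo -->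
     \int[mu]_(x in `[a, b]) ((k \_ `]s, t]) x)%:E]%E.
  apply: (@dominated_convergence _ _ _ mu `[a, b] _ (fun n x => (F n x)%:E)
     (EFin \o (k \_ `]s, t])) (fun x => `|(k x)%:E|%E)) => //.
  - move=> n; apply/measurable_EFinP; apply: measurable_funTS.
    exact: measurable_funM.
  - apply/measurable_EFinP; apply: measurable_funTS.
    by apply/(measurable_restrictT _ _).1 => //; exact: measurable_funTS.
  - apply: aeW => x _; apply: cvg_EFin; first exact: nearW.
    apply: cvg_near_cst; rewrite /= patchE; case: ifPn => [/set_mem/=|].
      rewrite in_itv/= => /andP[sx xt].
      have := small (x - s); rewrite subr_gt0 => /(_ sx); apply: filterS => n dn.
      by rewrite /F /bump ramp_1 ?ramp_0 ?subr0 ?mul1r//; lra.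
    rewrite notin_setE/= in_itv/= => /negP; rewrite negb_and -!ltNge -leNgt.
    move=> /orP[xs|tx].
      by apply: nearW => n; rewrite /F /bump !ramp_0 ?subrr ?mul0r//; lra.
    have := small (x - t); rewrite subr_gt0 => /(_ tx); apply: filterS => n dn.
    by rewrite /F /bump !ramp_1 ?subrr ?mul0r//; lra.
  - exact: integrable_abse.
  - apply: aeW => x n _; rewrite /= lee_fin /F normrM ler_piMl//.
have limE : (\int[mu]_(x in `[a, b]) ((k \_ `]s, t]) x)%:E)%E =
    (\int[mu]_(x in `]s, t]) (k x)%:E)%E.
  rewrite [RHS]integral_mkcond [LHS]integral_mkcond; apply: eq_integral => x _.
  rewrite !patchE; have [xst|xst] := boolP (x \in `]s, t]%classic); last by case: ifP.
  suff -> : x \in `[a, b]%classic by [].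
  rewrite mem_set//=; move/set_mem: xst => /=; rewrite !in_itv/=.
  by move=> /andP[? ?]; apply/andP; split; lra.
rewrite {}limE in cF.
have ab : a < b by lra.
have cs x : a < x -> x < b -> forall e, 0 < e ->
    exists2 d, 0 < d & forall y, `|y - x| < d -> `|eta y - eta x| <= e.
  move=> ax xb; apply/continuous_distP.
  by apply: within_continuous_continuous ab ceta _; rewrite in_itv/= ax.
apply/eqP; rewrite -subr_eq0 -normr_le0; apply/ler_addgt0Pr => e e0; rewrite add0r.
have e3 : 0 < e / 3 by rewrite divr_gt0.
have [d1 d10 H1] := cs s as_ (lt_trans st tb) _ e3.
have [d2 d20 H2] := cs t (lt_trans as_ st) tb _ e3.
have ik' : mu.-integrable `]s, t] (EFin \o k).
  apply: integrableS ik => // x /=; rewrite !in_itv/= => /andP[h1 h2].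
  by rewrite (ltW (lt_trans as_ h1)) (le_trans h2 (ltW tb)).
have IE : (\int[mu]_(x in `]s, t]) (k x)%:E)%E = (\int[mu]_(x in `]s, t]) k x)%R%:E.
  by rewrite /Rintegral fineK//; exact: integrable_fin_num.
rewrite IE in cF.
have iF n : mu.-integrable `[a, b] (EFin \o F n).
  apply: le_integrable ik => //.
    apply/measurable_EFinP; apply: measurable_funTS; exact: measurable_funM.
  by move=> x _ /=; rewrite lee_fin normrM ler_piMl.
have cR : (\int[mu]_(x in `[a, b]) F n x)%R @[n --> \oo] --> (\int[mu]_(x in `]s, t]) k x)%R.
  apply: fine_cvg; apply: cvg_trans cF; apply: near_eq_cvg; apply: nearW => n /=.
  by [].
have near3 : \forall n \near \oo, `|(\int[mu]_(x in `]s, t]) k x)%R - (\int[mu]_(x in `[a, b]) F n x)%R| <= e / 3.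
  by move/cvgrPdist_le : cR => /(_ _ e3).
have [n [[dn1 dn2] h3]] : exists n, (de n < d1 /\ de n < d2) /\
  `|(\int[mu]_(x in `]s, t]) k x)%R - (\int[mu]_(x in `[a, b]) F n x)%R| <= e / 3.
  have [n _ Hn] := filterI (filterI (small _ d10) (small _ d20)) near3.
  by exists n; exact: Hn (leqnn n).
have := H _ (bump_test as_ st (deb n) (de0 n)).
under eq_Rintegral do rewrite bump_derive mulrBl.
rewrite RintegralB//; [|exact: dramp_int|exact: dramp_int].
move=> E.
have A1 : `|(\int[mu]_(x in `[a, b]) (dramp s (de n) x * eta x))%R - eta s| <= e / 3.
  apply: ramp_average => //; [exact: ltW| |].
    by rewrite (le_trans _ (ltW (deb n)))// lerD2r ltW.
  by move=> x xs; apply: H1; exact: dist_interval xs dn1.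
have A2 : `|(\int[mu]_(x in `[a, b]) (dramp t (de n) x * eta x))%R - eta t| <= e / 3.
  apply: ramp_average => //; [exact: ltW (lt_trans as_ st)|exact: ltW (deb n)|].
  by move=> x xs; apply: H2; exact: dist_interval xs dn2.
exact: dist_chain E h3 A1 A2.
Qed.
End step.

(** Testing with smooth approximations of the indicator function of [(s, t]]
    turns the weak identity into the increment of [eta] in the limit. *)
Lemma du_bois_reymond a b s t (eta k : R -> R) :
  {within `[a, b], continuous eta} ->
  measurable_fun [set: measurableTypeR R] k ->
  mu.-integrable `[a, b] (EFin \o k) ->
  (forall phi, test_function a b phi ->
    (\int[mu]_(x in `[a, b]) (derive1 phi x * eta x) =
     - \int[mu]_(x in `[a, b]) (phi x * k x))%R) ->
  a < s -> s < t -> t < b ->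
  eta t - eta s = (\int[mu]_(x in `]s, t]) k x)%R.
Proof.
have [th [dth [h1 h2 h3 h4 [h5 h6]]]] := @smooth_step_exists R.
exact: (@du_bois_reymond_step th dth).
Qed.
End du_bois_reymond.

Section weak_derivatives.
Context {R : realType}.
Local Notation mu := (@lebesgue_measure R).
Implicit Types (a b s t e x : R).

Lemma itv_lt_pinfty a b : (mu `[a, b] < +oo)%E.
Proof. by rewrite lebesgue_measure_itv/=; case: ifP => _; rewrite ltry. Qed.

Lemma integrable_ae_le (D : set (measurableTypeR R)) (k p : R -> R) :
  measurable D -> measurable_fun [set: measurableTypeR R] k ->
  mu.-integrable D (EFin \o p) -> {ae mu, forall t, D t -> `|k t| <= p t} ->
  mu.-integrable D (EFin \o k).
Proof.
move=> mD mk ip kp; apply/integrableP; split.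
  by apply/measurable_EFinP; exact: measurable_funTS.
have /integrableP[_] := ip; apply: le_lt_trans.
apply: ae_le_integral => //.
  by apply: measurableT_comp => //; apply/measurable_EFinP; exact: measurable_funTS.
by apply: aeS kp => t kp Dt; rewrite /= lee_fin (le_trans (kp Dt))// ler_norm.
Qed.

Lemma ae_le_Rintegral (D : set (measurableTypeR R)) (k p : R -> R) :
  measurable D -> mu.-integrable D (EFin \o k) ->
  mu.-integrable D (EFin \o p) -> {ae mu, forall t, D t -> k t <= p t} ->
  (\int[mu]_(t in D) k t <= \int[mu]_(t in D) p t)%R.
Proof.
move=> mD ik ip kp; rewrite -subr_ge0 -RintegralB//.
have id : mu.-integrable D (EFin \o (fun t => p t - k t)).
  by rewrite (_ : _ \o _ = (EFin \o p) \- (EFin \o k))%E;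
    [exact: integrableB|apply/funext].
have /integrableP[md _] := id.
rewrite /Rintegral (_ : (\int[mu]_(t in D) _)%E =
    (\int[mu]_(t in D) (Num.max (p t - k t) 0)%:E)%E).
  by apply: fine_ge0; apply: integral_ge0 => t _; rewrite lee_fin le_max lexx orbT.
apply: ae_eq_integral => //.
  apply/measurable_EFinP; apply: measurable_maxr => //.
  exact/measurable_EFinP.
by apply: aeS kp => t kp Dt; rewrite /= max_l// subr_ge0 kp.
Qed.

Section functional.
Variables (X : normedModType R) (a b : R) (x dx : R -> X) (l : oper X R^o).
Variable (k : R -> R).
Hypothesis cx : {within `[a, b], continuous x}.
Hypothesis xdx : weak_derivative a b x dx.
Hypothesis mk : measurable_fun [set: measurableTypeR R] k.
Hypothesis ik : mu.-integrable `[a, b] (EFin \o k).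
Hypothesis dxk : {ae mu, forall t, t \in `[a, b] -> l (dx t) = k t :> R}.

Lemma functional_continuous : {within `[a, b], continuous (fun t => l (x t) : R)}.
Proof.
move=> t; apply: (@continuous_comp (subspace `[a, b]) X R x l); first exact: cx.
exact: oper_continuous.
Qed.

Lemma test_function_continuous phi : test_function a b phi ->
  continuous phi /\ continuous (derive1 phi).
Proof.
move=> [dphi _]; split=> t; apply/differentiable_continuous/derivable1_diffP.
  exact: (dphi 0%N).
exact: (dphi 1%N).
Qed.

(** Integrating [k] instead of [dx] avoids Bochner integrals over subintervals,
    about which [weak_derivative] says nothing. *)
Lemma weak_derivative_functional s t : a < s -> s < t -> t < b ->
  l (x t) - l (x s) = (\int[mu]_(r in `]s, t]) k r)%R :> R.
Proof.
apply: (@du_bois_reymond _ a b s t (fun t => l (x t) : R) k).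
- exact: functional_continuous.
- exact: mk.
- exact: ik.
move=> phi tphi; have [cphi cdphi] := test_function_continuous tphi.
have [y y1 y2] := xdx tphi.
have ce := functional_continuous.
rewrite (bochner_integral_functional (l := l) _ _ y1); first last.
- by apply: aeW => r _; rewrite linearZ.
- apply: continuous_compact_integrable; first exact: segment_compact.
  exact: continuous_within_mulr.
- exact: itv_lt_pinfty.
- exact: measurable_itv.
rewrite (bochner_integral_functional (l := l) (k := fun r => phi r * k r) _ _ y2) ?linearN ?opprK//.
- exact: itv_lt_pinfty.
- have [M [_ HM]] := compact_bounded (continuous_compact
    (continuous_subspaceT cphi) (@segment_compact R a b)).
  pose M1 := `|M| + 1.
  apply: (@integrable_ae_le _ _ (fun r => M1 * `|k r|)) => //.
  + by apply: measurable_funM => //; apply: continuous_measurable_fun.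
  + rewrite (_ : EFin \o _ = fun r => M1%:E * `|(k r)%:E|)%E; last by apply/funext.
    apply: integrableZl => //; exact: integrable_abse.
  + apply: aeW => r rab; rewrite normrM ler_wpM2r//.
    by apply: HM; [rewrite (le_lt_trans (ler_norm _))// ltrDl|exists r].
- by apply: aeS dxk => r h rab; rewrite linearZ/= h.
Qed.

End functional.

(** Near [t] the function differs by a constant from the primitive of [k] that
    starts half way between [a] and [t]. *)
Lemma weak_derivative_is_derive (X : normedModType R) a b t (x dx : R -> X)
    (l : oper X R^o) (k : R -> R) : {within `[a, b], continuous x} ->
  weak_derivative a b x dx -> continuous k ->
  {ae mu, forall t, t \in `[a, b] -> l (dx t) = k t :> R} ->
  a < t < b -> is_derive t (1 : R) (fun t => l (x t) : R) (k t).
Proof.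
move=> cx xdx ck dxk /andP[at_ tb]; pose s := (a + t) / 2.
have [as_ st] : a < s /\ s < t by rewrite /s; split; lra.
pose F r := (\int[mu]_(y in [set` Interval (BRight s) (BRight r)]) k y)%R.
have [dF F'] : derivable F t 1 /\ derive1 F t = k t.
  apply: (@continuous_FTC1 R k (BRight s) t b tb).
  - apply: (integrableS _ _ _ (Rintegrable_continuous s b ck)) => //.
    by apply: subset_itvr; rewrite bnd_simp.
  - by [].
  - exact: ck.
have h : is_derive t (1 : R) (fun r => l (x s) + F r : R) (0 + k t).
  exact: is_deriveD (is_derive_cst (l (x s) : R) t 1) (is_derive_derive1 dF F').
rewrite -[k t]add0r; apply: near_eq_is_derive h; near=> r.
have [sr rb] : s < r /\ r < b.
  by split; near: r; [exact: lt_nbhsr|exact: lt_nbhsl].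
rewrite /F -(@weak_derivative_functional X a b x dx l k cx xdx _ _ dxk s r)//.
- by rewrite addrC subrK.
- exact: continuous_measurable_fun.
- exact: Rintegrable_continuous.
Unshelve. all: by end_near. Qed.

Lemma half_absorb (V c I : R) : V <= V / 2 + c / 2 * I -> V <= c * I.
Proof. by move=> ?; lra. Qed.

(** Cauchy-Schwarz for the increment, in the form of Young's inequality with
    the parameter that makes it sharp. *)
Lemma weak_derivative_increment (X : normedModType R) (H : hilbertType R)
    a b s t (x dx : R -> X) (L : oper X H) (p : R -> R) :
  {within `[a, b], continuous x} ->
  weak_derivative a b x dx -> strongly_measurable `[a, b] dx ->
  mu.-integrable `[a, b] (EFin \o p) ->
  {ae mu, forall t, t \in `[a, b] -> `|L (dx t)| ^+ 2 = p t} ->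
  a < s -> s < t -> t < b ->
  `|L (x t) - L (x s)| ^+ 2 <= (t - s) * (\int[mu]_(r in `]s, t]) p r)%R.
Proof.
move=> cx xdx sdx ip dxp as_ st tb.
set v := L (x t) - L (x s).
have lP : (fun y => inner (L y) v : R^o) \in @oper_pred R X R^o.
  apply: (@oper_subproof _ _ _ _ (opnorm L * `|v|)) => [c y z|y].
    by rewrite linearP innerPl.
  rewrite (le_trans (cauchy_schwarz _ _))// mulrAC ler_wpM2r//.
  exact: oper_bound.
pose l := Oper lP.
have [k mk lk] := strongly_measurable_borel (@oper_continuous _ _ _ l) sdx.
pose tau := t - s; have tau0 : 0 < tau by rewrite subr_gt0.
pose y r := `|v| ^+ 2 / (2 * tau) + tau / 2 * p r.
have iy (c d : R) : a <= c -> d <= b -> mu.-integrable `[c, d] (EFin \o y).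
  move=> ac db; rewrite (_ : _ \o _ = (EFin \o (cst (`|v| ^+ 2 / (2 * tau))%R)) \+
      (fun r => (tau / 2)%:E * (p r)%:E))%E; last by apply/funext.
  apply: integrableD => //.
    by apply: Rintegrable_continuous; exact: cst_continuous.
  apply: integrableZl => //; apply: (integrableS _ _ _ ip) => //.
  by move=> r /=; rewrite !in_itv/= => /andP[? ?]; apply/andP; split; lra.
have kdx : {ae mu, forall r, r \in `[a, b] -> `|k r| <= y r}.
  apply: aeS (aeI lk dxp) => r [h1 h2] rab; rewrite -h1//= /y -h2//.
  rewrite (le_trans (cauchy_schwarz _ _))//.
  rewrite -subr_ge0 (_ : _ - _ = (`|v| - tau * `|L (dx r)|) ^+ 2 / (2 * tau)).
    by rewrite divr_ge0 ?sqr_ge0// mulr_ge0// ltW.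
  by field; rewrite gt_eqF.
have ik : mu.-integrable `[a, b] (EFin \o k) by apply: (integrable_ae_le _ mk (iy a b _ _)).
have E : `|v| ^+ 2 = (\int[mu]_(r in `]s, t]) k r)%R.
  rewrite -(@weak_derivative_functional X a b x dx l k cx xdx mk ik lk s t as_ st tb).
  by rewrite -inner_norm /l/= -innerNl -innerDl.
have sub : `]s, t] `<=` `[a, b].
  move=> r /=; rewrite !in_itv/= => /andP[? ?]; apply/andP; split; lra.
have ist (q : R -> R) : mu.-integrable `[a, b] (EFin \o q) ->
    mu.-integrable `]s, t] (EFin \o q).
  by apply: integrableS.
have : `|v| ^+ 2 <= (\int[mu]_(r in `]s, t]) y r)%R.
  rewrite E; apply: ae_le_Rintegral => //; [exact: ist|exact/ist/iy|].
  apply: aeS kdx => r h rst; rewrite (le_trans (ler_norm _))// h//.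
  exact: sub.
rewrite /y RintegralD//; first last.
- rewrite (_ : EFin \o _ = fun r => (tau / 2)%:E * (p r)%:E)%E; last by apply/funext.
  apply: integrableZl => //; exact: ist.
- apply: (ist (cst _)); apply: Rintegrable_continuous; exact: cst_continuous.
rewrite RintegralZl//; last exact: ist.
have muE : fine (mu `]s, t]) = tau by rewrite lebesgue_measure_itv/= lte_fin st.
rewrite Rintegral_cst// (_ : fine _ = tau); last exact: muE.
have -> : `|v| ^+ 2 / (2 * tau) * tau = `|v| ^+ 2 / 2 by field; rewrite gt_eqF.
exact: half_absorb.
Qed.
End weak_derivatives.

(** * Absolutely continuous functions *)

Section absolute_continuity.
Context {R : realType}.
Local Notation mu := (@lebesgue_measure R).
Implicit Types (a b c s t e d : R).

(** By the local hypothesis at the supremum [c] of the [t] with [P a t], first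
    [P a c] holds, and then [c] is not less than [b]. *)
Lemma interval_induction (P : R -> R -> Prop) a b : a <= b ->
  (forall s c t, a <= s -> s <= c -> c <= t -> t <= b ->
    P s c -> P c t -> P s t) ->
  (forall c, a <= c <= b -> exists2 d, 0 < d & forall s t,
    a <= s -> c - d < s -> s <= c -> c <= t -> t < c + d -> t <= b -> P s t) ->
  P a b.
Proof.
move=> ab Padd Ploc.
pose S := [set t | a <= t <= b /\ P a t].
have Sa : S a.
  have aab : a <= a <= b by rewrite lexx.
  have [d d0 H] := Ploc a aab.
  by split=> //; apply: H; rewrite ?lexx//; lra.
have hS : has_sup S by split; [exists a|exists b => t [/andP[]]].
pose c := sup S.
have ac : a <= c by apply: sup_upper_bound.
have cb : c <= b by apply: ge_sup; [exists a|move=> t [/andP[]]].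
have acb : a <= c <= b by rewrite ac.
have [d d0 H] := Ploc c acb.
have [t [/andP[at_ tb] Pat] ct] := sup_adherent d0 hS.
have tc : t <= c by apply: sup_upper_bound => //; split=> //; rewrite at_.
have Pac : P a c.
  apply: (Padd _ t) => //; apply: H => //; lra.
have [bc|cb'] := leP b c; first by rewrite (_ : b = c)//; apply/eqP; rewrite eq_le bc.
pose r := Num.min b (c + d / 2).
have cr : c < r by rewrite lt_min cb' ltrDl divr_gt0.
have rb : r <= b by rewrite ge_min lexx.
have rd : r < c + d.
  have : r <= c + d / 2 by rewrite ge_min lexx orbT.
  by move=> h; apply: (le_lt_trans h); lra.
have Pcr : P c r by apply: H => //; lra.
have : r <= c.
  apply: sup_upper_bound => //; split; first by apply/andP; split; lra.
  by apply: (Padd _ c) => //; lra.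
by rewrite leNgt cr.
Qed.

Section ac.
Variables (X : normedModType R) (a b : R) (x dx : R -> X) (q : R -> R).
Hypothesis acx : abs_continuous a b x.
Hypothesis xdx : {ae mu, forall t, t \in `[a, b] -> is_derive t (1 : R) x (dx t)}.
Hypothesis iq : mu.-integrable `[a, b] (EFin \o q).
Hypothesis dxq : {ae mu, forall t, t \in `[a, b] -> `|dx t| <= q t}.

Let F t := (\int[mu]_(r in `]-oo, t]) (q \_ `[a, b]) r)%R.

Let iqr : mu.-integrable [set: measurableTypeR R] (EFin \o (q \_ `[a, b])).
Proof. by rewrite -restrict_EFin; apply: (integrable_mkcond _ _).1. Qed.

Let F_increment s t : a <= s -> s <= t -> t <= b ->
  F t - F s = (\int[mu]_(r in `]s, t]) q r)%R.
Proof.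
move=> as_ st tb.
have -> : F t = F s + (\int[mu]_(r in `]s, t]) (q \_ `[a, b]) r)%R.
  rewrite /F -Rintegral_setU//.
  - congr Rintegral; rewrite -itv_bndbnd_setU//.
  - by apply: (integrableS _ _ _ iqr) => //; exact: measurableU.
  - by apply/disj_setPS => r /= []; rewrite !in_itv/= => h /andP[h' _]; lra.
rewrite addrAC subrr add0r; apply: eq_Rintegral => r /set_mem/=.
rewrite in_itv/= => /andP[? ?]; rewrite patchE mem_set//= in_itv/=.
by apply/andP; split; lra.
Qed.

Let F_derive : {ae mu, forall t, t \in `[a, b] -> is_derive t (1 : R) F (q t)}.
Proof.
have h := @FTC1Ny R (q \_ `[a, b]).
apply: aeS (h _ _) => [t [dF F'] tab||].
- by apply: DeriveDef => //; rewrite -derive1E F' patchE mem_set.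
- by move=> y; apply: (integrableS _ _ _ iqr).
- by apply: integrable_locally.
Qed.

(** The increment over [(s, t)] is bounded by the integral of [q] up to a small
    error, apart from the increments over finitely many disjoint intervals
    whose total length is at most the measure of [O] in [(s, t]].  This is
    additive in the interval, as [interval_induction] requires. *)
Let gap (O : set R) e s t := exists l : seq (R * R),
  [/\ all (fun p => [&& s <= p.1, p.1 <= p.2 & p.2 <= t]) l,
      pairwise (fun p r => p.2 <= r.1) l,
      ((\sum_(p <- l) (p.2 - p.1))%:E <= mu (O `&` `]s, t]))%E &
      `|x t - x s| <= \sum_(p <- l) `|x p.2 - x p.1| + (F t - F s) +
         2 * e * (t - s)].

Let gap_add (O : set R) e s c t : open O -> s <= c -> c <= t ->
  gap O e s c -> gap O e c t -> gap O e s t.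
Proof.
move=> oO sc ct [l1 [h1 h2 h3 h4]] [l2 [k1 k2 k3 k4]]; exists (l1 ++ l2).
have mO : measurable (O : set (measurableTypeR R)) by exact: open_measurable.
split.
- rewrite all_cat; apply/andP; split.
    apply/allP => p /(allP h1)/and3P[? ? ?]; apply/and3P; split => //; lra.
  apply/allP => p /(allP k1)/and3P[? ? ?]; apply/and3P; split => //; lra.
- rewrite pairwise_cat h2 k2 !andbT; apply/allrelP => p r.
  move=> /(allP h1)/and3P[? ? ?] /(allP k1)/and3P[? ? ?]; lra.
- rewrite big_cat/= EFinD.
  have -> : O `&` `]s, t] = (O `&` `]s, c]) `|` (O `&` `]c, t]).
    by rewrite -setIUr -itv_bndbnd_setU// bnd_simp.
  rewrite measureU//; first exact: leeD.
  - exact: measurableI.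
  - exact: measurableI.
  - rewrite setIACA setIid [X in _ `&` X](_ : _ = set0) ?setI0//.
    by apply/seteqP; split=> // r /= []; rewrite !in_itv/= => /andP[? ?] /andP[? ?]; lra.
- rewrite big_cat/=.
  have := ler_normD (x t - x c) (x c - x s); rewrite addrA subrK => h.
  move: h4 k4 h.
  move: (\sum_(_ <- _) _) (\sum_(_ <- _) _) `|_| `|_| `|_| => u1 u2 n1 n2 n3 *; lra.
Qed.

Let gap_open (O : set R) e c : 0 < e -> open O -> O c ->
  exists2 d, 0 < d & forall s t, c - d < s -> s <= c -> c <= t -> t < c + d ->
    0 <= F t - F s -> gap O e s t.
Proof.
move=> e0 oO Oc.
have /nbhs_distP[d d0 dO] : \forall r \near c, O r by exact: open_nbhs_nbhs.
exists d => // s t cs sc ct td F0; exists [:: (s, t)]; split => //=.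
- by rewrite !lexx (le_trans sc ct).
- rewrite big_seq1/= (_ : O `&` _ = `]s, t]%classic).
    rewrite lebesgue_measure_itv/= lte_fin; case: ltP => [_|ts]; first by rewrite EFinB.
    by rewrite lee_fin subr_le0.
  apply/seteqP; split => [r []//|r srt]; split => //; apply: dO.
  move: srt; rewrite /= in_itv/= ltr_norml => /andP[? ?]; apply/andP; split; lra.
- rewrite big_seq1/= -addrA lerDl addr_ge0// mulr_ge0 ?subr_ge0 ?(le_trans sc ct)//.
  by rewrite mulr_ge0// ltW.
Qed.

Let gap_derive (O : set R) e c : 0 < e ->
  is_derive c (1 : R) x (dx c) -> is_derive c (1 : R) F (q c) -> `|dx c| <= q c ->
  exists2 d, 0 < d & forall s t, c - d < s -> s <= c -> c <= t -> t < c + d ->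
    gap O e s t.
Proof.
move=> e0 xc Fc dq.
have [d1 d10 H1] := (is_derive_distP _ _ _).1 xc _ e0.
have [d2 d20 H2] := (is_derive_distP _ _ _).1 Fc _ e0.
exists (Num.min d1 d2); first by rewrite lt_min d10.
move=> s t cs sc ct td; exists [::]; split=> //.
  by rewrite big_nil measure_ge0.
rewrite big_nil add0r.
have dd1 : Num.min d1 d2 <= d1 by rewrite ge_min lexx.
have dd2 : Num.min d1 d2 <= d2 by rewrite ge_min lexx orbT.
have sd1 : `|s - c| < d1 by rewrite ltr_norml; apply/andP; split; lra.
have sd2 : `|s - c| < d2 by rewrite ltr_norml; apply/andP; split; lra.
have td1 : `|t - c| < d1 by rewrite ltr_norml; apply/andP; split; lra.
have td2 : `|t - c| < d2 by rewrite ltr_norml; apply/andP; split; lra.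
move: (H1 _ sd1) (H1 _ td1) (H2 _ sd2) (H2 _ td2).
rewrite [`|s - c|]ler0_norm ?subr_le0// [`|t - c|]ger0_norm ?subr_ge0//.
set y1 := x s - _ - _; set y2 := x t - _ - _ => h1 h2.
rewrite !ler_norml => /andP[h3 h3'] /andP[h4 h4'].
have : `|x t - x s| <= `|y2| + `|y1| + (t - s) * `|dx c|.
  have -> : x t - x s = y2 - y1 + (t - s) *: dx c.
    have -> : x t = y2 + (t - c) *: dx c + x c by rewrite /y2 !subrK.
    have -> : x s = y1 + (s - c) *: dx c + x c by rewrite /y1 !subrK.
    rewrite opprD addrACA subrr addr0 opprD addrACA -scalerBl.
    by congr (_ + _ *: _); ring.
  rewrite (le_trans (ler_normD _ _))// normrZ ger0_norm ?subr_ge0 ?(le_trans sc ct)//.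
  by rewrite lerD2r ler_normB.
have : (t - s) * `|dx c| <= (t - s) * q c.
  by rewrite ler_wpM2l// subr_ge0 (le_trans sc ct).
move: h3 h3' h4 h4'; rewrite -![_ *: _]/(_ * _) => *; lra.
Qed.
(** The null set where the derivatives of [x] or of the primitive of [q] are
    missing is covered by an open set of small measure, on which absolute
    continuity controls the increments of [x]. *)
Lemma abs_continuous_increment s t : a <= s -> s <= t -> t <= b ->
  `|x t - x s| <= (\int[mu]_(r in `]s, t]) q r)%R.
Proof.
move=> as_ st tb; rewrite -F_increment//.
have [N [mN N0 HN]] := aeI (aeI xdx dxq) F_derive.
apply/ler_addgt0Pr => e e0.
(* [e' + 2 * e' * (t - s) = e] : one [e'] for the intervals in the open set,
   the rest for the linear error in [gap]. *)
pose e' := e / (1 + 2 * (t - s)).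
have D0 : 0 < 1 + 2 * (t - s) by rewrite ltr_pwDl// mulr_ge0// subr_ge0.
have e0' : 0 < e' by rewrite divr_gt0.
have [del del0 Hdel] := acx e0'.
have mNoo : (mu N < +oo)%E by rewrite N0.
have [ O [oO NO muO]] := lebesgue_regularity_outer mN mNoo del0.
have mO : measurable (O : set (measurableTypeR R)) by exact: open_measurable.
have {}muO : (mu O < del%:E)%E.
  apply: le_lt_trans muO.
  rewrite -[X in (mu X <= _)%E](setDUK NO) measureU//.
  - by rewrite [X in (X + _ <= _)%E](_ : _ = 0%E) ?add0e//; exact: N0.
  - exact: measurableD.
  - by rewrite setDE setICA setICr setI0.
have F_mono r1 r2 : a <= r1 -> r1 <= r2 -> r2 <= b ->
    0 <= F r2 - F r1.
  move=> h1 h2 h3; rewrite F_increment//.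
  have iz : mu.-integrable `]r1, r2] (EFin \o (cst 0 : R -> R)).
    exact: integrable0.
  have -> : 0 = (\int[mu]_(r in `]r1, r2]) (cst 0 r : R))%R by rewrite Rintegral_cst// mul0r.
  apply: ae_le_Rintegral => //.
    apply: (integrableS _ _ _ iq) => //.
    move=> r /=; rewrite !in_itv/= => /andP[? ?]; apply/andP; split; lra.
  apply: aeS dxq => r h /=; rewrite in_itv/= => /andP[? ?].
  by rewrite (le_trans _ (h _))// in_itv/=; apply/andP; split; lra.
have G : gap O e' s t.
  apply: interval_induction => //.
  - by move=> r c r' _ rc cr' _; exact: gap_add.
  - move=> c /andP[sc ct].
    have acb : c \in `[a, b] by rewrite in_itv/=; apply/andP; split; lra.
    have [Oc|Oc] := pselect (O c).
      have [d d0 H] := gap_open e0' oO Oc; exists d => // r1 r2 ? ? ? ? ? ?.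
      by apply: H => //; apply: F_mono; lra.
    have /contrapT[xc [dc Fc]] : ~ ~ ((c \in `[a, b] -> is_derive c (1:R) x (dx c)) /\
        (c \in `[a, b] -> `|dx c| <= q c) /\
        (c \in `[a, b] -> is_derive c (1:R) F (q c))).
      by move=> h; apply: Oc; apply: NO; apply: HN => /= -[[? ?] ?]; exact: h.
    have [d d0 H] := @gap_derive O _ c e0' (xc acb) (Fc acb) (dc acb).
    by exists d => // r1 r2 *; exact: H.
have [l [h1 h2 h3 h4]] := G.
pose pl (j : 'I_(size l)) := nth (0, 0) l j.
have lj j : [&& s <= (pl j).1, (pl j).1 <= (pl j).2 & (pl j).2 <= t].
  by have /allP := h1; apply; exact: mem_nth.
rewrite (big_nth (0, 0)) big_mkord in h4.
rewrite (big_nth (0, 0)) big_mkord in h3.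
have muOst : (mu (O `&` `]s, t]) <= mu O)%E.
  apply: le_measure; rewrite ?inE; [exact: measurableI|exact: mO|].
  exact: subIsetl.
have h : \sum_(j < size l) `|x (pl j).2 - x (pl j).1| < e'.
  apply: (Hdel (size l) (fun j => (pl j).1) (fun j => (pl j).2)).
  - move=> j; have /and3P[l1 l2 l3] := lj j; split => //.
      exact: le_trans as_ l1.
    exact: le_trans l3 tb.
  - have h2' (j k : 'I_(size l)) : (j < k)%N -> (pl j).2 <= (pl k).1.
      by move=> jk; apply: (pairwiseP (0, 0) h2) => //; rewrite inE.
    move=> j k _ _ [r [/=]]; rewrite !in_itv/= => /andP[r1 r2] /andP[r3 r4].
    apply: val_inj; case: (ltngtP j k) => // /h2'; rewrite leNgt.
      by rewrite (lt_trans r3 r2).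
    by rewrite (lt_trans r1 r4).
  - rewrite -lte_fin; exact: le_lt_trans h3 (le_lt_trans muOst muO).
have ee : e = e' + 2 * e' * (t - s) by rewrite /e'; field; rewrite gt_eqF.
rewrite ee; apply: (le_trans h4); rewrite /pl in h.
move: h; move: (\sum_(j < _) _) => u ?; lra.
Qed.
End ac.

End absolute_continuity.

(** * Increments bounded by the square integral of the derivative *)

Section increments.
Context {R : realType}.
Local Notation mu := (@lebesgue_measure R).
Implicit Types (a b c s t e d : R).

(** Cauchy-Schwarz, obtained as in [weak_derivative_increment] from Young's
    inequality [|dx| <= |v| / (2 tau) + tau / (2 |v|) |dx|^2], where [v] is the
    increment and [tau = t - s]. *)
Lemma abs_continuous_increment_sqr (X : normedModType R) a b s t
    (x dx : R -> X) (p : R -> R) : abs_continuous a b x ->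
  {ae mu, forall t, t \in `[a, b] -> is_derive t (1 : R) x (dx t)} ->
  mu.-integrable `[a, b] (EFin \o p) ->
  {ae mu, forall t, t \in `[a, b] -> `|dx t| ^+ 2 = p t} ->
  a <= s -> s <= t -> t <= b ->
  `|x t - x s| ^+ 2 <= (t - s) * (\int[mu]_(r in `]s, t]) p r)%R.
Proof.
move=> acx xdx ip dxp as_; rewrite le_eqVlt => /orP[/eqP -> _|st tb].
  by rewrite !subrr normr0 expr0n mul0r.
pose tau := t - s; have tau0 : 0 < tau by rewrite subr_gt0.
set v := `|x t - x s|.
have ist (q : R -> R) : mu.-integrable `[a, b] (EFin \o q) ->
    mu.-integrable `]s, t] (EFin \o q).
  apply: integrableS => //.
  move=> r /=; rewrite !in_itv/= => /andP[? ?]; apply/andP; split; lra.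
have v_ge0 : 0 <= v by exact: normr_ge0.
have [->|v_neq0] := eqVneq v 0.
  rewrite expr0n mulr_ge0 ?subr_ge0 ?(ltW st)//.
  have -> : 0 = (\int[mu]_(r in `]s, t]) (cst 0 r : R))%R by rewrite Rintegral_cst// mul0r.
  apply: ae_le_Rintegral => //; [exact: integrable0|exact: ist|].
  apply: aeS dxp => r h /=; rewrite in_itv/= => /andP[? ?].
  rewrite -h ?sqr_ge0// in_itv/=; apply/andP; split; lra.
have v0 : 0 < v by rewrite lt_neqAle eq_sym v_neq0.
pose y r := v / (2 * tau) + tau / (2 * v) * p r.
have iy1 : mu.-integrable `[a, b] (fun r => (tau / (2 * v))%:E * (p r)%:E)%E.
  exact: integrableZl.
have iy0 : mu.-integrable `[a, b] (EFin \o cst (v / (2 * tau))).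
  by apply: Rintegrable_continuous; exact: cst_continuous.
have iy : mu.-integrable `[a, b] (EFin \o y).
  rewrite (_ : _ \o _ = (EFin \o (cst (v / (2 * tau))%R)) \+
      (fun r => (tau / (2 * v))%:E * (p r)%:E))%E; last by apply/funext.
  exact: integrableD.
have dxy : {ae mu, forall r, r \in `[a, b] -> `|dx r| <= y r}.
  apply: aeS dxp => r h rab; rewrite /y -h//.
  rewrite -subr_ge0 (_ : _ - _ = (v - tau * `|dx r|) ^+ 2 / (2 * tau * v)).
    by rewrite divr_ge0 ?sqr_ge0// !mulr_ge0// ltW.
  by field; rewrite !gt_eqF.
have := abs_continuous_increment acx xdx iy dxy as_ (ltW st) tb.
rewrite -/v /y RintegralD//; first last.
- exact: (ist (fun r => tau / (2 * v) * p r)).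
- exact: ist.
rewrite RintegralZl//; last exact: ist.
have muE : fine (mu `]s, t]) = tau by rewrite lebesgue_measure_itv/= lte_fin st.
rewrite Rintegral_cst// (_ : fine _ = tau); last exact: muE.
move: (\int[mu]_(r in _) _)%R => I.
have -> : v / (2 * tau) * tau = v / 2 by field; rewrite gt_eqF.
rewrite -(ler_pM2l v0) -expr2 mulrDr -/tau => h; apply: half_absorb.
apply: (le_trans h); rewrite le_eqVlt; apply/orP; left; apply/eqP.
by field; rewrite gt_eqF.
Qed.

Lemma right_limit_le (h : R -> R) (K d : R) : continuous h -> 0 < d ->
  (forall e, 0 < e -> e < d -> h e <= K) -> h 0 <= K.
Proof.
move=> ch d0 H; apply/ler_addgt0Pr => e e0.
have [del del0 Hd] := (continuous_distP h 0).1 (ch 0) _ e0.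
pose r := Num.min del d / 2.
have m0 : 0 < Num.min del d by rewrite lt_min del0.
have r0 : 0 < r by rewrite divr_gt0.
have [rdel rd] : r < del /\ r < d.
  have : Num.min del d <= del by rewrite ge_min lexx.
  have : Num.min del d <= d by rewrite ge_min lexx orbT.
  by rewrite /r => ? ?; split; lra.
have := Hd r; rewrite subr0 gtr0_norm// => /(_ rdel).
have := H r r0 rd; rewrite ler_norml => ? /andP[? ?]; lra.
Qed.

(** The increment between the end points follows by continuity. *)
Lemma weak_derivative_increment_closed (X : normedModType R) (H : hilbertType R)
    a b s t (x dx : R -> X) (L : oper X H) (p : R -> R) :
  {within `[a, b], continuous x} ->
  weak_derivative a b x dx -> strongly_measurable `[a, b] dx ->
  measurable_fun [set: measurableTypeR R] p -> (forall t, 0 <= p t) ->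
  mu.-integrable `[a, b] (EFin \o p) ->
  {ae mu, forall t, t \in `[a, b] -> `|L (dx t)| ^+ 2 = p t} ->
  a <= s -> s <= t -> t <= b ->
  `|L (x t) - L (x s)| ^+ 2 <= (t - s) * (\int[mu]_(r in `]s, t]) p r)%R.
Proof.
move=> cx xdx sdx mp p0 ip dxp as_; rewrite le_eqVlt => /orP[/eqP -> _|st tb].
  by rewrite !subrr normr0 expr0n mul0r.
have ab : a <= b by lra.
pose y r := L (x (clamp a b r)).
have cy : continuous y.
  move=> r; apply: (@continuous_comp _ _ _ (x \o clamp a b) L).
    exact: clamp_continuous.
  exact: oper_continuous.
pose h e := `|y (t - e) - y (s + e)| ^+ 2.
have ch : continuous h.
  move=> e; apply: (@continuous_comp _ _ _ (fun e => `|y (t - e) - y (s + e)|) (fun z => z ^+ 2)).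
    apply: (@continuous_comp _ _ _ (fun e => y (t - e) - y (s + e)) Num.norm); last exact: norm_continuous.
    apply: continuousB.
      apply: (@continuous_comp _ _ _ (fun e => t - e) y); last exact: cy.
      by apply: continuousB; [exact: cst_continuous|exact: cvg_id].
    apply: (@continuous_comp _ _ _ (fun e => s + e) y); last exact: cy.
    by apply: continuousD; [exact: cst_continuous|exact: cvg_id].
  exact: exprn_continuous.
have -> : `|L (x t) - L (x s)| ^+ 2 = h 0.
  by rewrite /h /y subr0 addr0 !clamp_id//; apply/andP; split; lra.
apply: (@right_limit_le _ _ ((t - s) / 2)) => //; first by rewrite divr_gt0// subr_gt0.
move=> e e0 ed; rewrite /h /y !clamp_id; try (apply/andP; split; lra).
have := @weak_derivative_increment _ X H a b (s + e) (t - e) x dx L p cx xdx sdx ip dxp.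
move=> /(_ _ _ _)/le_trans; apply; try lra.
have sub c d (q : R -> R) : a <= c -> d <= b -> mu.-integrable `[a, b] (EFin \o q) ->
    mu.-integrable `]c, d] (EFin \o q).
  move=> ac db; apply: integrableS => //.
  move=> r /=; rewrite !in_itv/= => /andP[? ?]; apply/andP; split; lra.
apply: ler_pM; [lra|by apply: Rintegral_ge0|lra|].
rewrite /Rintegral fine_le//.
- by apply: integrable_fin_num => //; apply: sub => //; lra.
- by apply: integrable_fin_num => //; apply: sub => //; lra.
apply: ge0_subset_integral => //.
- by apply/measurable_EFinP; exact: measurable_funTS.
- by move=> r _; rewrite lee_fin.
- move=> r /=; rewrite !in_itv/= => /andP[? ?]; apply/andP; split; lra.
Qed.

(** A Borel version of [psi \o f], which is integrable although
    [bochner_L2] only bounds an integral of a function that may fail to be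
    Borel measurable. *)
Lemma bochner_L2_borel (X : normedModType R) a b (f : R -> X) (psi : X -> R) c :
  bochner_L2 a b f -> continuous psi -> 0 <= c ->
  (forall v, 0 <= psi v <= c * `|v| ^+ 2) ->
  exists p : R -> R, [/\ measurable_fun [set: measurableTypeR R] p,
    forall t, 0 <= p t, mu.-integrable `[a, b] (EFin \o p) &
    {ae mu, forall t, t \in `[a, b] -> psi (f t) = p t}].
Proof.
move=> [sf f2] cpsi c0 Hpsi.
have [p mp pE] := strongly_measurable_borel cpsi sf.
have cn2 : continuous (fun v : X => `|v| ^+ 2).
  move=> v; apply: (@continuous_comp X R R (fun v => `|v|) (fun z => z ^+ 2)).
    exact: norm_continuous.
  exact: exprn_continuous.
have [p2 mp2 p2E] := strongly_measurable_borel cn2 sf.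
have ip2 : mu.-integrable `[a, b] (EFin \o p2).
  apply/integrableP; split; first by apply/measurable_EFinP; exact: measurable_funTS.
  apply: le_lt_trans f2; apply: ae_le_integral => //.
  - by apply: measurableT_comp => //; apply/measurable_EFinP; exact: measurable_funTS.
  - by apply: aeS p2E => t h rab; rewrite /= lee_fin -h// ger0_norm.
exists (fun t => Num.max (p t) 0); split.
- by apply: measurable_maxr.
- by move=> t; rewrite le_max lexx orbT.
- apply: (@integrable_ae_le _ _ _ (fun t => c * p2 t)) => //.
  + exact: measurable_maxr.
  + by rewrite (_ : EFin \o _ = fun t => c%:E * (p2 t)%:E)%E;
      [exact: integrableZl|apply/funext].
  + apply: aeS (aeI pE p2E) => t [h1 h2] rab; rewrite -h1// -h2//.
    by have /andP[h3 h4] := Hpsi (f t); rewrite max_l// ger0_norm.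
- by apply: aeS pE => t h rab; rewrite -h// max_l//; case/andP: (Hpsi (f t)).
Qed.
End increments.

(** * Gronwall's inequality and derivatives of quadratic forms *)

Section derivatives.
Context {R : realType}.
Implicit Types (a b s t e h c : R).

Lemma is_derive_bounded_linear (V W : normedModType R) (f : V -> W) (K : R)
    (P : R -> V) t v :
  (forall c u w, f (c *: u + w) = c *: f u + f w) ->
  (forall u, `|f u| <= K * `|u|) ->
  is_derive t (1 : R) P v -> is_derive t (1 : R) (fun s => f (P s)) (f v).
Proof.
move=> fP fK Pv; apply/is_derive_distP => e e0.
have K0 : 0 < `|K| + 1 by rewrite ltr_wpDl.
have [d d0 H] := (is_derive_distP _ _ _).1 Pv _ (divr_gt0 e0 K0).
exists d => // s sd.
have fB u w : f (u - w) = f u - f w.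
  by rewrite -[- w]scaleN1r addrC fP scaleN1r addrC.
have f0 : f 0 = 0 by rewrite -(subrr v) fB subrr.
have fZ c u : f (c *: u) = c *: f u by have := fP c u 0; rewrite !addr0 f0 addr0.
rewrite -fZ -!fB (le_trans (fK _))//.
apply: (@le_trans _ _ ((`|K| + 1) * (e / (`|K| + 1) * `|s - t|))).
  rewrite (le_trans (ler_wpM2r _ (_ : K <= `|K| + 1)))//.
    by rewrite (le_trans (ler_norm _))// lerDl.
  by rewrite ler_wpM2l ?(ltW K0)// H.
by rewrite mulrA mulrCA divff ?mulr1// gt_eqF.
Qed.

Lemma is_derive_shift_arg (V : normedModType R) (P : R -> V) t h v :
  is_derive (t + h) (1 : R) P v -> is_derive t (1 : R) (fun s => P (s + h)) v.
Proof.
move=> /is_derive_distP H; apply/is_derive_distP => e /H[d d0 Hd].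
exists d => // s sd; have E : s + h - (t + h) = s - t by ring.
by have := Hd (s + h); rewrite E; apply.
Qed.

Lemma gronwall (y dy : R -> R) c M a b : a <= b -> 0 <= c -> 0 <= M ->
  (forall t, a <= t <= b -> is_derive t (1 : R) y (dy t)) ->
  (forall t, a <= t <= b -> dy t <= c * y t + M) ->
  y b <= expR (c * (b - a)) * (y a + M * (b - a)).
Proof.
move=> ab c0 M0 ydy dyle.
pose Y t := expR (- c * t + c * a) * y t.
pose dY t := expR (- c * t + c * a) * (dy t - c * y t).
have YdY t : a <= t <= b -> is_derive t (1 : R) Y (dY t).
  move=> tab; have h1 := ydy t tab.
  have h2 := is_derive_affine (is_derive_expR (- c * t + c * a)).
  apply: is_derive_eq (is_deriveM h2 h1) _.
  by rewrite /dY -![_ *: _]/(_ * _); ring.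
have YL : Y b - Y a <= M * (b - a).
  have [| |t /[!in_itv]/= tab ->] := @MVT_segment R Y dY a b ab.
  - by move=> x /[!in_itv]/= /andP[ax xb]; apply: YdY; rewrite !ltW.
  - apply: derivable_within_continuous => x /[!in_itv]/= xab.
    by case: (YdY x xab).
  rewrite ler_wpM2r ?subr_ge0// /dY.
  apply: (@le_trans _ _ (expR (- c * t + c * a) * M)).
    by rewrite ler_wpM2l ?expR_ge0// lerBlDl dyle.
  rewrite ler_piMl// -[X in _ <= X]expR0 ler_expR.
  by rewrite mulNr addrC subr_le0 ler_wpM2l//; case/andP: tab.
have -> : y b = expR (c * (b - a)) * Y b.
  rewrite /Y mulrA -expRD (_ : _ + _ = 0) ?expR0 ?mul1r//; ring.
rewrite ler_wpM2l ?expR_ge0//; move: YL; rewrite {2}/Y.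
by rewrite (_ : - c * a + c * a = 0) ?expR0 ?mul1r; [lra|ring].
Qed.

Section quadratic.
Variables (V : normedModType R) (q : V -> V -> R) (K : R).
Hypothesis qC : forall u v, q u v = q v u.
Hypothesis qP : forall c u v w, q (c *: u + v) w = c * q u w + q v w.
Hypothesis qK : forall u v, `|q u v| <= K * `|u| * `|v|.

Let qE := formE qC qP.

Let qbd x y : `|q x y| <= `|K| * `|x| * `|y|.
Proof. by rewrite (le_trans (qK _ _))// !ler_wpM2r//; exact: ler_norm. Qed.

Lemma quadratic_dist u v :
  `|q v v - q u u| <= `|K| * (`|v - u| + 2 * `|u|) * `|v - u|.
Proof.
have -> : q v v - q u u = q (v - u) (v - u) + 2 * q u (v - u).
  by rewrite !qE [q v u]qC; ring.
rewrite (le_trans (ler_normD _ _))// normrM ger0_norm//.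
have := qbd (v - u) (v - u); have := qbd u (v - u) => ? ?; lra.
Qed.

Lemma is_derive_quadratic (P : R -> V) t v : is_derive t (1 : R) P v ->
  is_derive t (1 : R) (fun s => q (P s) (P s)) (2 * q (P t) v).
Proof.
move=> Pv.
have Pl : is_derive t (1 : R) (fun s => q (P s) (P t)) (q v (P t)).
  apply: (@is_derive_bounded_linear V R (fun u => q u (P t)) (K * `|P t|)) => // u.
  by rewrite mulrAC.
apply/is_derive_distP => e e0.
have e2 : 0 < e / 3 by rewrite divr_gt0.
have [d1 d10 H1] := (is_derive_distP _ _ _).1 Pl _ e2.
pose k := `|K| * (`|v| + 1) ^+ 2 + 1.
have k0 : 0 < k by rewrite ltr_wpDl// mulr_ge0// sqr_ge0.
have [d2 d20 H2] := (is_derive_distP _ _ _).1 Pv _ ltr01.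
exists (Num.min d1 (Num.min d2 (e / 3 / k))).
  by rewrite !lt_min d10 d20 divr_gt0.
move=> s; rewrite !lt_min => /and3P[/H1 h1 /H2 h2 h3].
have h4 : `|P s - P t| <= (`|v| + 1) * `|s - t|.
  rewrite -[P s - P t](subrK ((s - t) *: v)) (le_trans (ler_normD _ _))//.
  by rewrite normrZ mulrDl addrC [`|v| * _]mulrC lerD2l.
have -> : q (P s) (P s) - q (P t) (P t) - (s - t) *: (2 * q (P t) v) =
    2 * (q (P s) (P t) - q (P t) (P t) - (s - t) *: q v (P t)) +
    q (P s - P t) (P s - P t).
  by rewrite !qE [q v _]qC [q (P t) (P s)]qC -![_ *: _]/(_ * _); ring.
have h5 : `|q (P s - P t) (P s - P t)| <= e / 3 * `|s - t|.
  apply: (le_trans (qbd _ _)).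
  apply: (@le_trans _ _ (`|K| * ((`|v| + 1) * `|s - t|) * ((`|v| + 1) * `|s - t|))).
    by apply: ler_pM => //; rewrite ler_wpM2l.
  have -> : `|K| * ((`|v| + 1) * `|s - t|) * ((`|v| + 1) * `|s - t|) =
      `|K| * (`|v| + 1) ^+ 2 * `|s - t| * `|s - t| by ring.
  rewrite ler_wpM2r//; apply: (@le_trans _ _ (k * `|s - t|)).
    by rewrite ler_wpM2r// lerDl.
  by move: h3; rewrite ltr_pdivlMr// mulrC => /ltW.
rewrite (le_trans (ler_normD _ _))// normrM ger0_norm//.
by move: h1 h5; lra.
Qed.
End quadratic.
End derivatives.

(** * The energy *)

Section energy_form.
Context {R : realType} (V H : hilbertType R) (i : oper V H).
Variables (A A1 : oper V (dual V)) (A2 : oper V H) (muA : R).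

(** The weight of the [H]-norm for which [A1 + garding * (., .)_H] is coercive
    with constant [muA / 2] on the kernel of [B]. *)
Definition garding : R := opnorm A2 ^+ 2 / (2 * muA).

Definition energy_form (u v : V) : R := A1 u v + garding * inner (i u) (i v).

(** The exponential growth rate of the energy in [energy_dissipation]; the
    factor [3] comes from the square of a sum of three terms. *)
Definition energy_rate : R :=
  3 * (opnorm A2 ^+ 2 + garding ^+ 2 * opnorm i ^+ 2) / muA.

Hypothesis mu0 : 0 < muA.
Hypothesis sp : splitting i A A1 A2.

Lemma splittingE v w : A v w = A1 v w + inner (A2 v) (i w).
Proof. by rewrite (sp.2 v). Qed.

Lemma energy_formC u v : energy_form u v = energy_form v u.
Proof. by rewrite /energy_form (sp.1 u) innerC. Qed.

Lemma energy_formP c u v w :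
  energy_form (c *: u + v) w = c * energy_form u w + energy_form v w.
Proof. by rewrite /energy_form operPl linearP innerPl; ring. Qed.

Lemma garding_ge0 : 0 <= garding.
Proof. by rewrite divr_ge0 ?sqr_ge0// mulr_ge0// ltW. Qed.

Lemma energy_form_bounded u v :
  `|energy_form u v| <= (opnorm A1 + garding * opnorm i ^+ 2) * `|u| * `|v|.
Proof.
rewrite (le_trans (ler_normD _ _))// !mulrDl lerD ?oper_bound2//.
have key : `|inner (i u) (i v)| <= opnorm i ^+ 2 * `|u| * `|v|.
  rewrite (le_trans (cauchy_schwarz _ _))//.
  have -> : opnorm i ^+ 2 * `|u| * `|v| = (opnorm i * `|u|) * (opnorm i * `|v|) by ring.
  by apply: ler_pM => //; exact: oper_bound.
rewrite normrM (ger0_norm garding_ge0) (le_trans (ler_wpM2l garding_ge0 key))//.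
by move: garding => k; rewrite !mulrA.
Qed.

Lemma energy_rate_ge0 : 0 <= energy_rate.
Proof.
by rewrite divr_ge0 ?(ltW mu0)// mulr_ge0// addr_ge0 ?sqr_ge0// mulr_ge0 ?sqr_ge0.
Qed.

(** Garding inequality: the lower order part of [A] is absorbed by the [H]-norm. *)
Lemma energy_form_coercive v : muA * `|v| ^+ 2 <= A v v ->
  muA / 2 * `|v| ^+ 2 <= energy_form v v.
Proof.
move=> Av; rewrite /energy_form.
have -> : A1 v v = A v v - inner (A2 v) (i v) by rewrite splittingE addrK.
have h : inner (A2 v) (i v) <= opnorm A2 * `|v| * `|i v|.
  by rewrite (le_trans (inner_le _ _))// ler_wpM2r// oper_bound.
rewrite inner_norm.
have h2 : 0 <= muA / 2 * (`|v| - opnorm A2 * `|i v| / muA) ^+ 2.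
  by rewrite mulr_ge0 ?sqr_ge0// divr_ge0// ltW.
have E : muA / 2 * (`|v| - opnorm A2 * `|i v| / muA) ^+ 2 =
    muA / 2 * `|v| ^+ 2 - opnorm A2 * `|v| * `|i v| + garding * `|i v| ^+ 2.
  by rewrite /garding; field; rewrite gt_eqF.
lra.
Qed.

Lemma sqr_absorb (X g : R) : - 2 * X ^+ 2 + 2 * (g * X) <= g ^+ 2 / 2.
Proof.
rewrite -subr_ge0 (_ : _ - _ = 2 * (X - g / 2) ^+ 2).
  by rewrite mulr_ge0// sqr_ge0.
by field.
Qed.

Lemma sqr_sum3 (x y z : R) : (x + y + z) ^+ 2 <= 3 * (x ^+ 2 + y ^+ 2 + z ^+ 2).
Proof.
rewrite -subr_ge0 (_ : _ - _ = (x - y) ^+ 2 + (y - z) ^+ 2 + (x - z) ^+ 2).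
  by rewrite !addr_ge0// sqr_ge0.
by ring.
Qed.

(** Testing the evolution equation [m' + A m = G] with [m'] itself: the term
    [- |i m'|^2] absorbs [m'] on the right-hand side, so that the bound does
    not involve [m'] any more. *)
Lemma energy_dissipation (m m' : V) (G : H) (M : R) :
  muA * `|m| ^+ 2 <= A m m -> `|G| <= M ->
  inner (i m') (i m') = - A m m' + inner G (i m') ->
  2 * energy_form m m' <= energy_rate * energy_form m m + 3 / 2 * M ^+ 2.
Proof.
move=> Am GM eq_m.
have M0 : 0 <= M by exact: le_trans (normr_ge0 _) GM.
have k0 := garding_ge0.
pose g := M + opnorm A2 * `|m| + garding * (opnorm i * `|m|).
have A20 := opnorm_ge0 A2; have i0 := opnorm_ge0 i.
have g0 : 0 <= g.
  apply: addr_ge0; last exact: mulr_ge0 k0 (mulr_ge0 i0 (normr_ge0 m)).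
  exact: addr_ge0 M0 (mulr_ge0 A20 (normr_ge0 m)).
pose W := G - A2 m + garding *: i m.
have Wg : `|W| <= g.
  rewrite (le_trans (ler_normD _ _))// lerD//.
    rewrite (le_trans (ler_normB _ _))// lerD// oper_bound//.
  by rewrite normrZ (ger0_norm k0); apply: (ler_wpM2l k0); exact: oper_bound.
have E : 2 * energy_form m m' = - 2 * `|i m'| ^+ 2 + 2 * inner W (i m').
  rewrite /energy_form /W !innerDl innerNl innerZl.
  have -> : A1 m m' = A m m' - inner (A2 m) (i m') by rewrite splittingE addrK.
  have -> : A m m' = inner G (i m') - inner (i m') (i m') by rewrite eq_m; ring.
  by rewrite inner_norm; ring.
have h1 : inner W (i m') <= g * `|i m'|.
  by rewrite (le_trans (inner_le _ _))// ler_wpM2r.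
have h2 := sqr_absorb `|i m'| g.
have h3 : g ^+ 2 <= 3 * (M ^+ 2 + (opnorm A2 * `|m|) ^+ 2 + (garding * (opnorm i * `|m|)) ^+ 2).
  exact: sqr_sum3.
have h4 : 3 / 2 * ((opnorm A2 * `|m|) ^+ 2 + (garding * (opnorm i * `|m|)) ^+ 2)
    <= energy_rate * energy_form m m.
  apply: (@le_trans _ _ (energy_rate * (muA / 2 * `|m| ^+ 2))).
    rewrite le_eqVlt; apply/orP; left; apply/eqP; rewrite /energy_rate.
    by field; rewrite gt_eqF.
  by rewrite ler_wpM2l ?energy_rate_ge0// energy_form_coercive.
rewrite E; lra.
Qed.
End energy_form.

Section energy_estimate.
Context {R : realType} (V H Q : hilbertType R) (i : oper V H).
Variables (A A1 : oper V (dual V)) (A2 : oper V H) (muA : R).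
Variable (B : oper V (dual Q)).
Hypothesis mu0 : 0 < muA.
Hypothesis sp : splitting i A A1 A2.
Hypothesis Aell : elliptic_on A (operator_kernel B) muA.
Local Notation E := (energy_form i A1 A2 muA).
Local Notation rate := (energy_rate i A2 muA).

Variables (a b : R) (d : R -> V) (F : R -> H) (M : R).
Hypothesis ab : a < b.
Hypothesis cd : continuous d.
Hypothesis cF : continuous F.
Hypothesis Bd : forall t, B (d t) = 0.
Hypothesis FM : forall t, a <= t <= b -> `|F t| <= M.
Hypothesis eq_d : forall w, B w = 0 -> forall t, a < t < b ->
  is_derive t (1 : R) (fun s => inner (i (d s)) (i w))
    (- A (d t) w + inner (F t) (i w)).

Lemma derive0_eq (f : R -> R) (s t : R) : s <= t ->
  (forall r, s <= r <= t -> {for r, continuous f}) ->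
  (forall r, s < r < t -> is_derive r (1 : R) f 0) -> f s = f t.
Proof.
move=> st cf f0; apply/eqP; rewrite eq_sym -subr_eq0.
have cw : {within `[s, t], continuous f}.
  apply: continuous_in_subspaceT => r; rewrite inE/= in_itv/= => rst.
  exact: cf.
have fd r : r \in `]s, t[ -> is_derive r (1 : R) f 0 by rewrite in_itv; exact: f0.
by have [r _ ->] := @MVT_segment R f (fun=> 0) s t st fd cw; rewrite mul0r.
Qed.

Section averages.
Variables (P : R -> V) (Phi : R -> H).
Hypothesis Pd : forall t, a - 1 < t -> is_derive t (1 : R) P (d t).
Hypothesis PhiF : forall t, a - 1 < t -> is_derive t (1 : R) Phi (F t).

(** The increments of [P] stay in the kernel of [B] because their derivative
    does. *)
Lemma kernel_primitive s t : a <= s -> s <= t -> B (P t - P s) = 0.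
Proof.
move=> as_ st; apply/val_inj/funext => q /=.
have h r : a <= r -> is_derive r (1 : R) (fun y => B (P y) q : R) 0.
  move=> ar; have -> : 0 = B (d r) q :> R by rewrite Bd.
  apply: (@is_derive_bounded_linear R V R (fun v => B v q) (opnorm B * `|q|)).
  - by move=> c u w; rewrite operPl.
  - by move=> u; rewrite (le_trans (oper_bound2 _ _ _))// mulrAC.
  - by apply: Pd; lra.
rewrite operBl; apply/eqP; rewrite subr_eq0 eq_sym; apply/eqP.
apply: (@derive0_eq (fun y => B (P y) q : R) s t st) => r rst.
  by apply: is_derive_continuous (h r _); lra.
by apply: h; lra.
Qed.

(** The difference of the two sides is continuous in [t] on [[a, b]] and has
    derivative [0] inside. *)
Lemma integrated_equation w s t : B w = 0 -> a <= s -> s <= t -> t <= b ->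
  inner (i (d t - d s)) (i w) = - A (P t - P s) w + inner (Phi t - Phi s) (i w).
Proof.
move=> Bw as_ st tb.
have dA r : a <= r -> is_derive r (1 : R) (fun y => A (P y) w : R) (A (d r) w).
  move=> ar; apply: (@is_derive_bounded_linear R V R (fun v => A v w) (opnorm A * `|w|)).
  - by move=> c u v; rewrite operPl.
  - by move=> u; rewrite (le_trans (oper_bound2 _ _ _))// mulrAC.
  - by apply: Pd; lra.
have dPhi r : a <= r -> is_derive r (1 : R) (fun y => inner (Phi y) (i w)) (inner (F r) (i w)).
  move=> ar; apply: (@is_derive_bounded_linear R H R (fun v => inner v (i w)) `|i w|).
  - by move=> c u v; rewrite innerPl.
  - by move=> u; rewrite (le_trans (cauchy_schwarz _ _))// mulrC.
  - by apply: PhiF; lra.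
pose f y := inner (i (d y)) (i w) + (A (P y) w - inner (Phi y) (i w)).
have cid : continuous (fun y => inner (i (d y)) (i w)).
  apply: (@continuous_inner R H (fun y => i (d y))) => y.
  by apply: (@continuous_comp _ _ _ d i); [exact: cd|exact: oper_continuous].
have : f s = f t.
  apply: derive0_eq => // r rst.
    apply: continuousD; first exact: cid.
    apply: continuousB.
      by apply: is_derive_continuous (dA r _); lra.
    by apply: is_derive_continuous (dPhi r _); lra.
  have rab : a < r < b by lra.
  have h1 := eq_d Bw rab; have h2 := dA r (ltW (proj1 (andP rab))).
  have h3 := dPhi r (ltW (proj1 (andP rab))).
  apply: is_derive_eq (is_deriveD h1 (is_deriveB h2 h3)) _; ring.
rewrite /f linearB/= operBl !innerDl !innerNl => h; lra.
Qed.

Lemma primitive_increment s t : a <= s -> s <= t -> t <= b ->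
  `|Phi t - Phi s| <= M * (t - s).
Proof.
move=> as_ st tb; set X := Phi t - Phi s.
have M0 : 0 <= M by apply: le_trans (FM (t := a) _) => //; lra.
have [->|X0] := eqVneq X 0; first by rewrite normr0 mulr_ge0// subr_ge0.
rewrite -(@ler_pM2r _ `|X|) ?normr_gt0// -expr2 -inner_norm {1}/X innerDl innerNl.
rewrite (le_trans (ler_norm _))// mulrAC.
apply: (@mean_value_le R (fun y => inner (Phi y) X) (fun y => inner (F y) X)) => // r rst.
  apply: (@is_derive_bounded_linear R H R (fun v => inner v X) `|X|).
  - by move=> c u v; rewrite innerPl.
  - by move=> u; rewrite (le_trans (cauchy_schwarz _ _))// mulrC.
  - by apply: PhiF; lra.
rewrite (le_trans (cauchy_schwarz _ _))// ler_wpM2r// FM//; lra.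
Qed.

Let m h t := h^-1 *: (P (t + h) - P t).

(** The time average [m] of [d] is differentiable with values in [V], so the
    averaged equation may be tested with its derivative. *)
Lemma average_energy h : 0 < h -> h < b - a ->
  E (m h (b - h)) (m h (b - h)) <=
  expR (rate * (b - a)) * (E (m h a) (m h a) + 3 / 2 * M ^+ 2 * (b - a)).
Proof.
move=> h0 hab.
pose m' t := h^-1 *: (d (t + h) - d t).
have Bm t : a <= t -> B (m h t) = 0.
  by move=> at_; rewrite linearZ/= kernel_primitive ?scaler0//; lra.
have Bm' t : B (m' t) = 0 by rewrite linearZ linearB /= !Bd subrr scaler0.
have md t : a <= t -> is_derive t (1 : R) (m h) (m' t).
  move=> at_; apply: is_deriveZ; apply: is_deriveB.
    by apply: is_derive_shift_arg; apply: Pd; lra.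
  by apply: Pd; lra.
have mE t : a <= t <= b - h -> 2 * E (m h t) (m' t) <=
    rate * E (m h t) (m h t) + 3 / 2 * M ^+ 2.
  move=> /andP[at_ tb].
  apply: (@energy_dissipation _ _ _ i A A1 A2 muA mu0 sp _ _ (h^-1 *: (Phi (t + h) - Phi t))).
  - exact/Aell/Bm.
  - rewrite normrZ gtr0_norm ?invr_gt0// ler_pdivrMl// mulrC.
    have -> : M * h = M * (t + h - t) by ring.
    by apply: primitive_increment; lra.
  - have E1 w : inner (i (m' t)) w = h^-1 * inner (i (d (t + h) - d t)) w.
      by rewrite -innerZl /m' linearZ.
    rewrite E1 [A _ _]operZl [inner (h^-1 *: _) _]innerZl.
    rewrite (integrated_equation (Bm' t)); [by rewrite mulrDr mulrN|lra|lra|lra].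
have Epos t : a <= t -> 0 <= E (m h t) (m h t).
  move=> at_; apply: le_trans (energy_form_coercive mu0 sp (Aell (Bm _ at_))).
  by rewrite mulr_ge0 ?sqr_ge0// divr_ge0// ltW.
have ab' : a <= b - h by lra.
have M20 : 0 <= 3 / 2 * M ^+ 2 by rewrite mulr_ge0 ?sqr_ge0.
have := @gronwall R (fun t => E (m h t) (m h t)) (fun t => 2 * E (m h t) (m' t))
  rate (3 / 2 * M ^+ 2) a (b - h) ab' (energy_rate_ge0 _ _ mu0) M20 _ mE.
move=> /(_ _)/le_trans; apply.
  move=> t /andP[at_ tb]; apply: is_derive_quadratic (md t at_).
  - exact: energy_formC sp.
  - exact: energy_formP.
  - exact: energy_form_bounded.
apply: ler_pM; rewrite ?expR_ge0//.
- by rewrite addr_ge0 ?Epos ?lexx// mulr_ge0//; lra.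
- by rewrite ler_expR ler_wpM2l ?energy_rate_ge0//; lra.
- by rewrite lerD2l ler_wpM2l//; lra.
Qed.

Lemma average_left e : 0 < e -> exists2 del, 0 < del &
  forall h, 0 < h -> h < del -> `|m h a - d a| <= e.
Proof.
move=> e0; have a1 : a - 1 < a by lra.
have [del del0 Hd] := (is_derive_distP _ _ _).1 (Pd a1) _ e0.
exists del => // h h0 hdel; have := Hd (a + h).
have -> : a + h - a = h by ring.
rewrite gtr0_norm// => /(_ hdel) {}Hd.
rewrite -[d a](scalerK (lt0r_neq0 h0)) /m -scalerBr normrZ gtr0_norm ?invr_gt0//.
by rewrite ler_pdivrMl// mulrC.
Qed.

Lemma average_right e : 0 < e -> exists2 del, 0 < del &
  forall h, 0 < h -> h < del -> `|m h (b - h) - d b| <= e.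
Proof.
move=> e0; have a1 : a - 1 < b by have := ab; lra.
have [del del0 Hd] := (is_derive_distP _ _ _).1 (Pd a1) _ e0.
exists del => // h h0 hdel; have := Hd (b - h).
have -> : b - h - b = - h by ring.
rewrite normrN gtr0_norm// => /(_ hdel) {}Hd.
rewrite -[d b](scalerK (lt0r_neq0 h0)) /m -scalerBr normrZ gtr0_norm ?invr_gt0//.
rewrite ler_pdivrMl// mulrC (_ : _ - _ = - (P (b - h) - P b - - h *: d b)) ?normrN//.
by rewrite subrK scaleNr opprK opprD opprB.
Qed.
End averages.

(** The energy of the averages tends to that of [d] as [h] tends to [0]; the
    averages over [[a, a + h]] and [[b - h, b]] serve for the two end points. *)
Lemma energy_estimate :
  E (d b) (d b) <=
  expR (rate * (b - a)) * (E (d a) (d a) + 3 / 2 * M ^+ 2 * (b - a)).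
Proof.
have [P Pd] := hilbert_primitive (a - 1) cd.
have [Phi PhiF] := hilbert_primitive (a - 1) cF.
have cEs (u : V) (e : R) : 0 < e -> exists2 del, 0 < del & forall v, `|v - u| <= del ->
    `|E v v - E u u| <= e.
  move=> e0; pose K := opnorm A1 + garding A2 muA * opnorm i ^+ 2.
  have K0 : 0 < (`|K| + 1) * (1 + 2 * `|u|) by rewrite mulr_gt0// ltr_wpDl// mulr_ge0.
  exists (Num.min 1 (e / ((`|K| + 1) * (1 + 2 * `|u|)))).
    by rewrite lt_min ltr01 divr_gt0.
  move=> v; rewrite le_min => /andP[v1 v2].
  apply: (le_trans (quadratic_dist (energy_formC muA sp) (@energy_formP _ _ _ i A1 A2 muA)
    (@energy_form_bounded _ _ _ i A1 A2 muA mu0) u v)).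
  apply: (@le_trans _ _ ((`|K| + 1) * (1 + 2 * `|u|) * `|v - u|)).
    rewrite ler_wpM2r//; apply: ler_pM => //; [by rewrite lerDl|by rewrite lerD2r].
  by rewrite mulrC -ler_pdivlMr.
apply/ler_addgt0Pr => e e0.
pose X := expR (rate * (b - a)); have X0 : 0 < X by exact: expR_gt0.
have e1 : 0 < e / (1 + X) by rewrite divr_gt0// ltr_wpDl// ltW.
have [d1 d10 H1] := cEs (d a) _ e1.
have [d2 d20 H2] := cEs (d b) _ e1.
have [h1 h10 L1] := average_left Pd d10.
have [h2 h20 L2] := average_right Pd d20.
pose h := Num.min (b - a) (Num.min h1 h2) / 2.
have m0 : 0 < Num.min (b - a) (Num.min h1 h2) by rewrite !lt_min subr_gt0 ab h10.
have h0 : 0 < h by rewrite divr_gt0.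
have hm : h < Num.min (b - a) (Num.min h1 h2) by rewrite /h; lra.
move: hm; rewrite !lt_min => /and3P[hba hh1 hh2].
have := average_energy Pd PhiF h0 hba; rewrite -/X.
have := H1 _ (L1 h h0 hh1); have := H2 _ (L2 h h0 hh2).
rewrite !ler_norml => /andP[k1 k2] /andP[k3 k4] k5.
have k6 : X * (E (h^-1 *: (P (a + h) - P a)) (h^-1 *: (P (a + h) - P a)) + 3 / 2 * M ^+ 2 * (b - a)) <=
    X * (E (d a) (d a) + e / (1 + X) + 3 / 2 * M ^+ 2 * (b - a)).
  by rewrite ler_wpM2l ?(ltW X0)// lerD2r -lerBlDl.
have k7 : e = e / (1 + X) + X * (e / (1 + X)).
  by field; rewrite gt_eqF// ltr_wpDl// ltW.
rewrite [X in _ <= _ + X]k7; move: k1 k5 k6.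
move: (E _ _) (E _ _) (E _ _) (E _ _) => E1 E2 E3 E4; lra.
Qed.
End energy_estimate.

(** * The constrained equation tested on the kernel of the constraint *)

Section continuity.
Context {R : realType}.
Local Notation mu := (@lebesgue_measure R).
Implicit Types (a b s t e : R).

(** A continuous function that does not vanish at [t] does not vanish on an
    interval around [t], which is not a null set. *)
Lemma ae_eq0_continuous (X : normedModType R) a b (h : R -> X) : a < b ->
  continuous h -> {ae mu, forall t, t \in `[a, b] -> h t = 0} ->
  forall t, a <= t <= b -> h t = 0.
Proof.
move=> ab ch [N [mN N0 HN]] t /andP[at_ tb]; apply/eqP.
rewrite -normr_le0 leNgt; apply/negP => ht0.
have ht2 : 0 < `|h t| / 2 by rewrite divr_gt0.
have [d d0 Hd] := (continuous_distP h t).1 (ch t) _ ht2.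
pose s1 := Num.max a (t - d); pose s2 := Num.min b (t + d).
have s12 : s1 < s2 by rewrite gt_max !lt_min ab /=; apply/and3P; split; lra.
have sub : `]s1, s2[%classic `<=` N.
  move=> r /=; rewrite in_itv/= gt_max lt_min => /andP[/andP[ar tr] /andP[rb rt]].
  apply: HN => /= H; have rab : r \in `[a, b] by rewrite in_itv/= !ltW.
  have : `|r - t| < d by rewrite ltr_norml; apply/andP; split; lra.
  by move=> /Hd; rewrite H// sub0r normrN leNgt => /negP; apply; lra.
have : (mu `]s1, s2[ <= mu N)%E by apply: le_measure; rewrite ?inE.
rewrite lebesgue_measure_itv/= lte_fin s12 -EFinB; move: N0 => ->.
by rewrite lee_fin subr_le0 leNgt s12.
Qed.

Lemma abs_continuous_within (X : normedModType R) a b (x : R -> X) :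
  abs_continuous a b x -> {within `[a, b], continuous x}.
Proof.
move=> acx; apply/subspace_continuousP => t /=; rewrite in_itv/= => /andP[at_ tb].
apply/cvgrPdist_le => e e0; rewrite near_withinE; apply/nbhs_distP.
have [d d0 Hd] := acx e e0; exists d => // s sd /=; rewrite in_itv/= => /andP[as_ sb].
have key s1 s2 : a <= s1 -> s1 <= s2 -> s2 <= b -> s2 - s1 < d -> `|x s2 - x s1| <= e.
  move=> h1 h2 h3 h4; have := Hd 1%N (fun=> s1) (fun=> s2).
  rewrite !big_ord1 => /(_ _ _ _)/ltW; apply => //.
  by move=> j k _ _ _; rewrite [j]ord1 [k]ord1.
move: sd; rewrite ltr_norml => /andP[sd1 sd2].
have [st|ts] := leP s t; first by apply: key => //; lra.
by rewrite distrC; apply: key => //; lra.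
Qed.

Lemma clamp_near a b t : a < t < b -> \forall s \near t, clamp a b s = s.
Proof.
move=> /andP[at_ tb]; near=> s; apply: clamp_id; apply/andP; split.
  by near: s; exact: lt_le_nbhsr.
by near: s; exact: lt_le_nbhsl.
Unshelve. all: by end_near. Qed.

Lemma within_continuous_sub (X : topologicalType) a b c d (x : R -> X) :
  a <= c -> d <= b -> {within `[a, b], continuous x} -> {within `[c, d], continuous x}.
Proof.
move=> ac db; apply: continuous_subspaceW => r /=; rewrite !in_itv/=.
by move=> /andP[? ?]; apply/andP; split; lra.
Qed.
End continuity.

Section operators.
Context {R : realType}.

Lemma inner_oper_subproof (X : normedModType R) (H : hilbertType R)
  (L : oper X H) (h : H) : (fun y : X => inner (L y) h : R^o) \in @oper_pred R X R^o.
Proof.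
apply: (@oper_subproof _ _ _ _ (opnorm L * `|h|)) => [c y z|y].
  by rewrite linearP innerPl.
rewrite (le_trans (cauchy_schwarz _ _))// mulrAC ler_wpM2r//.
exact: oper_bound.
Qed.

Definition inner_oper (X : normedModType R) (H : hilbertType R)
  (L : oper X H) (h : H) : oper X R^o := Oper (inner_oper_subproof L h).

Lemma id_oper_subproof (X : normedModType R) : (fun y : X => y) \in @oper_pred R X X.
Proof. by apply: (@oper_subproof _ _ _ _ 1) => // y; rewrite mul1r. Qed.

Definition id_oper (X : normedModType R) : oper X X := Oper (id_oper_subproof X).
End operators.

Section kernel_equation.
Context {R : realType} (V H Q : hilbertType R) (i : oper V H).
Variables (A : oper V (dual V)) (B : oper V (dual Q)).
Local Notation mu := (@lebesgue_measure R).

Variables (a b : R) (F : R -> H) (G : R -> dual Q) (x0 : V) (x : R -> V) (lam : R -> Q).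
Hypothesis ab : a < b.
Hypothesis sol : constrained_solution i A B a b F G x0 x lam.

(** Tested with [w] in the kernel of [B] the multiplier disappears, and the
    remaining right-hand side is continuous in time. *)
Lemma kernel_equation w t : B w = 0 -> {within `[a, b], continuous F} ->
  a < t < b -> is_derive t (1 : R) (fun s => inner (i (x s)) (i w))
    (- A (x t) w + inner (F t) (i w)).
Proof.
move=> Bw cF tab.
have [cx [_ [_ [dx [_ _ wdx] xE]]]] := sol.
pose k s : R := - (A (x (clamp a b s)) w : R) + inner (F (clamp a b s)) (i w).
have cxc := clamp_continuous (ltW ab) cx.
have cFc := clamp_continuous (ltW ab) cF.
have ck : continuous k.
  have cA : continuous (fun v => A v w : R).
    exact: (@oper_continuous R V R^o (adjoint A w)).
  move=> s; apply: (@continuousD _ _ _ (fun s => - (A (x (clamp a b s)) w : R))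
    (fun s => inner (F (clamp a b s)) (i w))).
    apply: (@continuousN _ _ _ (fun s => A (x (clamp a b s)) w : R)).
    exact: (@continuous_comp _ _ _ (x \o clamp a b) (fun v => A v w : R) s (cxc s) (cA _)).
  apply: (@continuous_inner R H (F \o clamp a b)); first exact: cFc.
have := @weak_derivative_is_derive R H a b t (i \o x) dx (inner_oper (id_oper H) (i w)) k.
rewrite /k (clamp_id (t := t)); last by case/andP: tab => ? ?; rewrite !ltW.
apply => //.
  move=> s; apply: (@continuous_comp (subspace `[a, b]) V H x i); first exact: cx.
  exact: oper_continuous.
apply: aeS xE => s h sab; rewrite clamp_id; last by move: sab; rewrite in_itv.
have [/(congr1 (fun l : dual V => l w)) + _] := h sab.
rewrite [X in X = _ -> _](_ : _ = inner (dx s) (i w) + A (x s) w + B w (lam s))//.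
by rewrite Bw [(0 : dual Q) _]/(0 : R) addr0 => /= <-; rewrite addrC addrK.
Qed.

(** The residual [B x - G] is continuous and vanishes for almost every time. *)
Lemma constraint_everywhere : {within `[a, b], continuous G} ->
  forall t, a <= t <= b -> B (x t) = G t.
Proof.
move=> cG t tab; have [cx [_ [_ [dx _ xE]]]] := sol.
pose h s := B (x (clamp a b s)) - G (clamp a b s).
have cxc := clamp_continuous (ltW ab) cx.
have cGc := clamp_continuous (ltW ab) cG.
have ch : continuous h.
  move=> s; apply: (@continuousB _ _ _ (B \o (x \o clamp a b)) (G \o clamp a b)).
    apply: continuous_comp; first exact: cxc.
    exact: oper_continuous.
  exact: cGc.
have := ae_eq0_continuous ab ch _ tab; rewrite /h clamp_id// => E.
apply/eqP; rewrite -subr_eq0; apply/eqP; apply: E.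
apply: aeS xE => s hs sab; rewrite clamp_id; last by move: sab; rewrite in_itv.
by have [_ ->] := hs sab; rewrite subrr.
Qed.
End kernel_equation.

(** * The error recursion *)

(** The Lipschitz part of the forcing bound multiplies the energy by
    [1 + 9 L0^2 / mu * tau], which is absorbed into the exponential. *)
Lemma growth_absorb {R : realType} (ra L0 mu tau E0 J M2 : R) :
  0 < mu -> 0 < tau -> 0 <= E0 -> 0 <= J ->
  M2 <= 3 * (L0 ^+ 2 * (2 / mu * E0) + tau * J) ->
  expR (ra * tau) * (E0 + 3 / 2 * M2 * tau) <=
  expR ((ra + 9 * L0 ^+ 2 / mu) * tau) * (E0 + 9 / 2 * tau ^+ 2 * J).
Proof.
move=> mu0 tau0 E00 J0 hM.
pose k := 9 * L0 ^+ 2 / mu * tau.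
have k0 : 0 <= k.
  by rewrite mulr_ge0 ?(ltW tau0)// divr_ge0 ?(ltW mu0)// mulr_ge0// sqr_ge0.
rewrite [(ra + _) * tau]mulrDl -/k expRD -[expR _ * expR k * _]mulrA ler_wpM2l ?expR_ge0//.
have h1 := expR_ge1Dx k.
have h2 : 0 <= 9 / 2 * tau ^+ 2 * J by rewrite mulr_ge0// mulr_ge0// sqr_ge0.
have h3 : (1 + k) * (E0 + 9 / 2 * tau ^+ 2 * J) <=
    expR k * (E0 + 9 / 2 * tau ^+ 2 * J) by rewrite ler_wpM2r// addr_ge0.
apply: le_trans h3.
have h4 : 3 / 2 * M2 * tau <= k * E0 + 9 / 2 * tau ^+ 2 * J.
  apply: (@le_trans _ _ (3 / 2 * (3 * (L0 ^+ 2 * (2 / mu * E0) + tau * J)) * tau)).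
    by rewrite ler_wpM2r ?(ltW tau0)// ler_wpM2l.
  rewrite /k le_eqVlt; apply/orP; left; apply/eqP; field; by rewrite gt_eqF.
have h5 : 0 <= k * (9 / 2 * tau ^+ 2 * J) by rewrite mulr_ge0.
lra.
Qed.

Section error_recursion.
Context {R : realType} (V H Q : hilbertType R) (i : oper V H).
Variables (A A1 : oper V (dual V)) (A2 : oper V H) (muA : R).
Variables (B : oper V (dual Q)) (Bm : dual Q -> V).
Local Notation mu := (@lebesgue_measure R).
Hypothesis mu0 : 0 < muA.
Hypothesis sp : splitting i A A1 A2.
Hypothesis Aell : elliptic_on A (operator_kernel B) muA.
Hypothesis Bm_inv : right_inverse_onto_Vc A B Bm.
Local Notation E := (energy_form i A1 A2 muA).
Local Notation rate := (energy_rate i A2 muA).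

Variable (BmO : oper (dual Q) V).
Hypothesis BmOE : forall h, BmO h = Bm h.

Variable (L : oper (dual Q) H).
Hypothesis LE : forall h, L h = i (Bm h).

Variables (T : R) (u0 : V) (g dg ddg : R -> dual Q) (f : R -> V -> H).
Variables (u : R -> V) (lam : R -> Q) (df : R -> H) (p1 p2 : R -> R).
Hypothesis T0 : 0 < T.
Hypothesis gH2 : bochner_H2 0 T g dg ddg.
Hypothesis sol : constrained_solution i A B 0 T (fun t => f t (u t)) g u0 u lam.
Hypothesis acf : abs_continuous_L2 0 T (fun t => f t (u t)) df.
Hypothesis mp1 : measurable_fun [set: measurableTypeR R] p1.
Hypothesis ip1 : mu.-integrable `[0, T] (EFin \o p1).
Hypothesis p1_ge0 : forall t, 0 <= p1 t.
Hypothesis p1E : {ae mu, forall t, t \in `[0, T] -> `|df t| ^+ 2 = p1 t}.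
Hypothesis mp2 : measurable_fun [set: measurableTypeR R] p2.
Hypothesis ip2 : mu.-integrable `[0, T] (EFin \o p2).
Hypothesis p2_ge0 : forall t, 0 <= p2 t.
Hypothesis p2E : {ae mu, forall t, t \in `[0, T] -> `|L (ddg t)| ^+ 2 = p2 t}.

Implicit Types (a b s t : R).

Let J s t := (\int[mu]_(r in `]s, t]) (p1 r + p2 r))%R.

Let integrable_itv (q : R -> R) s t : 0 <= s -> t <= T ->
  mu.-integrable `[0, T] (EFin \o q) -> mu.-integrable `]s, t] (EFin \o q).
Proof.
move=> s0 tT; apply: integrableS => //.
by move=> r /=; rewrite !in_itv/= => /andP[? ?]; apply/andP; split; lra.
Qed.

Let Rintegral_itv_le (q : R -> R) s t t' :
  measurable_fun [set: measurableTypeR R] q ->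
  0 <= s -> t <= t' -> t' <= T -> (forall r, 0 <= q r) ->
  mu.-integrable `[0, T] (EFin \o q) ->
  (\int[mu]_(r in `]s, t]) q r <= \int[mu]_(r in `]s, t']) q r)%R.
Proof.
move=> mq s0 tt tT q0 iq; rewrite /Rintegral fine_le//.
- by apply: integrable_fin_num => //; apply: integrable_itv => //; lra.
- by apply: integrable_fin_num => //; apply: integrable_itv => //; lra.
apply: ge0_subset_integral => //.
- by apply/measurable_EFinP; exact: measurable_funTS.
- by move=> r _; rewrite lee_fin.
- by move=> r /=; rewrite !in_itv/= => /andP[? ?]; apply/andP; split; lra.
Qed.

Let JE s t : 0 <= s -> t <= T ->
  J s t = ((\int[mu]_(r in `]s, t]) p1 r) + (\int[mu]_(r in `]s, t]) p2 r))%R.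
Proof. by move=> s0 tT; rewrite /J RintegralD//; exact: integrable_itv. Qed.

Lemma forcing_increment_bound s t t' : 0 <= s -> s <= t -> t <= t' -> t' <= T ->
  `|f t (u t) - f s (u s)| <= Num.sqrt ((t' - s) * (\int[mu]_(r in `]s, t']) p1 r)%R).
Proof.
move=> s0 st tt tT.
have [acx dx _] := acf.
rewrite -[X in X <= _]ger0_norm// -sqrtr_sqr ler_sqrt; last first.
  by rewrite mulr_ge0 ?Rintegral_ge0//; lra.
rewrite (le_trans (abs_continuous_increment_sqr acx dx ip1 p1E s0 st _))//; first lra.
apply: ler_pM; [lra|by apply: Rintegral_ge0|lra|].
exact: Rintegral_itv_le.
Qed.

Lemma lifting_increment_bound s t t' : 0 <= s -> s <= t -> t <= t' -> t' <= T ->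
  `|L (dg t) - L (dg s)| <= Num.sqrt ((t' - s) * (\int[mu]_(r in `]s, t']) p2 r)%R).
Proof.
move=> s0 st tt tT.
have [_ [_ [sddg _] wdg] _ cdg] := gH2.
rewrite -[X in X <= _]ger0_norm// -sqrtr_sqr ler_sqrt; last first.
  by rewrite mulr_ge0 ?Rintegral_ge0//; lra.
rewrite (le_trans (weak_derivative_increment_closed cdg wdg sddg mp2 p2_ge0 ip2 p2E s0 st _))//; first lra.
apply: ler_pM; [lra|by apply: Rintegral_ge0|lra|].
exact: Rintegral_itv_le.
Qed.

(** The lifting [B^- g] of the constraint data has the classical derivative
    [B^- dg] because [dg] is continuous. *)
Lemma lifting_is_derive a b w t : 0 <= a -> b <= T -> a < t < b ->
  is_derive t (1 : R) (fun s => inner (L (g s)) w) (inner (L (dg t)) w).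
Proof.
move=> a0 bT /andP[at_ tb]; have [[_ _ wg] _ cg cdg] := gH2.
have cdgc := clamp_continuous (ltW T0) cdg.
have cL : continuous (L \o (dg \o clamp 0 T)).
  move=> s; apply: continuous_comp; first exact: cdgc.
  exact: oper_continuous.
have := @weak_derivative_is_derive R (dual Q) 0 T t g dg (inner_oper L w)
  (fun s => inner (L (dg (clamp 0 T s))) w) cg wg.
rewrite clamp_id; last by apply/andP; split; lra.
apply.
- exact: (@continuous_inner R H (L \o (dg \o clamp 0 T)) w cL).
- by apply: aeW => s sT; rewrite clamp_id//; move: sT; rewrite in_itv.
- by apply/andP; split; lra.
Qed.

Section step.
Variables (a b : R) (un un1 : V) (L0 : R).
Hypothesis a0 : 0 <= a.
Hypothesis ab : a < b.
Hypothesis bT : b <= T.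
Hypothesis step : exp_euler_step i A B Bm f g dg a b un un1.
Hypothesis lip : `|f a un - f a (u a)| <= L0 * `|un - u a|.

Let rho := rate + 9 * L0 ^+ 2 / muA.

(** When [u - Bm g] is subtracted from [z + w], the terms [A (Bm g)] and the
    multipliers vanish against the kernel of [B], and the equation for [w]
    supplies the frozen right-hand side. *)
Lemma error_step :
  B (un1 - u b) = 0 /\
  E (un1 - u b) (un1 - u b) <=
    expR (rho * (b - a)) * (E (un - u a) (un - u a) + 9 / 2 * (b - a) ^+ 2 * J a b).
Proof.
have [a0' ab' bT'] : [/\ 0 <= a, a < b & b <= T] by [].
have [w [nu [z [m [wE Bw zsol ->]]]]] := step.
have [[_ _ wg] _ cg cdg] := gH2.
have cu : {within `[0, T], continuous u} by case: sol.
have cz : {within `[a, b], continuous z} by case: zsol.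
have za : z a = un - Bm (g a) - w by case: zsol => _ [_ []].
have cst0 (X : normedModType R) (y : X) (c e : R) : {within `[c, e], continuous (fun=> y)}.
  by move=> s; exact: cvg_cst.
have Bz t : a <= t <= b -> B (z t) = 0.
  by apply: (constraint_everywhere ab zsol); exact: cst0.
have Bu t : 0 <= t <= T -> B (u t) = g t by exact: (constraint_everywhere T0 sol).
pose d0 t := z t + w - u t + Bm (g t).
have d0E t : d0 t = z t + w + (- u t + BmO (g t)) by rewrite BmOE /d0 addrA.
have Bd0 t : a <= t <= b -> B (d0 t) = 0.
  move=> /andP[at_ tb]; rewrite /d0 linearD linearB linearD /=.
  rewrite Bz ?at_// Bw (right_inverseK Bm_inv) Bu ?addr0 ?sub0r ?addNr//.
  by apply/andP; split; lra.
have da : d0 a = un - u a.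
  by rewrite /d0 za subrK addrAC subrK.
have db : d0 b = Bm (g b) + z b + w - u b.
  by rewrite /d0 addrC !addrA.
pose c := clamp a b.
have cE t : a <= t <= b -> c t = t by exact: clamp_id.
pose d t := d0 (c t).
have cfu : {within `[a, b], continuous (fun t => f t (u t))}.
  apply: within_continuous_sub a0 bT _; case: acf => acx _ _.
  exact: abs_continuous_within.
have czc : continuous (z \o c) by exact: clamp_continuous (ltW ab) cz.
have cuc : continuous (u \o c).
  exact: clamp_continuous (ltW ab) (within_continuous_sub a0 bT cu).
have cgc : continuous (g \o c).
  exact: clamp_continuous (ltW ab) (within_continuous_sub a0 bT cg).
have cdgc : continuous (dg \o c).
  exact: clamp_continuous (ltW ab) (within_continuous_sub a0 bT cdg).
have cfc : continuous ((fun t => f t (u t)) \o c) by exact: clamp_continuous (ltW ab) cfu.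
have cd : continuous d.
  have -> : d = (fun t => ((z \o c) t + w) + (- (u \o c) t + (BmO \o (g \o c)) t)).
    by apply/funext => t; rewrite /d d0E.
  move=> t; apply: (@continuousD _ _ _ (fun t => (z \o c) t + w)
      (fun t => - (u \o c) t + (BmO \o (g \o c)) t)).
    by apply: (@continuousD _ _ _ (z \o c) (fun=> w)); [exact: czc|exact: cst_continuous].
  apply: (@continuousD _ _ _ (fun t => - (u \o c) t) (BmO \o (g \o c))).
    by apply: (@continuousN _ _ _ (u \o c)); exact: cuc.
  by apply: continuous_comp; [exact: cgc|exact: oper_continuous].
pose F t := f a un - f (c t) (u (c t)) + (L (dg (c t)) - L (dg a)).
have cF : continuous F.
  move=> t; apply: (@continuousD _ _ _ (fun t => f a un - ((fun t => f t (u t)) \o c) t)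
      (fun t => (L \o (dg \o c)) t - L (dg a))).
    apply: (@continuousB _ _ _ (fun=> f a un) ((fun t => f t (u t)) \o c)).
      exact: cst_continuous.
    exact: cfc.
  apply: (@continuousB _ _ _ (L \o (dg \o c)) (fun=> L (dg a))).
    by apply: continuous_comp; [exact: cdgc|exact: oper_continuous].
  exact: cst_continuous.
pose M := L0 * `|un - u a| + Num.sqrt ((b - a) * (\int[mu]_(r in `]a, b]) p1 r)%R)
  + Num.sqrt ((b - a) * (\int[mu]_(r in `]a, b]) p2 r)%R).
have FM t : a <= t <= b -> `|F t| <= M.
  move=> /[dup] /andP[at_ tb] tab; rewrite /F cE//.
  have h1 := forcing_increment_bound a0 at_ tb bT.
  have h2 := lifting_increment_bound a0 at_ tb bT.
  have -> : f a un - f t (u t) = (f a un - f a (u a)) + - (f t (u t) - f a (u a)).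
    by rewrite opprB addrA subrK.
  rewrite (le_trans (ler_normD _ _))// lerD//.
  rewrite (le_trans (ler_normD _ _))// normrN lerD//.
have eq_d v : B v = 0 -> forall t, a < t < b ->
  is_derive t (1 : R) (fun s => inner (i (d s)) (i v))
    (- A (d t) v + inner (F t) (i v)).
  move=> Bv t tab; have /andP[at_ tb] := tab.
  have tab' : a <= t <= b by rewrite !ltW.
  have tT : 0 < t < T by apply/andP; split; lra.
  have cfT : {within `[0, T], continuous (fun t => f t (u t))}.
    by case: acf => acx _ _; exact: abs_continuous_within.
  have hz := kernel_equation ab zsol Bv (cst0 _ _ _ _) tab.
  have hu := kernel_equation T0 sol Bv cfT tT.
  have hg := lifting_is_derive (i v) a0 bT tab.
  have hw := is_derive_cst (inner (i w) (i v)) t (1 : R).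
  have hsum := is_deriveD (is_deriveD hz hw) (is_deriveB hg hu).
  have Awv : A w v = inner (f a un - L (dg a)) (i v).
    have := congr1 (fun l : dual V => l v) wE; rewrite -LE => h.
    rewrite -[RHS]/(embed_dual i (f a un - L (dg a)) v) -h.
    have Bvn : B v nu = 0 :> R by rewrite Bv.
    by rewrite [RHS]/((A w v : R) + (B v nu : R)) Bvn; exact: (esym (addr0 _)).
  have Agv : A (Bm (g t)) v = 0 by exact: (right_inverse_orth Bm_inv).
  have E1 : A (d t) v = A (z t) v + A w v - A (u t) v.
    by rewrite /d cE// /d0 operDl operBl operDl Agv addr0.
  apply: (@is_derive_eq _ _ _ _ _ _ _ (- A (z t) v + inner 0 (i v) + 0 +
      (inner (L (dg t)) (i v) - (- A (u t) v + inner (f t (u t)) (i v))))); last first.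
    rewrite E1 Awv inner0l /F cE// !innerDl !innerNl; ring.
  apply: near_eq_is_derive hsum; near=> s.
  have cs : c s = s by near: s; exact: clamp_near.
  rewrite /d cs /d0; rewrite /= linearD linearB linearD/= -LE !innerDl innerNl.
  have swap (X1 X2 X3 X4 : R) : X1 + X2 + (X3 - X4) = X1 + X2 - X4 + X3 by ring.
  exact: swap.
have Bd t : B (d t) = 0 by apply: Bd0; exact: (clamp_in _ (ltW ab)).
split.
  by rewrite -db Bd0// lexx ltW.
have := energy_estimate mu0 sp Aell ab cd cF Bd FM eq_d.
have [ca cb] : c a = a /\ c b = b by rewrite !cE ?lexx ?ltW.
rewrite /d ca cb db da => h; apply: (le_trans h).
set E0 := E (un - u a) (un - u a).
have Be : B (un - u a) = 0 by rewrite -da Bd0// lexx ltW.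
have E0X : `|un - u a| ^+ 2 <= 2 / muA * E0.
  have := energy_form_coercive mu0 sp (Aell Be); rewrite -/E0 => k.
  rewrite -(ler_pM2l (_ : 0 < muA / 2)) ?divr_gt0//; apply: (le_trans k).
  by rewrite mulrA (_ : muA / 2 * (2 / muA) = 1) ?mul1r//; field; rewrite gt_eqF.
have tau0 : 0 < b - a by rewrite subr_gt0.
have I1 : 0 <= (b - a) * (\int[mu]_(r in `]a, b]) p1 r)%R.
  by rewrite mulr_ge0 ?(ltW tau0)// Rintegral_ge0.
have I2 : 0 <= (b - a) * (\int[mu]_(r in `]a, b]) p2 r)%R.
  by rewrite mulr_ge0 ?(ltW tau0)// Rintegral_ge0.
have M2 : M ^+ 2 <= 3 * (L0 ^+ 2 * (2 / muA * E0) + (b - a) * J a b).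
  apply: (le_trans (sqr_sum3 _ _ _)); rewrite !sqr_sqrtr// JE// [(b - a) * (_ + _)]mulrDr addrA.
  by rewrite ler_wpM2l// !lerD2r exprMn ler_wpM2l// sqr_ge0.
have E0_ge0 : 0 <= E0.
  by move: E0X; move/(le_trans (sqr_ge0 _)); rewrite pmulr_rge0// divr_gt0.
have J_ge0 : 0 <= J a b.
  by apply: Rintegral_ge0 => r _; rewrite addr_ge0.
exact: growth_absorb mu0 tau0 E0_ge0 J_ge0 M2.
Unshelve. all: by end_near. Qed.
End step.

Let J_add s t : 0 <= s -> s <= t -> t <= T -> J 0 t = J 0 s + J s t.
Proof.
move=> s0 st tT; rewrite /J.
have ip : mu.-integrable `[0, T] (EFin \o (fun r => p1 r + p2 r)).
  rewrite (_ : _ \o _ = (EFin \o p1) \+ (EFin \o p2))%E; last by apply/funext.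
  exact: integrableD.
have -> : `]0, t]%classic = `]0, s] `|` `]s, t].
  by rewrite -itv_bndbnd_setU// bnd_simp.
rewrite Rintegral_setU//.
- apply: integrableS ip => //; first exact: measurableU.
  by move=> r /= []; rewrite !in_itv/= => /andP[? ?]; apply/andP; split; lra.
- by apply/disj_setPS => r /= []; rewrite !in_itv/= => /andP[? ?] /andP[? ?]; lra.
Qed.

Let J_ge0 s t : 0 <= J s t.
Proof. by apply: Rintegral_ge0 => r _; rewrite addr_ge0. Qed.

(** The exponential factor is at least [1], so it also dominates the contribution
    of the last step. *)
Lemma error_recursion (N : nat) (un : nat -> V) (L0 : R) :
  (0 < N)%N -> exp_euler i A B Bm f g dg T N u0 un ->
  lipschitz_in_strip T f u N (grid T N) un L0 ->
  forall n, (n <= N)%N -> let e := un n - u (grid T N n) in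
  B e = 0 /\
  E e e <= expR ((rate + 9 * L0 ^+ 2 / muA) * grid T N n) *
    (9 / 2 * (T / N%:R) ^+ 2 * J 0 (grid T N n)).
Proof.
move=> N0 [un0 step] [r [r0 lip strip]].
have NR0 : 0 < N%:R :> R by rewrite ltr0n.
pose tau := T / N%:R; have tau0 : 0 < tau by rewrite divr_gt0.
have gridS n : grid T N n.+1 - grid T N n = tau.
  by rewrite /grid -mulrBl -natrB// subSnn mul1r.
have grid0 n : 0 <= grid T N n by rewrite mulr_ge0// ltW.
have gridT n : (n <= N)%N -> grid T N n <= T.
  move=> nN; rewrite /grid mulrA ler_pdivrMr// mulrC ler_wpM2l ?(ltW T0)//.
  by rewrite ler_nat.
have rho0 : 0 <= rate + 9 * L0 ^+ 2 / muA.
  rewrite addr_ge0 ?energy_rate_ge0// divr_ge0 ?(ltW mu0)// mulr_ge0//.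
  exact: sqr_ge0.
set rho := rate + _ in rho0 *.
elim=> [_|n IH nN].
  have -> : grid T N 0 = 0 by rewrite /grid mul0r.
  have u00 : u 0 = u0 by case: sol => _ [_ []].
  rewrite un0 u00 subrr /=; split; first by rewrite linear0.
  rewrite (form_0l (energy_formP i A1 A2 muA)) mulr_ge0 ?expR_ge0//.
  by rewrite mulr_ge0// mulr_ge0// sqr_ge0.
have [Be IHE] := IH (ltnW nN).
have tn : grid T N n \in `[0, T] by rewrite in_itv/= grid0 gridT// ltnW.
have lipn : `|f (grid T N n) (un n) - f (grid T N n) (u (grid T N n))| <=
    L0 * `|un n - u (grid T N n)|.
  by apply: lip => //; [apply: strip; exact: ltnW|rewrite subrr normr0].
have ab : grid T N n < grid T N n.+1 by rewrite -subr_gt0 gridS.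
have [B1 E1] := error_step (grid0 n) ab (gridT _ nN) (step n nN) lipn.
split=> //; apply: (le_trans E1).
rewrite -/rho gridS (J_add (grid0 n) (ltW ab) (gridT _ nN)).
have -> : grid T N n.+1 = tau + grid T N n by rewrite -(gridS n) subrK.
rewrite [rho * (_ + _)]mulrDr expRD -[expR _ * expR _ * _]mulrA.
rewrite ler_wpM2l ?expR_ge0// [9 / 2 * _ * (_ + _)]mulrDr.
rewrite [expR _ * (_ + _)]mulrDr lerD//.
rewrite ler_peMl//; last by rewrite -[X in X <= _]expR0 ler_expR mulr_ge0.
by rewrite mulr_ge0// mulr_ge0// sqr_ge0.
Qed.

End error_recursion.
(** * The error bound *)

Unset Implicit Arguments.
Set Strict Implicit.

Theorem theorem3p3 (R : realType) (V H : hilbertType R) (i : oper V H)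
    (A A1 : oper V (dual V)) (A2 : oper V H) (muA : R) :
  gelfand_triple i ->
  splitting i A A1 A2 ->
  0 < muA ->
  exists C : R -> R -> R,
  forall (Q : hilbertType R) (B : oper V (dual Q)) (Bm : dual Q -> V)
    (T : R) (u0 : V) (g dg ddg : R -> dual Q) (f : R -> V -> H)
    (u : R -> V) (lam : R -> Q) (df : R -> H)
    (N : nat) (un : nat -> V) (L : R),
  assumption_B B ->
  elliptic_on A (operator_kernel B) muA ->
  right_inverse_onto_Vc A B Bm ->
  0 < T ->
  B u0 = g 0 ->
  bochner_H2 0 T g dg ddg ->
  caratheodory T f ->
  linear_growth T f ->
  locally_lipschitz T f ->
  constrained_solution i A B 0 T (fun t => f t (u t)) g u0 u lam ->
  abs_continuous_L2 0 T (fun t => f t (u t)) df ->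
  (0 < N)%N ->
  exp_euler i A B Bm f g dg T N u0 un ->
  0 < L ->
  lipschitz_in_strip T f u N (grid T N) un L ->
  forall n, (n <= N)%N ->
  ((`|un n - u (grid T N n)| ^+ 2)%:E <=
   (C (grid T N n) L * (T / N%:R) ^+ 2)%:E *
   \int[@lebesgue_measure R]_(t in `[0%R, grid T N n])
     (`|df t| ^+ 2 + `|i (Bm (ddg t))| ^+ 2)%:E)%E.
Proof.
move=> _ sp mu0.
exists (fun t L => 9 / muA * expR ((energy_rate i A2 muA + 9 * L ^+ 2 / muA) * t)).
move=> Q B Bm T u0 g dg ddg f u lam df N un L HB Aell Bminv T0 _ gH2 _ _ _ sol
  acf N0 scheme L0 strip n nN.
set mu := @lebesgue_measure R.
have [c c0 Bmc] := right_inverse_bounded mu0 Aell Bminv HB.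
have BmP : Bm \in @oper_pred R (dual Q) V.
  by apply: (@oper_subproof _ _ _ _ c) => // h k q; exact: (right_inverseP mu0 Aell Bminv).
pose BmO := Oper BmP.
have LP : (i \o Bm) \in @oper_pred R (dual Q) H.
  apply: (@oper_subproof _ _ _ _ (opnorm i * c)) => [h k q|h].
    by rewrite /= (right_inverseP mu0 Aell Bminv) linearP.
  rewrite (le_trans (oper_bound i _))// -mulrA ler_wpM2l ?opnorm_ge0//.
pose Lo := Oper LP.
have sqr_norm_continuous (X : normedModType R) : continuous (fun v : X => `|v| ^+ 2).
  move=> v; apply: (@continuous_comp X R R (fun v => `|v|) (fun z => z ^+ 2)).
    exact: norm_continuous.
  exact: exprn_continuous.
have [p1 [mp1 p1_ge0 ip1 p1E]] : exists p : R -> R, [/\ measurable_fun [set: measurableTypeR R] p,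
    forall t, 0 <= p t, mu.-integrable `[0, T] (EFin \o p) &
    {ae mu, forall t, t \in `[0, T] -> `|df t| ^+ 2 = p t}].
  apply: (@bochner_L2_borel R H 0 T df (fun v => `|v| ^+ 2) 1) => //.
  - by case: acf.
  - by move=> v; rewrite mul1r lexx sqr_ge0.
have [p2 [mp2 p2_ge0 ip2 p2E]] : exists p : R -> R, [/\ measurable_fun [set: measurableTypeR R] p,
    forall t, 0 <= p t, mu.-integrable `[0, T] (EFin \o p) &
    {ae mu, forall t, t \in `[0, T] -> `|Lo (ddg t)| ^+ 2 = p t}].
  apply: (@bochner_L2_borel R (dual Q) 0 T ddg (fun h => `|Lo h| ^+ 2) (opnorm Lo ^+ 2)).
  - by case: gH2 => _ [].
  - move=> h; apply: (@continuous_comp _ _ _ Lo (fun v => `|v| ^+ 2)).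
      exact: oper_continuous.
    exact: sqr_norm_continuous.
  - exact: sqr_ge0.
  - move=> h; rewrite sqr_ge0/= -exprMn lerXn2r ?nnegrE//.
      by rewrite mulr_ge0// opnorm_ge0.
    exact: (oper_bound Lo h).
have [Be Ee] := error_recursion mu0 sp Aell Bminv (BmO := BmO) (fun=> erefl)
  (L := Lo) (fun=> erefl) T0 gH2 sol acf mp1 ip1 p1_ge0 p1E mp2 ip2 p2_ge0 p2E
  N0 scheme strip nN.
set e := un n - _ in Be Ee *; set t := grid T N n in Ee *.
set J := (\int[mu]_(r in _) _)%R in Ee.
have t0 : 0 <= t by rewrite mulr_ge0// divr_ge0// ltW.
have tT : t <= T.
  rewrite /t /grid mulrA ler_pdivrMr ?ltr0n// mulrC ler_wpM2l ?(ltW T0)//.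
  by rewrite ler_nat.
(* The factor [2 / muA] from the coercivity of [E] turns [9 / 2] into [9 / muA]. *)
have eJ : `|e| ^+ 2 <= 9 / muA * expR ((energy_rate i A2 muA + 9 * L ^+ 2 / muA) * t) *
    (T / N%:R) ^+ 2 * J.
  rewrite -(ler_pM2l (_ : 0 < muA / 2)) ?divr_gt0//.
  apply: (le_trans (energy_form_coercive mu0 sp (Aell _ Be))); apply: (le_trans Ee).
  by rewrite le_eqVlt; apply/orP; left; apply/eqP; field; rewrite !gt_eqF// ltr0n.
apply: (@le_trans _ _ ((9 / muA * expR ((energy_rate i A2 muA + 9 * L ^+ 2 / muA) * t) *
    (T / N%:R) ^+ 2)%:E * J%:E)%E); first by rewrite -EFinM lee_fin.
apply: lee_wpmul2l.
  by rewrite lee_fin mulr_ge0 ?sqr_ge0// mulr_ge0 ?expR_ge0// divr_ge0// ltW.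
have ip : mu.-integrable `[0, T] (EFin \o (fun r => p1 r + p2 r)).
  rewrite (_ : _ \o _ = (EFin \o p1) \+ (EFin \o p2))%E; last by apply/funext.
  exact: integrableD.
have ipt : mu.-integrable `]0, t] (EFin \o (fun r => p1 r + p2 r)).
  apply: integrableS ip => //.
  by move=> r /=; rewrite !in_itv/= => /andP[r0 rt]; rewrite ltW//= (le_trans rt).
have mp : measurable_fun [set: measurableTypeR R] (fun r => p1 r + p2 r).
  exact: measurable_funD.
have -> : J%:E = (\int[mu]_(r in `]0%R, t]) (p1 r + p2 r)%:E)%E.
  by rewrite /J /Rintegral fineK//; exact: integrable_fin_num.
apply: (@le_trans _ _ (\int[mu]_(r in `[0%R, t]) (p1 r + p2 r)%:E)%E).
  apply: ge0_subset_integral => //.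
  - by apply/measurable_EFinP; exact: measurable_funTS.
  - by move=> r _; rewrite lee_fin addr_ge0.
  - by move=> r /=; rewrite !in_itv/= => /andP[/ltW -> ->].
apply: ae_le_integral => //.
- by apply/measurable_EFinP; exact: measurable_funTS.
- by move=> r _; rewrite lee_fin addr_ge0.
apply: aeS (aeI p1E p2E) => r [h1 h2] /=; rewrite in_itv/= => /andP[r0 rt].
have rT : r \in `[0, T] by rewrite in_itv/= r0 (le_trans rt tT).
by rewrite lee_fin -h1// -h2.
Qed.
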